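(* Let $A$ be the $k$-algebra of $n$-truncated simplicial objects and $A^b$ the $k$-algebra of chain complexes concentrated in degrees $1,\dots,n$. The truncated Dold–Kan correspondence (the equivalence, for an abelian category $\mathcal{A}$, between the category of $n$-truncated simplicial objects in $\mathcal{A}$ and the category of chain complexes in $\mathcal{A}$ concentrated in degrees $1,2,\dots,n$) is induced from the functor $$R=\mathrm{Hom}_{A^b}(P,-):\mathrm{Mod}(A^b)\to\mathrm{Mod}(A),\qquad P=\bigoplus_{j=1}^n\bigoplus_{i=1}^{j}P_i^{\oplus T_{ij}},$$ where $P_i$ is the indecomposable projective $A^b$-module at the vertex $i$, and $T$ is the upper-triangular integer matrix obtained from Pascal's (Jia Xian's) triangle, $T_{ij}=\binom{j-1}{i-1}$ for $1\le i\le j\le n$.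
   Context: $k$ is a fixed PID and abelian categories $\mathcal{A}$ are taken $k$-linear (for instance $k=\mathbb{Z}$). $\mathrm{Mod}$ denotes finitely generated left modules, and paths compose right to left. The algebra $A$ is the path algebra over $k$ of the quiver with vertices $1,\dots,n$ and, for each $2\le m\le n$, arrows $\pi_1,\dots,\pi_m:m\to m-1$ and $\iota_1,\dots,\iota_{m-1}:m-1\to m$, modulo the simplicial relations (wherever the composites are defined): $\pi_j\pi_i=\pi_{i-1}\pi_j$ if $j<i$; $\pi_j\iota_i=\iota_{i-1}\pi_j$ if $j<i$, $\pi_j\iota_i=e_*$ (the trivial path at the appropriate vertex) if $j=i$ or $j=i+1$, and $\pi_j\iota_i=\iota_i\pi_{j-1}$ if $j>i+1$; $\iota_j\iota_i=\iota_i\iota_{j-1}$ if $j>i$. The algebra $A^b$ is the path algebra over $k$ of the linear quiver $n\xrightarrow{d}n-1\xrightarrow{d}\cdots\xrightarrow{d}2\xrightarrow{d}1$ modulo the relations $dd=0$. Here $P_i=A^be_i$. Representations of $A$ (respectively $A^b$) in $\mathcal{A}$, i.e. $k$-algebra morphisms into $\mathrm{End}_{\mathcal{A}}(M)$ with $M\in\mathcal{A}$, are the same as $n$-truncated simplicial objects in $\mathcal{A}$ (respectively chain complexes in $\mathcal{A}$ in degrees $1,\dots,n$). ''Induced from $R$'' means: $A\cong\mathrm{End}_{A^b}(P)^{\mathrm{op}}$ with the idempotent $e_j\in A$ corresponding to the summand $\bigoplus_iP_i^{\oplus T_{ij}}$ of $P$, $R$ is an equivalence of categories, and the equivalence of representation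 categories in $\mathcal{A}$ is the one induced by this Morita equivalence. In particular, the value at vertex $j$ of the simplicial object associated with a complex $C$ is $\bigoplus_iC_i^{\oplus T_{ij}}$. *)

(* Defs.v *)
From HB Require Import structures.
From mathcomp Require Import all_boot all_algebra.
From mathcomp Require Import finmap boolp monalg.

Set Implicit Arguments.
Unset Strict Implicit.
Unset Printing Implicit Defensive.

Import GRing.Theory.
Local Open Scope quotient_scope.
Local Open Scope ring_scope.

Definition is_ideal (k : comNzRingType) (I : k -> Prop) : Prop :=
  [/\ I 0, (forall x y, I x -> I y -> I (x + y))
    & (forall a x, I x -> I (a * x))].

Definition is_PID (k : idomainType) : Prop :=
  forall I : k -> Prop, is_ideal I ->
    exists a : k, forall x, I x <-> exists c, x = c * a.

(* The algType of MathComp excludes the zero algebra, hence the endomorphism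
   algebra of a zero object; here a k-algebra is a possibly zero ring with a
   central ring morphism from k.                                              *)
HB.mixin Record isKAlgebra (k : comNzRingType) A of GRing.PzRing A := {
  kscalar : k -> A;
  kscalarD : {morph kscalar : x y / x + y};
  kscalarM : {morph kscalar : x y / x * y};
  kscalar1 : kscalar 1 = 1;
  kscalarC : forall (c : k) (x : A), kscalar c * x = x * kscalar c;
}.
#[short(type="kalgType")]
HB.structure Definition KAlgebra (k : comNzRingType) :=
  {A of isKAlgebra k A & GRing.PzRing A}.

Record alghom (k : comNzRingType) (A B : kalgType k) := AlgHom {
  alghom_fun :> {rmorphism A -> B};
  alghom_scalar : forall c : k, alghom_fun (kscalar c) = kscalar c
}.

Section AlgebraQuotient.
Context (k : comNzRingType) (B : kalgType k) (S : B -> Prop).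

Inductive ideal_gen : B -> Prop :=
| IG_gen x : S x -> ideal_gen x
| IG_0 : ideal_gen 0
| IG_add x y : ideal_gen x -> ideal_gen y -> ideal_gen (x + y)
| IG_mull a x : ideal_gen x -> ideal_gen (a * x)
| IG_mulr a x : ideal_gen x -> ideal_gen (x * a).

Lemma ideal_genN x : ideal_gen x -> ideal_gen (- x).
Proof. by rewrite -mulN1r; apply: IG_mull. Qed.

Definition ideal_rel (x y : B) : bool := `[< ideal_gen (x - y) >].

Lemma ideal_rel_equiv : equiv_class_of ideal_rel.
Proof.
split=> [x|x y|y x z]; rewrite /ideal_rel.
- by apply/asboolP; rewrite subrr; apply: IG_0.
- by apply/asboolP/asboolP => /ideal_genN; rewrite opprB.
- move=> /asboolP Ixy /asboolP Iyz; apply/asboolP.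
  by rewrite -(subrKA y); apply: IG_add.
Qed.

Canonical ideal_equiv := EquivRelPack ideal_rel_equiv.

Definition alg_quot : Type := {eq_quot ideal_rel}%qT.
HB.instance Definition _ := Choice.on alg_quot.

Definition to_quot (x : B) : alg_quot := \pi_({eq_quot ideal_rel})%qT x.
Definition of_quot (x : alg_quot) : B := repr x.

Lemma of_quotK x : to_quot (of_quot x) = x.
Proof. exact: reprK. Qed.

Lemma to_quot_eq x y : to_quot x = to_quot y <-> ideal_gen (x - y).
Proof.
split=> [/eqmodP|Ixy]; first by move/asboolP.
by apply/eqmodP; apply/asboolP.
Qed.

Lemma repr_rel x : ideal_gen (of_quot (to_quot x) - x).
Proof. by apply/to_quot_eq; rewrite of_quotK. Qed.

Definition quot_add (x y : alg_quot) := to_quot (of_quot x + of_quot y).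
Definition quot_opp (x : alg_quot) := to_quot (- of_quot x).
Definition quot_mul (x y : alg_quot) := to_quot (of_quot x * of_quot y).

Lemma to_quotD x y : quot_add (to_quot x) (to_quot y) = to_quot (x + y).
Proof.
by apply/to_quot_eq; rewrite opprD addrACA; apply: IG_add; apply: repr_rel.
Qed.

Lemma to_quotN x : quot_opp (to_quot x) = to_quot (- x).
Proof. by apply/to_quot_eq; rewrite -opprD; apply/ideal_genN/repr_rel. Qed.

Lemma to_quotM x y : quot_mul (to_quot x) (to_quot y) = to_quot (x * y).
Proof.
apply/to_quot_eq; set x' := of_quot _; set y' := of_quot _.
have -> : x' * y' - x * y = (x' - x) * y' + x * (y' - y).
  by rewrite mulrBl mulrBr subrKA.
by apply: IG_add; [apply: IG_mulr | apply: IG_mull]; apply: repr_rel.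
Qed.

Lemma quot_ind (P : alg_quot -> Prop) : (forall x, P (to_quot x)) -> forall x, P x.
Proof. by move=> H x; rewrite -(of_quotK x). Qed.

Fact quot_addA : associative quot_add.
Proof.
by elim/quot_ind=> x; elim/quot_ind=> y; elim/quot_ind=> z; rewrite !to_quotD addrA.
Qed.
Fact quot_addC : commutative quot_add.
Proof. by elim/quot_ind=> x; elim/quot_ind=> y; rewrite !to_quotD addrC. Qed.
Fact quot_add0 : left_id (to_quot 0) quot_add.
Proof. by elim/quot_ind=> x; rewrite to_quotD add0r. Qed.
Fact quot_addN : left_inverse (to_quot 0) quot_opp quot_add.
Proof. by elim/quot_ind=> x; rewrite to_quotN to_quotD addNr. Qed.
HB.instance Definition _ := GRing.isZmodule.Build alg_quot
  quot_addA quot_addC quot_add0 quot_addN.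

Fact quot_mulA : associative quot_mul.
Proof.
by elim/quot_ind=> x; elim/quot_ind=> y; elim/quot_ind=> z; rewrite !to_quotM mulrA.
Qed.
Fact quot_mul1 : left_id (to_quot 1) quot_mul.
Proof. by elim/quot_ind=> x; rewrite to_quotM mul1r. Qed.
Fact quot_1mul : right_id (to_quot 1) quot_mul.
Proof. by elim/quot_ind=> x; rewrite to_quotM mulr1. Qed.
Fact quot_mulDl : left_distributive quot_mul +%R.
Proof.
elim/quot_ind=> x; elim/quot_ind=> y; elim/quot_ind=> z.
by rewrite [LHS](congr1 (quot_mul^~ _) (to_quotD _ _)) !to_quotM mulrDl -to_quotD.
Qed.
Fact quot_mulDr : right_distributive quot_mul +%R.
Proof.
elim/quot_ind=> x; elim/quot_ind=> y; elim/quot_ind=> z.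
by rewrite [LHS](congr1 (quot_mul _) (to_quotD _ _)) !to_quotM mulrDr -to_quotD.
Qed.
HB.instance Definition _ := GRing.Zmodule_isPzRing.Build alg_quot
  quot_mulA quot_mul1 quot_1mul quot_mulDl quot_mulDr.

Definition quot_scalar (c : k) : alg_quot := to_quot (kscalar c).
Fact quot_scalarD : {morph quot_scalar : x y / x + y}.
Proof. by move=> x y; rewrite /quot_scalar kscalarD -to_quotD. Qed.
Fact quot_scalarM : {morph quot_scalar : x y / x * y}.
Proof. by move=> x y; rewrite /quot_scalar kscalarM -to_quotM. Qed.
Fact quot_scalar1 : quot_scalar 1 = 1.
Proof. by rewrite /quot_scalar kscalar1. Qed.
Fact quot_scalarC (c : k) (x : alg_quot) : quot_scalar c * x = x * quot_scalar c.
Proof.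
elim/quot_ind: x => x.
by rewrite [LHS]to_quotM [RHS]to_quotM kscalarC.
Qed.
HB.instance Definition _ := isKAlgebra.Build k alg_quot
  quot_scalarD quot_scalarM quot_scalar1 quot_scalarC.

End AlgebraQuotient.

Record quiver := Quiver {
  vertex :> finType;
  arrow : vertex -> vertex -> Type
}.
Arguments arrow {q} u v : rename.

(* [path_cons a p] is the path a p: first p, then a. *)
Inductive qpath (Q : quiver) (u : Q) : Q -> Type :=
| path_nil : qpath u u
| path_cons v w : arrow v w -> qpath u v -> qpath u w.
Arguments qpath {Q} u v.
Arguments path_nil {Q} u.
Arguments path_cons {Q u v w} a p.

Fixpoint path_comp (Q : quiver) (u v w : Q) (q : qpath v w) (p : qpath u v) : qpath u w :=
  match q in qpath _ w return qpath u w with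
  | path_nil => p
  | path_cons _ _ a q' => path_cons a (path_comp q' p)
  end.

Lemma path_comp_nil (Q : quiver) (u v : Q) (p : qpath u v) :
  path_comp p (path_nil u) = p.
Proof. by elim: p => //= w w' a p ->. Qed.

Lemma path_compA (Q : quiver) (u v w x : Q) (r : qpath w x) (q : qpath v w)
    (p : qpath u v) :
  path_comp r (path_comp q p) = path_comp (path_comp r q) p.
Proof. by elim: r q => //= y z a r IH q; rewrite IH. Qed.

Definition anypath (Q : quiver) := {classic {u : Q & {v : Q & qpath u v}}}.
Definition Anypath (Q : quiver) (u v : Q) (p : qpath u v) : anypath Q :=
  existT _ u (existT _ v p).

(* q p if p ends where q starts *)
Definition anypath_comp (Q : quiver) (q p : anypath Q) : option (anypath Q) :=
  let: existT u (existT v p) := p in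
  let: existT v' (existT w q) := q in
  if v' =P v is ReflectT e then
    Some (Anypath (path_comp (ecast x (qpath x w) e q) p))
  else None.
Arguments anypath_comp {Q} q p.

Lemma anypath_compE (Q : quiver) (u v w : Q) (q : qpath v w) (p : qpath u v) :
  anypath_comp (Anypath q) (Anypath p) = Some (Anypath (path_comp q p)).
Proof. by rewrite /=; case: eqP => // e; rewrite eq_axiomK. Qed.

Lemma anypath_comp_neq (Q : quiver) (u v v' w : Q) (q : qpath v' w) (p : qpath u v) :
  v' <> v -> anypath_comp (Anypath q) (Anypath p) = None.
Proof. by rewrite /=; case: eqP. Qed.

Lemma anypath_compA (Q : quiver) (r q p : anypath Q) :
  obind (anypath_comp r) (anypath_comp q p)
  = obind (anypath_comp^~ p) (anypath_comp r q).
Proof.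
case: p q r => u [v p] [v' [w q]] [w' [x r]].
rewrite -/(Anypath p) -/(Anypath q) -/(Anypath r).
have [ev|nv] := eqVneq v' v; have [ew|nw] := eqVneq w' w; subst.
- rewrite !anypath_compE /obind /oapp !anypath_compE; do 2!f_equal.
  exact: path_compA.
- rewrite anypath_compE /obind /oapp !anypath_comp_neq //; exact/eqP.
- by rewrite anypath_compE /obind /oapp !anypath_comp_neq //; apply/eqP.
- by rewrite /obind /oapp !anypath_comp_neq //; apply/eqP.
Qed.

Definition path_alg (k : idomainType) (Q : quiver) : Type := {malg k[anypath Q]}.

Section PathAlgebra.
Context (k : idomainType) (Q : quiver).
Local Notation kQ := (path_alg k Q).

HB.instance Definition _ := GRing.Lmodule.on kQ.

Definition path_elt (u v : Q) (p : qpath u v) : kQ := << Anypath p >>.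

Definition basis_mul (q p : anypath Q) : kQ :=
  oapp (fun r => << r >> : kQ) 0 (anypath_comp q p).

Definition path_mul (x y : kQ) : kQ :=
  \sum_(q <- msupp x) \sum_(p <- msupp y) (x@_q * y@_p) *: basis_mul q p.

Definition path_one : kQ := \sum_(v : Q) path_elt (path_nil v).

Lemma path_mulw (d1 d2 : {fset anypath Q}) (x y : kQ) :
  (msupp x `<=` d1)%fset -> (msupp y `<=` d2)%fset ->
  path_mul x y = \sum_(q <- d1) \sum_(p <- d2) (x@_q * y@_p) *: basis_mul q p.
Proof.
move=> le1 le2; rewrite /path_mul (big_fset_incl _ le1) /=.
  apply: eq_bigr => q _; apply: big_fset_incl => // p _ /mcoeff_outdom ->.
  by rewrite mulr0 scale0r.
move=> q _ /mcoeff_outdom xq.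
by rewrite big1 // => p _; rewrite xq mul0r scale0r.
Qed.

Lemma path_mulDl : left_distributive path_mul +%R.
Proof.
move=> x y z.
rewrite (path_mulw (msuppD_le x y) (fsubset_refl _)).
rewrite (path_mulw (fsubsetUl _ (msupp y)) (fsubset_refl (msupp z))).
rewrite (path_mulw (fsubsetUr (msupp x) _) (fsubset_refl (msupp z))).
rewrite -big_split /=; apply: eq_bigr => q _.
rewrite -big_split /=; apply: eq_bigr => p _.
by rewrite mcoeffD mulrDl scalerDl.
Qed.

Lemma path_mulDr : right_distributive path_mul +%R.
Proof.
move=> x y z.
rewrite (path_mulw (fsubset_refl _) (msuppD_le y z)).
rewrite (path_mulw (fsubset_refl _) (fsubsetUl _ (msupp z))).
rewrite (path_mulw (fsubset_refl _) (fsubsetUr (msupp y) _)).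
rewrite -big_split /=; apply: eq_bigr => q _.
rewrite -big_split /=; apply: eq_bigr => p _.
by rewrite mcoeffD mulrDr scalerDl.
Qed.

Lemma path_mulZl c x y : path_mul (c *: x) y = c *: path_mul x y.
Proof.
rewrite (path_mulw (msuppZ_le c x) (fsubset_refl _)) scaler_sumr.
apply: eq_bigr => q _; rewrite scaler_sumr; apply: eq_bigr => p _.
by rewrite mcoeffZ scalerA mulrA.
Qed.

Lemma path_mulZr c x y : path_mul x (c *: y) = c *: path_mul x y.
Proof.
rewrite (path_mulw (fsubset_refl _) (msuppZ_le c y)) scaler_sumr.
apply: eq_bigr => q _; rewrite scaler_sumr; apply: eq_bigr => p _.
by rewrite mcoeffZ scalerA mulrCA.
Qed.

Lemma path_mul0l y : path_mul 0 y = 0.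
Proof. by have := path_mulZl 0 0 y; rewrite !scale0r. Qed.
Lemma path_mul0r x : path_mul x 0 = 0.
Proof. by have := path_mulZr 0 x 0; rewrite !scale0r. Qed.

Lemma path_mul_basis (q p : anypath Q) :
  path_mul (<< q >> : kQ) (<< p >> : kQ) = basis_mul q p.
Proof.
rewrite (path_mulw msuppU_le msuppU_le) !big_seq_fset1 !mcoeffUU.
by rewrite mul1r scale1r.
Qed.

(* linear induction on the basis of paths *)
Lemma path_alg_ind (P : kQ -> Prop) :
  P 0 -> (forall x y, P x -> P y -> P (x + y)) ->
  (forall c x, P x -> P (c *: x)) -> (forall p, P << p >>) -> forall x, P x.
Proof.
move=> P0 PD PZ Pb x; rewrite [x]monalgE.
elim: (msupp x : seq _) => [|p s IH]; first by rewrite big_nil.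
rewrite big_cons; apply: PD => //.
have -> : (<< x@_p *g p >> : kQ) = x@_p *: (<< p >> : kQ).
  by apply/malgP => r; rewrite mcoeffZ !mcoeffU mulrnAr mulr1.
exact: PZ.
Qed.

Lemma path_mulA : associative path_mul.
Proof.
move=> x y z; move: x; apply: path_alg_ind => [|x x' IH IH'|c x IH|r].
- by rewrite !path_mul0l.
- by rewrite !path_mulDl IH IH'.
- by rewrite !path_mulZl IH.
move: y; apply: path_alg_ind => [|y y' IH IH'|c y IH|q].
- by rewrite path_mul0l path_mul0r path_mul0l.
- by rewrite path_mulDl !path_mulDr path_mulDl IH IH'.
- by rewrite path_mulZl !path_mulZr path_mulZl IH.
move: z; apply: path_alg_ind => [|z z' IH IH'|c z IH|p].
- by rewrite !path_mul0r.
- by rewrite !path_mulDr IH IH'.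
- by rewrite !path_mulZr IH.
rewrite !path_mul_basis /basis_mul; have := anypath_compA r q p.
case: (anypath_comp q p) (anypath_comp r q) => [s|] [t|] /=;
  rewrite ?path_mul0l ?path_mul0r ?path_mul_basis /basis_mul //.
- by move=> ->.
- by move=> ->.
- by move=> <-.
Qed.

Lemma path_mul_suml (I : finType) (F : I -> kQ) y :
  path_mul (\sum_i F i) y = \sum_i path_mul (F i) y.
Proof.
exact: (big_morph (path_mul^~ y) (fun a b => path_mulDl a b y) (path_mul0l y)).
Qed.
Lemma path_mul_sumr (I : finType) (F : I -> kQ) x :
  path_mul x (\sum_i F i) = \sum_i path_mul x (F i).
Proof.
exact: (big_morph (path_mul x) (fun a b => path_mulDr x a b) (path_mul0r x)).
Qed.

Lemma path_mul1 : left_id path_one path_mul.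
Proof.
move=> x; move: x; apply: path_alg_ind => [|x x' IH IH'|c x IH|[u [v p]]].
- by rewrite path_mul0r.
- by rewrite path_mulDr IH IH'.
- by rewrite path_mulZr IH.
rewrite -/(Anypath p) path_mul_suml (bigD1 v) //= big1 => [|w nw].
  by rewrite path_mul_basis addr0 /basis_mul anypath_compE.
by rewrite path_mul_basis /basis_mul anypath_comp_neq //; apply/eqP.
Qed.

Lemma path_1mul : right_id path_one path_mul.
Proof.
move=> x; move: x; apply: path_alg_ind => [|x x' IH IH'|c x IH|[u [v p]]].
- by rewrite path_mul0l.
- by rewrite path_mulDl IH IH'.
- by rewrite path_mulZl IH.
rewrite -/(Anypath p) path_mul_sumr (bigD1 u) //= big1 => [|w nw].
  by rewrite path_mul_basis addr0 /basis_mul anypath_compE path_comp_nil.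
rewrite path_mul_basis /basis_mul anypath_comp_neq //.
by apply/eqP; rewrite eq_sym.
Qed.

HB.instance Definition _ := GRing.Zmodule_isPzRing.Build kQ
  path_mulA path_mul1 path_1mul path_mulDl path_mulDr.

Definition path_scalar (c : k) : kQ := c *: path_one.
Fact path_scalarD : {morph path_scalar : x y / x + y}.
Proof. by move=> x y; rewrite /path_scalar scalerDl. Qed.
Fact path_scalarM : {morph path_scalar : x y / x * y}.
Proof.
move=> x y; rewrite /path_scalar -scalerA.
by rewrite [RHS]path_mulZl path_mul1.
Qed.
Fact path_scalar1 : path_scalar 1 = 1.
Proof. by rewrite /path_scalar scale1r. Qed.
Fact path_scalarC (c : k) (x : kQ) : path_scalar c * x = x * path_scalar c.
Proof. by rewrite [LHS]path_mulZl [RHS]path_mulZr path_mul1 path_1mul. Qed.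
HB.instance Definition _ := isKAlgebra.Build k kQ
  path_scalarD path_scalarM path_scalar1 path_scalarC.

(* A relation is a k-linear combination of parallel paths; [R u v r] says that
   r = 0 is imposed.                                                          *)
Definition lincomb (u v : Q) := seq (k * qpath u v).
Definition relations := forall u v : Q, lincomb u v -> Prop.

Definition lincomb_elt (u v : Q) (r : lincomb u v) : kQ :=
  \sum_(t <- r) t.1 *: path_elt t.2.

Definition rel_elts (R : relations) (x : kQ) : Prop :=
  exists (u v : Q) (r : lincomb u v), R u v r /\ x = lincomb_elt r.

Definition bound_alg (R : relations) : kalgType k := alg_quot (rel_elts R).

Definition path_class (R : relations) (u v : Q) (p : qpath u v) : bound_alg R :=
  to_quot (rel_elts R) (path_elt p).

Definition idem (R : relations) (v : Q) : bound_alg R := path_class R (path_nil v).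
Definition arrow_class (R : relations) (u v : Q) (a : arrow u v) : bound_alg R :=
  path_class R (path_cons a (path_nil u)).

End PathAlgebra.

Record category := Category {
  object :> Type;
  morph : object -> object -> Type;
  idc : forall X, morph X X;
  compc : forall X Y Z, morph Y Z -> morph X Y -> morph X Z;
  compcA : forall X Y Z T (h : morph Z T) (g : morph Y Z) (f : morph X Y),
    compc h (compc g f) = compc (compc h g) f;
  compc1 : forall X Y (f : morph X Y), compc f (idc X) = f;
  comp1c : forall X Y (f : morph X Y), compc (idc Y) f = f
}.
Arguments morph {c} X Y : rename.
Arguments idc {c} X : rename.

Record functor (C D : category) := Functor {
  fob :> C -> D;
  fmap : forall X Y : C, morph X Y -> morph (fob X) (fob Y);
  fmap1 : forall X, fmap (idc X) = idc (fob X);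
  fmapM : forall X Y Z (g : morph Y Z) (f : morph X Y),
    fmap (compc g f) = compc (fmap g) (fmap f)
}.
Arguments fmap {C D} F {X Y} f : rename.

Definition functor_id (C : category) : functor C C :=
  @Functor C C id (fun _ _ f => f) (fun _ => erefl) (fun _ _ _ _ _ => erefl).

Section FunctorComp.
Context (C D E : category) (G : functor D E) (F : functor C D).
Fact functor_comp1 (X : C) : fmap G (fmap F (idc X)) = idc (G (F X)).
Proof. by rewrite !fmap1. Qed.
Fact functor_compM (X Y Z : C) (g : morph Y Z) (f : morph X Y) :
  fmap G (fmap F (compc g f)) = compc (fmap G (fmap F g)) (fmap G (fmap F f)).
Proof. by rewrite !fmapM. Qed.
Definition functor_comp : functor C E :=
  @Functor C E (fun X => G (F X)) (fun _ _ f => fmap G (fmap F f))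
    functor_comp1 functor_compM.
End FunctorComp.

Definition is_iso (C : category) (X Y : C) (f : morph X Y) : Prop :=
  exists g : morph Y X, compc g f = idc X /\ compc f g = idc Y.

Definition nat_iso (C D : category) (F G : functor C D) : Prop :=
  exists t : forall X, morph (F X) (G X),
    (forall X, is_iso (t X)) /\
    (forall X Y (f : morph X Y), compc (t Y) (fmap F f) = compc (fmap G f) (t X)).

Definition is_equivalence (C D : category) (F : functor C D) : Prop :=
  exists G : functor D C,
    nat_iso (functor_comp G F) (functor_id C) /\
    nat_iso (functor_comp F G) (functor_id D).

Definition lin (B : pzRingType) (U V : lmodType B) : Type := {linear U -> V}.

Section LinearMaps.
Context (B : pzRingType) (U V : lmodType B).
Implicit Types f g h : lin U V.

Lemma linP f g : f =1 g -> f = g.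
Proof.
case: f g => [f [[af] [sf]]] [g [[ag] [sg]]] /= /funext fg.
by subst g; rewrite (Prop_irrelevance af ag) (Prop_irrelevance sf sg).
Qed.

HB.instance Definition _ := gen_eqMixin (lin U V).
HB.instance Definition _ := gen_choiceMixin (lin U V).

Definition lin_add f g : lin U V := f \+ g.
Definition lin_opp f : lin U V := \- f.
Definition lin_zero : lin U V := \0.

Fact lin_addA : associative lin_add.
Proof. by move=> f g h; apply: linP => x /=; rewrite addrA. Qed.
Fact lin_addC : commutative lin_add.
Proof. by move=> f g; apply: linP => x /=; rewrite addrC. Qed.
Fact lin_add0 : left_id lin_zero lin_add.
Proof. by move=> f; apply: linP => x /=; rewrite add0r. Qed.
Fact lin_addN : left_inverse lin_zero lin_opp lin_add.
Proof. by move=> f; apply: linP => x /=; rewrite addNr. Qed.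
HB.instance Definition _ := GRing.isZmodule.Build (lin U V)
  lin_addA lin_addC lin_add0 lin_addN.
End LinearMaps.

Definition lin_id (B : pzRingType) (U : lmodType B) : lin U U := idfun.
Definition lin_comp (B : pzRingType) (U V W : lmodType B)
  (g : lin V W) (f : lin U V) : lin U W := g \o f.

Definition fin_gen (B : pzRingType) (M : lmodType B) : Prop :=
  exists (m : nat) (x : 'I_m -> M), forall y, exists c : 'I_m -> B,
    y = \sum_i c i *: x i.

Record fgmod (B : pzRingType) := FgMod {
  fgmod_mod :> lmodType B;
  fgmod_fg : fin_gen fgmod_mod
}.

Section ModuleCategory.
Context (B : pzRingType).
Fact lin_compA (X Y Z T : fgmod B) (h : lin Z T) (g : lin Y Z) (f : lin X Y) :
  lin_comp h (lin_comp g f) = lin_comp (lin_comp h g) f.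
Proof. exact: linP. Qed.
Fact lin_comp1 (X Y : fgmod B) (f : lin X Y) : lin_comp f (lin_id X) = f.
Proof. exact: linP. Qed.
Fact lin_1comp (X Y : fgmod B) (f : lin X Y) : lin_comp (lin_id Y) f = f.
Proof. exact: linP. Qed.
Definition Mod : category :=
  @Category (fgmod B) (fun M N => lin M N) (fun M => lin_id M)
    (fun M N L g f => lin_comp g f) lin_compA lin_comp1 lin_1comp.
End ModuleCategory.

(* End_B(P)^op : the product of f and g is g o f. *)
Definition end_op (B : pzRingType) (P : lmodType B) : Type := lin P P.

Section EndOp.
Context (k : comNzRingType) (B : kalgType k) (P : lmodType B).
HB.instance Definition _ := GRing.Zmodule.on (end_op P).
Implicit Types f g h : end_op P.

Definition end_op_mul f g : end_op P := lin_comp g f.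
Fact end_op_mulA : associative end_op_mul.
Proof. by move=> f g h; apply: linP. Qed.
Fact end_op_mul1 : left_id (lin_id P : end_op P) end_op_mul.
Proof. by move=> f; apply: linP. Qed.
Fact end_op_1mul : right_id (lin_id P : end_op P) end_op_mul.
Proof. by move=> f; apply: linP. Qed.
Fact end_op_mulDl : left_distributive end_op_mul +%R.
Proof. by move=> f g h; apply: linP => x /=; rewrite raddfD. Qed.
Fact end_op_mulDr : right_distributive end_op_mul +%R.
Proof. by move=> f g h; apply: linP. Qed.
HB.instance Definition _ := GRing.Zmodule_isPzRing.Build (end_op P)
  end_op_mulA end_op_mul1 end_op_1mul end_op_mulDl end_op_mulDr.

Definition scalar_map (c : k) (x : P) : P := (kscalar c : B) *: x.
Fact scalar_map_linear c : linear (scalar_map c).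
Proof.
by move=> a x y; rewrite /scalar_map scalerDr !scalerA kscalarC.
Qed.
HB.instance Definition _ c :=
  GRing.isLinear.Build B P P *:%R (scalar_map c) (scalar_map_linear c).

Definition end_op_scalar (c : k) : end_op P := scalar_map c.
Fact end_op_scalarD : {morph end_op_scalar : x y / x + y}.
Proof. by move=> a b; apply: linP => x; rewrite /= /scalar_map kscalarD scalerDl. Qed.
Fact end_op_scalarM : {morph end_op_scalar : x y / x * y}.
Proof.
move=> a b; apply: linP => x; rewrite /= /scalar_map scalerA -kscalarM.
by rewrite mulrC.
Qed.
Fact end_op_scalar1 : end_op_scalar 1 = 1.
Proof. by apply: linP => x; rewrite /= /scalar_map kscalar1 scale1r. Qed.
Fact end_op_scalarC (c : k) f : end_op_scalar c * f = f * end_op_scalar c.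
Proof. by apply: linP => x; rewrite /= /scalar_map linearZ. Qed.
HB.instance Definition _ := isKAlgebra.Build k (end_op P)
  end_op_scalarD end_op_scalarM end_op_scalar1 end_op_scalarC.
End EndOp.

(* Hom_B(P, M) as a left A-module, when A acts on P through a morphism
   phi : A -> End_B(P)^op : (a h)(p) = h (phi(a) p).                          *)
Definition hom_mod (k : comNzRingType) (A B : kalgType k) (P : lmodType B)
  (phi : alghom A (end_op P)) (M : lmodType B) : Type := lin P M.

Section HomMod.
Context (k : comNzRingType) (A B : kalgType k) (P : lmodType B).
Context (phi : alghom A (end_op P)).

Section Action.
Context (M : lmodType B).
Local Notation H := (hom_mod phi M).
HB.instance Definition _ := GRing.Zmodule.on H.
Definition hom_mod_scale (a : A) (h : H) : H := lin_comp h (phi a).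
Fact hom_mod_scaleA a b h :
  hom_mod_scale a (hom_mod_scale b h) = hom_mod_scale (a * b) h.
Proof. by apply: linP => x; rewrite /= rmorphM. Qed.
Fact hom_mod_scale1 : left_id 1 hom_mod_scale.
Proof. by move=> h; apply: linP => x; rewrite /= rmorph1. Qed.
Fact hom_mod_scaleDr : right_distributive hom_mod_scale +%R.
Proof. by move=> a f g; apply: linP. Qed.
Fact hom_mod_scaleDl h : {morph hom_mod_scale^~ h : a b / a + b}.
Proof. by move=> a b; apply: linP => x; rewrite /= rmorphD /= raddfD. Qed.
HB.instance Definition _ := GRing.Zmodule_isLmodule.Build A H
  hom_mod_scaleA hom_mod_scale1 hom_mod_scaleDr hom_mod_scaleDl.
End Action.

Section Functoriality.
Context (M N : lmodType B) (g : lin M N).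
Definition hom_mod_map (h : hom_mod phi M) : hom_mod phi N := lin_comp g h.
Fact hom_mod_map_linear : linear hom_mod_map.
Proof. by move=> a f h; apply: linP => x; rewrite /= raddfD. Qed.
HB.instance Definition _ :=
  GRing.isLinear.Build A (hom_mod phi M) (hom_mod phi N) *:%R
    hom_mod_map hom_mod_map_linear.
End Functoriality.

Context (fg : forall M : fgmod B, fin_gen (hom_mod phi M)).
Definition hom_ob (M : fgmod B) : fgmod A := FgMod (fg M).
Definition hom_map (M N : fgmod B) (g : lin M N) : lin (hom_ob M) (hom_ob N) :=
  hom_mod_map g.
Fact hom_map1 (M : fgmod B) : hom_map (lin_id M) = lin_id (hom_ob M).
Proof. by apply: linP => h; apply: linP. Qed.
Fact hom_mapM (M N L : fgmod B) (g : lin N L) (f : lin M N) :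
  hom_map (lin_comp g f) = lin_comp (hom_map g) (hom_map f).
Proof. by apply: linP => h; apply: linP. Qed.
Definition hom_functor : functor (Mod B) (Mod A) :=
  @Functor (Mod B) (Mod A) hom_ob hom_map hom_map1 hom_mapM.
End HomMod.

Section LeftIdeal.
Context (B : pzRingType) (e : B).
Definition in_left_ideal : pred B^o := fun x => `[< exists a : B, x = a * e >].
Fact left_ideal_submod : submod_closed in_left_ideal.
Proof.
split=> [|a x y]; first by apply/asboolP; exists 0; rewrite mul0r.
move=> /asboolP[b ->] /asboolP[c ->]; apply/asboolP; exists (a * b + c).
by rewrite mulrDl -mulrA.
Qed.
HB.instance Definition _ :=
  GRing.isSubmodClosed.Build B B^o in_left_ideal left_ideal_submod.
Definition left_ideal : Type := {x : B^o | in_left_ideal x}.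
HB.instance Definition _ := SubChoice.on left_ideal.
HB.instance Definition _ := [SubChoice_isSubLmodule of left_ideal by <:].
End LeftIdeal.

(* direct sum of a finite family *)
Definition dsum (B : pzRingType) (I : finType) (V : I -> lmodType B) : Type :=
  forall i, V i.

Section DirectSum.
Context (B : pzRingType) (I : finType) (V : I -> lmodType B).
Local Notation D := (dsum V).
HB.instance Definition _ := gen_eqMixin D.
HB.instance Definition _ := gen_choiceMixin D.
Definition dsum_add (x y : D) : D := fun i => x i + y i.
Definition dsum_opp (x : D) : D := fun i => - x i.
Definition dsum_zero : D := fun i => 0.
Definition dsum_scale (a : B) (x : D) : D := fun i => a *: x i.
Fact dsum_addA : associative dsum_add.
Proof. by move=> x y z; apply: functional_extensionality_dep => i; exact: addrA. Qed.
Fact dsum_addC : commutative dsum_add.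
Proof. by move=> x y; apply: functional_extensionality_dep => i; exact: addrC. Qed.
Fact dsum_add0 : left_id dsum_zero dsum_add.
Proof. by move=> x; apply: functional_extensionality_dep => i; exact: add0r. Qed.
Fact dsum_addN : left_inverse dsum_zero dsum_opp dsum_add.
Proof. by move=> x; apply: functional_extensionality_dep => i; exact: addNr. Qed.
HB.instance Definition _ := GRing.isZmodule.Build D
  dsum_addA dsum_addC dsum_add0 dsum_addN.
Fact dsum_scaleA a b x : dsum_scale a (dsum_scale b x) = dsum_scale (a * b) x.
Proof. by apply: functional_extensionality_dep => i; exact: scalerA. Qed.
Fact dsum_scale1 : left_id 1 dsum_scale.
Proof. by move=> x; apply: functional_extensionality_dep => i; exact: scale1r. Qed.
Fact dsum_scaleDr : right_distributive dsum_scale +%R.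
Proof. by move=> a x y; apply: functional_extensionality_dep => i; exact: scalerDr. Qed.
Fact dsum_scaleDl x : {morph dsum_scale^~ x : a b / a + b}.
Proof. by move=> a b; apply: functional_extensionality_dep => i; exact: scalerDl. Qed.
HB.instance Definition _ := GRing.Zmodule_isLmodule.Build B D
  dsum_scaleA dsum_scale1 dsum_scaleDr dsum_scaleDl.
End DirectSum.

Record lincat (k : comNzRingType) := Lincat {
  lob :> Type;
  lhom : lob -> lob -> lmodType k;
  lid : forall X, lhom X X;
  lcomp : forall X Y Z, lhom Y Z -> lhom X Y -> lhom X Z;
  lcompA : forall X Y Z T (h : lhom Z T) (g : lhom Y Z) (f : lhom X Y),
    lcomp h (lcomp g f) = lcomp (lcomp h g) f;
  lcomp1 : forall X Y (f : lhom X Y), lcomp f (lid X) = f;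
  l1comp : forall X Y (f : lhom X Y), lcomp (lid Y) f = f;
  lcomp_linl : forall X Y Z (f : lhom X Y),
    linear (fun g : lhom Y Z => lcomp g f);
  lcomp_linr : forall X Y Z (g : lhom Y Z),
    linear (fun f : lhom X Y => lcomp g f)
}.
Arguments lhom {k l} X Y : rename.
Arguments lid {k l} X : rename.

Local Notation "g \oc f" := (lcomp g f) (at level 40, left associativity).

Section Abelian.
Context (k : comNzRingType) (A : lincat k).

Definition is_zero_object (Z : A) : Prop :=
  forall X : A, (forall f : lhom X Z, f = 0) /\ (forall f : lhom Z X, f = 0).

Definition is_biproduct (I : finType) (Y : I -> A) (Z : A) : Prop :=
  exists (inj : forall i, lhom (Y i) Z) (pr : forall i, lhom Z (Y i)),
    [/\ forall i, pr i \oc inj i = lid (Y i),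
        forall i j, i != j -> pr i \oc inj j = 0
      & \sum_i inj i \oc pr i = lid Z].

Definition is_kernel (X Y K : A) (f : lhom X Y) (i : lhom K X) : Prop :=
  f \oc i = 0 /\
  forall (T : A) (g : lhom T X), f \oc g = 0 -> exists! h : lhom T K, i \oc h = g.

Definition is_cokernel (X Y C : A) (f : lhom X Y) (p : lhom Y C) : Prop :=
  p \oc f = 0 /\
  forall (T : A) (g : lhom Y T), g \oc f = 0 -> exists! h : lhom C T, h \oc p = g.

Definition is_mono (X Y : A) (f : lhom X Y) : Prop :=
  forall (T : A) (g h : lhom T X), f \oc g = f \oc h -> g = h.

Definition is_epi (X Y : A) (f : lhom X Y) : Prop :=
  forall (T : A) (g h : lhom Y T), g \oc f = h \oc f -> g = h.

Record is_abelian : Prop := {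
  abelian_zero : exists Z : A, is_zero_object Z;
  abelian_biproduct : forall X Y : A, exists Z : A,
    is_biproduct (fun b : bool => if b then X else Y) Z;
  abelian_kernel : forall (X Y : A) (f : lhom X Y),
    exists (K : A) (i : lhom K X), is_kernel f i;
  abelian_cokernel : forall (X Y : A) (f : lhom X Y),
    exists (C : A) (p : lhom Y C), is_cokernel f p;
  abelian_mono : forall (X Y : A) (i : lhom X Y), is_mono i ->
    exists (Z : A) (f : lhom Y Z), is_kernel f i;
  abelian_epi : forall (X Y : A) (p : lhom X Y), is_epi p ->
    exists (Z : A) (f : lhom Z X), is_cokernel f p
}.

Lemma lcompDl (X Y Z : A) (g g' : lhom Y Z) (f : lhom X Y) :
  (g + g') \oc f = g \oc f + g' \oc f.
Proof. by rewrite -[g]scale1r lcomp_linl !scale1r. Qed.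
Lemma lcompDr (X Y Z : A) (g : lhom Y Z) (f f' : lhom X Y) :
  g \oc (f + f') = g \oc f + g \oc f'.
Proof. by rewrite -[f]scale1r lcomp_linr !scale1r. Qed.
Lemma lcomp0l (X Y Z : A) (f : lhom X Y) : (0 : lhom Y Z) \oc f = 0.
Proof. by apply: (addIr (0 \oc f)); rewrite -lcompDl !add0r. Qed.
Lemma lcomp0r (X Y Z : A) (g : lhom Y Z) : g \oc (0 : lhom X Y) = 0.
Proof. by apply: (addIr (g \oc 0)); rewrite -lcompDr !add0r. Qed.
Lemma lcompZl (X Y Z : A) c (g : lhom Y Z) (f : lhom X Y) :
  (c *: g) \oc f = c *: (g \oc f).
Proof. by rewrite -[_ *: g]addr0 lcomp_linl lcomp0l addr0. Qed.
Lemma lcompZr (X Y Z : A) c (g : lhom Y Z) (f : lhom X Y) :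
  g \oc (c *: f) = c *: (g \oc f).
Proof. by rewrite -[_ *: f]addr0 lcomp_linr lcomp0r addr0. Qed.

Definition endo (X : A) : Type := lhom X X.

Section Endo.
Context (X : A).
HB.instance Definition _ := GRing.Zmodule.on (endo X).
Definition endo_mul (f g : endo X) : endo X := f \oc g.
Fact endo_mulA : associative endo_mul. Proof. by move=> f g h; exact: lcompA. Qed.
Fact endo_mul1 : left_id (lid X : endo X) endo_mul.
Proof. by move=> f; exact: l1comp. Qed.
Fact endo_1mul : right_id (lid X : endo X) endo_mul.
Proof. by move=> f; exact: lcomp1. Qed.
Fact endo_mulDl : left_distributive endo_mul +%R.
Proof. by move=> f g h; exact: lcompDl. Qed.
Fact endo_mulDr : right_distributive endo_mul +%R.
Proof. by move=> f g h; exact: lcompDr. Qed.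
HB.instance Definition _ := GRing.Zmodule_isPzRing.Build (endo X)
  endo_mulA endo_mul1 endo_1mul endo_mulDl endo_mulDr.

Definition endo_scalar (c : k) : endo X := c *: lid X.
Fact endo_scalarD : {morph endo_scalar : x y / x + y}.
Proof. by move=> x y; rewrite /endo_scalar scalerDl. Qed.
Fact endo_scalarM : {morph endo_scalar : x y / x * y}.
Proof.
by move=> x y; rewrite /endo_scalar [RHS]lcompZl l1comp scalerA.
Qed.
Fact endo_scalar1 : endo_scalar 1 = 1. Proof. exact: scale1r. Qed.
Fact endo_scalarC (c : k) (f : endo X) : endo_scalar c * f = f * endo_scalar c.
Proof. by rewrite [LHS]lcompZl [RHS]lcompZr l1comp lcomp1. Qed.
HB.instance Definition _ := isKAlgebra.Build k (endo X)
  endo_scalarD endo_scalarM endo_scalar1 endo_scalarC.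
End Endo.
End Abelian.

Lemma sig_eq (T : Type) (P : T -> Prop) (x y : {t : T | P t}) :
  sval x = sval y -> x = y.
Proof.
case: x y => [x px] [y py] /= exy; subst y.
by rewrite (Prop_irrelevance px py).
Qed.

Section Representations.
Context (k : comNzRingType) (B : kalgType k) (A : lincat k).

Record rep := MkRep {
  rep_ob : A;
  rep_act : alghom B (endo rep_ob)
}.

Definition rep_act_hom (M : rep) (b : B) : lhom (rep_ob M) (rep_ob M) :=
  rep_act M b.

Definition rep_hom (M N : rep) : Type :=
  {f : lhom (rep_ob M) (rep_ob N) |
    forall b : B, f \oc rep_act_hom M b = rep_act_hom N b \oc f}.

Definition rep_id (M : rep) : rep_hom M M.
Proof. by exists (lid (rep_ob M)) => b; rewrite lcomp1 l1comp. Defined.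

Definition rep_comp (M N L : rep) (g : rep_hom N L) (f : rep_hom M N) : rep_hom M L.
Proof.
by exists (sval g \oc sval f) => b; rewrite -lcompA (svalP f) !lcompA (svalP g).
Defined.

Fact rep_compA (M N L K : rep) (h : rep_hom L K) (g : rep_hom N L) (f : rep_hom M N) :
  rep_comp h (rep_comp g f) = rep_comp (rep_comp h g) f.
Proof. by apply: sig_eq; exact: lcompA. Qed.
Fact rep_comp1 (M N : rep) (f : rep_hom M N) : rep_comp f (rep_id M) = f.
Proof. by apply: sig_eq; exact: lcomp1. Qed.
Fact rep_1comp (M N : rep) (f : rep_hom M N) : rep_comp (rep_id N) f = f.
Proof. by apply: sig_eq; exact: l1comp. Qed.
Definition Rep : category :=
  @Category rep rep_hom rep_id rep_comp rep_compA rep_comp1 rep_1comp.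

(* Hom(X, M) with the left B-module structure coming from the action on M *)
Definition hom_rep (X : A) (M : rep) : Type := lhom X (rep_ob M).

Section HomRep.
Context (X : A) (M : rep).
Local Notation H := (hom_rep X M).
HB.instance Definition _ := GRing.Zmodule.on H.
Definition hom_rep_scale (b : B) (f : H) : H := rep_act_hom M b \oc f.
Fact hom_rep_scaleA a b f :
  hom_rep_scale a (hom_rep_scale b f) = hom_rep_scale (a * b) f.
Proof. by rewrite /hom_rep_scale lcompA /rep_act_hom rmorphM. Qed.
Fact hom_rep_scale1 : left_id 1 hom_rep_scale.
Proof. by move=> f; rewrite /hom_rep_scale /rep_act_hom rmorph1; exact: l1comp. Qed.
Fact hom_rep_scaleDr : right_distributive hom_rep_scale +%R.
Proof. by move=> a f g; exact: lcompDr. Qed.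
Fact hom_rep_scaleDl f : {morph hom_rep_scale^~ f : a b / a + b}.
Proof. by move=> a b; rewrite /hom_rep_scale /rep_act_hom rmorphD; exact: lcompDl. Qed.
HB.instance Definition _ := GRing.Zmodule_isLmodule.Build B H
  hom_rep_scaleA hom_rep_scale1 hom_rep_scaleDr hom_rep_scaleDl.
End HomRep.
End Representations.

(* F is the functor Hom_B(P, -) on representations in the category A, i.e.
   F M represents X |-> Hom_B(P, Hom_A(X, M)), the action of A' coming from phi;
   this determines F up to a unique isomorphism.                              *)
Definition is_induced (k : comNzRingType) (A' B : kalgType k) (P : lmodType B)
    (phi : alghom A' (end_op P)) (A : lincat k)
    (F : functor (Rep B A) (Rep A' A)) : Prop :=
  exists t : forall (X : A) (M : Rep B A),
      lin (hom_rep X (F M)) (hom_mod phi (hom_rep X M)),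
  [/\ forall X M, bijective (t X M),
      forall (X Y : A) (M : Rep B A) (g : lhom Y X) (f : hom_rep X (F M)) (p : P),
        t Y M (f \oc g) p = t X M f p \oc g
    & forall (X : A) (M N : Rep B A) (h : morph M N) (f : hom_rep X (F M)) (p : P),
        t X N (sval (fmap F h) \oc f) p = sval h \oc t X M f p].

Section QuiverRepresentations.
Context (k : idomainType) (Q : quiver) (R : relations k Q) (A : lincat k).

Fixpoint path_map (V : Q -> A)
    (f : forall u v : Q, arrow u v -> lhom (V u) (V v))
    (u v : Q) (p : qpath u v) : lhom (V u) (V v) :=
  match p in qpath _ v return lhom (V u) (V v) with
  | path_nil => lid (V u)
  | path_cons _ _ a p' => f _ _ a \oc path_map f p'
  end.

Record qrep := MkQrep {
  qrep_ob :> Q -> A;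
  qrep_arrow : forall u v : Q, arrow u v -> lhom (qrep_ob u) (qrep_ob v);
  qrep_rel : forall (u v : Q) (r : lincomb k u v), R r ->
    \sum_(t <- r) t.1 *: path_map qrep_arrow t.2 = 0
}.

Definition qrep_hom (X Y : qrep) : Type :=
  {f : forall v, lhom (X v) (Y v) |
    forall u v (a : arrow u v), f v \oc qrep_arrow X a = qrep_arrow Y a \oc f u}.

Definition qrep_id (X : qrep) : qrep_hom X X.
Proof. by exists (fun v => lid (X v)) => u v a; rewrite lcomp1 l1comp. Defined.

Definition qrep_comp (X Y Z : qrep) (g : qrep_hom Y Z) (f : qrep_hom X Y) :
  qrep_hom X Z.
Proof.
exists (fun v => sval g v \oc sval f v) => u v a.
by rewrite -lcompA (svalP f) !lcompA (svalP g).
Defined.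

Fact qrep_compA (X Y Z T : qrep) (h : qrep_hom Z T) (g : qrep_hom Y Z)
    (f : qrep_hom X Y) :
  qrep_comp h (qrep_comp g f) = qrep_comp (qrep_comp h g) f.
Proof.
by apply: sig_eq; apply: functional_extensionality_dep => v; exact: lcompA.
Qed.
Fact qrep_comp1 (X Y : qrep) (f : qrep_hom X Y) : qrep_comp f (qrep_id X) = f.
Proof.
by apply: sig_eq; apply: functional_extensionality_dep => v; exact: lcomp1.
Qed.
Fact qrep_1comp (X Y : qrep) (f : qrep_hom X Y) : qrep_comp (qrep_id Y) f = f.
Proof.
by apply: sig_eq; apply: functional_extensionality_dep => v; exact: l1comp.
Qed.
Definition QRep : category :=
  @Category qrep qrep_hom qrep_id qrep_comp qrep_compA qrep_comp1 qrep_1comp.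

(* V sends a representation M of kQ/R to the representation of the quiver whose
   value at the vertex v is the image e_v M of the idempotent e_v, split by
   [q] and [p]; this determines V up to a unique isomorphism.                 *)
Definition is_vertex_functor (V : functor (Rep (bound_alg R) A) QRep) : Prop :=
  exists (q : forall (M : Rep (bound_alg R) A) (v : Q), lhom (V M v) (rep_ob M))
         (p : forall (M : Rep (bound_alg R) A) (v : Q), lhom (rep_ob M) (V M v)),
  [/\ forall M v, p M v \oc q M v = lid (V M v),
      forall M v, q M v \oc p M v = rep_act_hom M (idem R v),
      forall M u v (a : arrow u v),
        qrep_arrow (V M) a = p M v \oc rep_act_hom M (arrow_class R a) \oc q M u
    & forall M N (f : morph M N) v, sval (fmap V f) v = p N v \oc sval f \oc q M v].

End QuiverRepresentations.

(* Vertices and arrows, usually numbered from 1, are numbered from 0 here: the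
   vertex u : 'I_n stands for u + 1 (it carries the simplicial degree u), the
   arrows out of u are pi_i : u -> u - 1 and iota_i : u -> u + 1 for
   0 <= i <= u; that is, pi_i and iota_i are the face d_i and the degeneracy
   s_i. The simplicial relations are unchanged by this shift.                 *)
Variant simp_arrow (n : nat) (u v : 'I_n) : Type :=
| Pi (i : nat) of u == v.+1 :> nat & (i <= u)%N
| Iota (i : nat) of v == u.+1 :> nat & (i <= u)%N.
Arguments Pi {n u v} i _ _.
Arguments Iota {n u v} i _ _.

Definition simp_quiver (n : nat) : quiver := Quiver (@simp_arrow n).

Definition arrow2 (Q : quiver) (u v w : Q) (b : arrow v w) (a : arrow u v) :
  qpath u w := path_cons b (path_cons a (path_nil u)).

(* the relation p = q *)
Definition rel_eq (k : idomainType) (Q : quiver) (u v : Q) (p q : qpath u v) :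
  lincomb k u v := [:: (1, p); (-1, q)].

Section SimplicialRelations.
Context (k : idomainType) (n : nat).
Local Notation Q := (simp_quiver n).
Local Notation "b ** a" := (@arrow2 Q _ _ _ b a) (at level 40).

Inductive simp_rel : relations k Q :=
| Rel_pi_pi (u v w : Q) (i j : nat) (uv : u == v.+1 :> nat) (vw : v == w.+1 :> nat)
    (iu : (i <= u)%N) (jv : (j <= v)%N) (ju : (j <= u)%N) (iv : (i.-1 <= v)%N) :
    (j < i)%N ->
    simp_rel (rel_eq k (Pi j vw jv ** Pi i uv iu)
                     (Pi i.-1 vw iv ** Pi j uv ju))
| Rel_pi_iota_lt (u v w : Q) (i j : nat) (uv : v == u.+1 :> nat)
    (wu : u == w.+1 :> nat)
    (iu : (i <= u)%N) (jv : (j <= v)%N) (ju : (j <= u)%N) (iw : (i.-1 <= w)%N) :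
    (j < i)%N ->
    simp_rel (rel_eq k (Pi j uv jv ** Iota i uv iu)
                     (Iota i.-1 wu iw ** Pi j wu ju))
| Rel_pi_iota_id (u v : Q) (i j : nat) (uv : v == u.+1 :> nat)
    (iu : (i <= u)%N) (jv : (j <= v)%N) :
    (j == i) || (j == i.+1) ->
    simp_rel (rel_eq k (Pi j uv jv ** Iota i uv iu) (path_nil u))
| Rel_pi_iota_gt (u v w : Q) (i j : nat) (uv : v == u.+1 :> nat)
    (wu : u == w.+1 :> nat)
    (iu : (i <= u)%N) (jv : (j <= v)%N) (ju : (j.-1 <= u)%N) (iw : (i <= w)%N) :
    (i.+1 < j)%N ->
    simp_rel (rel_eq k (Pi j uv jv ** Iota i uv iu)
                     (Iota i wu iw ** Pi j.-1 wu ju))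
| Rel_iota_iota (u v w : Q) (i j : nat) (uv : v == u.+1 :> nat)
    (vw : w == v.+1 :> nat)
    (iu : (i <= u)%N) (jv : (j <= v)%N) (ju : (j.-1 <= u)%N) (iv : (i <= v)%N) :
    (i < j)%N ->
    simp_rel (rel_eq k (Iota j vw jv ** Iota i uv iu)
                     (Iota i vw iv ** Iota j.-1 uv ju)).

End SimplicialRelations.

Variant chain_arrow (n : nat) (u v : 'I_n) : Type := D of u == v.+1 :> nat.

Definition chain_quiver (n : nat) : quiver := Quiver (@chain_arrow n).

Inductive chain_rel (k : idomainType) (n : nat) : relations k (chain_quiver n) :=
| Rel_d_d (u v w : chain_quiver n) (b : arrow v w) (a : arrow u v) :
    chain_rel [:: (1, arrow2 b a)].

Definition simp_alg (k : idomainType) (n : nat) : kalgType k :=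
  bound_alg (@simp_rel k n).
Definition chain_alg (k : idomainType) (n : nat) : kalgType k :=
  bound_alg (@chain_rel k n).

Definition SimpObj (k : idomainType) (n : nat) (A : lincat k) : category :=
  QRep (@simp_rel k n) A.
Definition Chain (k : idomainType) (n : nat) (A : lincat k) : category :=
  QRep (@chain_rel k n) A.

Definition is_joint_kernel (k : comNzRingType) (A : lincat k) (X K : A)
    (S : forall Y : A, lhom X Y -> Prop) (i : lhom K X) : Prop :=
  (forall Y (f : lhom X Y), S Y f -> f \oc i = 0) /\
  forall (T : A) (g : lhom T X), (forall Y (f : lhom X Y), S Y f -> f \oc g = 0) ->
    exists! h : lhom T K, i \oc h = g.

Variant positive_face (k : idomainType) (n : nat) (A : lincat k)
    (X : SimpObj n A) (u : 'I_n) : forall Y : A, lhom (X u) Y -> Prop :=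
| Positive_face (v : 'I_n) (i : nat) (uv : u == v.+1 :> nat) (iu : (i <= u)%N) :
    (0 < i)%N -> positive_face (qrep_arrow X (Pi i uv iu)).

(* The normalized (Moore) complex: N(X)_u is the intersection of the kernels of
   the faces d_1, ..., d_u on X_u, and the differential is induced by d_0. The
   other conventions (d_u, or the quotient by degenerate simplices) give
   isomorphic functors.                                                       *)
Definition is_normalization (k : idomainType) (n : nat) (A : lincat k)
    (N : functor (SimpObj n A) (Chain n A)) : Prop :=
  exists i : forall (X : SimpObj n A) (u : 'I_n), lhom (N X u) (X u),
  [/\ forall X u, is_joint_kernel (@positive_face k n A X u) (i X u),
      forall X (u v : 'I_n) (uv : u == v.+1 :> nat),
        i X v \oc qrep_arrow (N X) (D uv) =
        qrep_arrow X (Pi 0 uv (leq0n u)) \oc i X u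
    & forall X Y (f : morph X Y) u, i Y u \oc sval (fmap N f) u = sval f u \oc i X u].

(* Pascal's triangle, rows and columns numbered from 0; zero for j < i *)
Definition pascal (n : nat) : 'M[nat]_n := \matrix_(i < n, j < n) 'C(j, i).

Definition summands (n : nat) (j : 'I_n) : finType :=
  {i : 'I_n & 'I_(pascal n i j)}.

Definition proj (k : idomainType) (n : nat) (i : 'I_n) : lmodType (chain_alg k n) :=
  left_ideal (idem (@chain_rel k n) i).

Definition DK_module (k : idomainType) (n : nat) : lmodType (chain_alg k n) :=
  @dsum (chain_alg k n) {j : 'I_n & summands j} (fun s => proj k (tag (tagged s))).

(* Main.v *)
From HB Require Import structures.
Require Import Defs.
From mathcomp Require Import all_boot all_algebra.
From mathcomp Require Import finmap boolp monalg.
Import GRing.Theory.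
Local Open Scope ring_scope.

(* Write A for the simplicial and B for the chain algebra. Since
   Hom_B(P_i, M) = e_i M, the value at the vertex j of Hom_B(P, M) is the direct
   sum of the components of M of degree |S| over the subsets S of {1, ..., j}.
   The summand of P at j is the complex of normalized chains of the simplex
   [0, ..., j], where the simplex {0} u S generates a copy of P_|S|; the
   functoriality of this complex in the simplex is the morphism from A to
   End_B(P)^op. In these coordinates the degeneracies and the faces d_i with
   i > 0 only permute or kill components, so that the common kernel of the
   positive faces is the component of S = {1, ..., j}, on which d_0 acts as the
   differential. This identifies normalization as a quasi-inverse.
   The idempotents eps_u = (1 - s_0 d_1) ... (1 - s_(u-1) d_u) of A satisfy
   d_i eps_u = 0 for i > 0 and eps_u s_i = 0; they generate A as a two-sided
   ideal, and their corner of A is a quotient of B because it is spanned by the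
   eps_u and the d_0 eps_u. This corner acts on the top components as B does, so
   the morphism from A to End_B(P)^op is bijective on corners, hence bijective.
   The equivalences then follow by Morita theory with respect to the corner.  *)

Set Implicit Arguments.
Unset Strict Implicit.
Unset Printing Implicit Defensive.

(** * Equivalences of categories *)

(** The simplices through 0 are good coordinates because a simplex is a cone with apex 0: in a chain
    map out of its normalized chains the values on the simplices 0 u S can be prescribed freely in
    degree |S|, and the value on a simplex U without 0 is forced by the equation for the boundary of
    0 u U. The price is that d_0, whose coface moves 0, leaves these coordinates; it is the only
    generator that involves the differential. Comparing A with the endomorphisms of P directly would
    need a basis of A, that is, a normal form for words in faces and degeneracies. The corners avoid
    it. A two-sided ideal K with eps_v K eps_w = 0 for all v, w vanishes once the eps generate the
    unit ideal; for the kernel this is injectivity. Expanding 1 on both sides of an endomorphism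
    gives surjectivity in the same way. Words have to be sorted, degeneracies to the left, but no
    uniqueness of the sorted form is required. The corner suffices for Morita theory because the
    diagonal of T consists of ones: the top summands, one for each vertex, already add up to B. *)

Lemma dep_choice (I : Type) (T : I -> Type) (P : forall i, T i -> Prop) :
  (forall i, exists x, P i x) -> exists f : forall i, T i, forall i, P i (f i).
Proof. by move=> ex; exists (fun i => sval (cid (ex i))) => i; case: cid. Qed.

Lemma nat_iso_sym (C D : category) (F G : functor C D) : nat_iso F G -> nat_iso G F.
Proof.
move=> [t [iso_t nat_t]]; have [s sP] := dep_choice iso_t.
exists s; split=> [X|X Y f]; first by exists (t X); have [] := sP X.
have [st _] := sP Y; have [_ ts] := sP X.
by rewrite -[LHS]compc1 -ts -compcA (compcA (fmap G f)) -nat_t !compcA st comp1c.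
Qed.

Lemma nat_iso_trans (C D : category) (F G H : functor C D) :
  nat_iso F G -> nat_iso G H -> nat_iso F H.
Proof.
move=> [t [iso_t nat_t]] [s [iso_s nat_s]].
exists (fun X => compc (s X) (t X)); split=> [X|X Y f].
  have [t' [t't tt']] := iso_t X; have [s' [s's ss']] := iso_s X.
  exists (compc t' s'); split.
    by rewrite -compcA (compcA s') s's comp1c.
  by rewrite -compcA (compcA (t X)) tt' comp1c.
by rewrite -compcA nat_t compcA nat_s compcA.
Qed.

Lemma fmap_iso (C D : category) (F : functor C D) (X Y : C) (f : morph X Y) :
  is_iso f -> is_iso (fmap F f).
Proof. by move=> [g [gf fg]]; exists (fmap F g); rewrite -!fmapM gf fg !fmap1. Qed.

Lemma nat_iso_whisker (B C D E : category) (H : functor D E) (F G : functor C D)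
    (K : functor B C) :
  nat_iso F G ->
  nat_iso (functor_comp H (functor_comp F K)) (functor_comp H (functor_comp G K)).
Proof.
move=> [t [iso_t nat_t]]; exists (fun X => fmap H (t (K X))); split=> [X|X Y f].
  exact: (@fmap_iso _ _ H _ _ _ (iso_t (K X))).
by rewrite /= -!fmapM nat_t.
Qed.

Lemma is_equivalence_comp (C D E : category) (G : functor D E) (F : functor C D) :
  is_equivalence G -> is_equivalence F -> is_equivalence (functor_comp G F).
Proof.
move=> [G' [G'G GG']] [F' [F'F FF']]; exists (functor_comp F' G'); split.
  by apply: nat_iso_trans F'F; exact: (nat_iso_whisker F' F G'G).
by apply: nat_iso_trans GG'; exact: (nat_iso_whisker G G' FF').
Qed.

(** With quasi-inverses G' and V', a quasi-inverse of N is G V', by the chain G V' N ~ G V' N G G' ~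
    G V' V G' ~ G G' ~ 1. No inverse of normalization has to be written down. *)
Lemma is_equivalence_cancel (C D E : category) (N : functor D E) (G : functor C D)
    (V : functor C E) :
  nat_iso (functor_comp N G) V -> is_equivalence G -> is_equivalence V ->
  is_equivalence N.
Proof.
move=> NG [G' [G'G GG']] [V' [V'V VV']]; exists (functor_comp G V'); split.
- apply: nat_iso_trans (GG').
  apply: (@nat_iso_trans _ _ _
    (functor_comp G (functor_comp (functor_comp V' V) G'))); last first.
    exact: (nat_iso_whisker G G' V'V).
  apply: (@nat_iso_trans _ _ _
    (functor_comp (functor_comp G V') (functor_comp (functor_comp N G) G'))).
    apply: nat_iso_sym.
    exact: (nat_iso_whisker (functor_comp (functor_comp G V') N)
                            (functor_id D) GG').
  exact: (nat_iso_whisker (functor_comp G V') G' NG).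
- apply: nat_iso_trans (VV').
  exact: (nat_iso_whisker (functor_id E) V' NG).
Qed.

Lemma equivalence_of_ff_eso (C D : category) (F : functor C D) :
  (forall (X Y : C) (f g : morph X Y), fmap F f = fmap F g -> f = g) ->
  (forall (X Y : C) (g : morph (F X) (F Y)), exists f, fmap F f = g) ->
  (forall Z : D, exists (X : C) (f : morph (F X) Z), is_iso f) ->
  is_equivalence F.
Proof.
move=> faithF fullF.
move=> /dep_choice[G] /dep_choice[t] /dep_choice[s sP].
have ts Z : compc (t Z) (s Z) = idc Z by have [] := sP Z.
have st Z : compc (s Z) (t Z) = idc _ by have [] := sP Z.
pose gm (Z W : D) (f : morph Z W) := cid (fullF _ _ (compc (s W) (compc f (t Z)))).
have gmE Z W f : fmap F (sval (gm Z W f)) = compc (s W) (compc f (t Z)).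
  by rewrite /gm; case: cid.
pose um (X : C) := cid (fullF (G (F X)) X (t (F X))).
have umE X : fmap F (sval (um X)) = t (F X) by rewrite /um; case: cid.
have g1 Z : sval (gm Z Z (idc Z)) = idc (G Z).
  by apply: faithF; rewrite gmE comp1c st fmap1.
have gM Z W V (g : morph W V) (f : morph Z W) :
    sval (gm _ _ (compc g f)) = compc (sval (gm _ _ g)) (sval (gm _ _ f)).
  apply: faithF; rewrite fmapM !gmE -!compcA.
  by rewrite (compcA (t W)) ts comp1c.
exists (Functor g1 gM); split.
- exists (fun X => sval (um X)); split=> [X|X Y f].
    have [v vE] := fullF X (G (F X)) (s (F X)).
    by exists v; split; apply: faithF; rewrite fmapM vE umE fmap1 ?ts ?st.
  by apply: faithF; rewrite /= !fmapM umE gmE compcA ts comp1c umE.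
- exists t; split=> [Z|Z W f]; first by exists (s Z); exact: sP.
  by rewrite /= gmE compcA ts comp1c.
Qed.

(** * Bound path algebras *)

Lemma kscalar0 (k : comNzRingType) (D : kalgType k) : kscalar 0 = 0 :> D.
Proof. by apply: (addIr (kscalar 0)); rewrite -kscalarD !add0r. Qed.

Lemma kscalarN1 (k : comNzRingType) (D : kalgType k) : kscalar (- 1) = - 1 :> D.
Proof.
by apply: (addIr 1); rewrite addNr -[X in _ + X](@kscalar1 k) -kscalarD addNr kscalar0.
Qed.

Section MkAlghom.
Context (k : comNzRingType) (B E : kalgType k) (f : B -> E).
Hypothesis fD : {morph f : a b / a + b}.
Hypothesis fM : {morph f : a b / a * b}.
Hypothesis f1 : f 1 = 1.
Hypothesis fs : forall c, f (kscalar c) = kscalar c.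

Definition alghom_map : B -> E := f.
Fact alghom_map_zmod : zmod_morphism alghom_map.
Proof. by move=> b c; apply: (addIr (f c)); rewrite -fD !subrK. Qed.
Fact alghom_map_monoid : monoid_morphism alghom_map.
Proof. by split; [exact: f1 | exact: fM]. Qed.
HB.instance Definition _ := GRing.isZmodMorphism.Build B E alghom_map alghom_map_zmod.
HB.instance Definition _ :=
  GRing.isMonoidMorphism.Build B E alghom_map alghom_map_monoid.

Definition mk_alghom : alghom B E := @AlgHom k B E alghom_map fs.
End MkAlghom.

Section BoundAlgebra.
Context (k : idomainType) (Q : quiver) (R : relations k Q).
Local Notation kQ := (path_alg k Q).
Local Notation B := (bound_alg R).
Local Notation cl := (to_quot (rel_elts R)).

Lemma path_class_comp (u v w : Q) (q : qpath v w) (p : qpath u v) :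
  path_class R q * path_class R p = path_class R (path_comp q p).
Proof.
by rewrite [LHS]to_quotM; congr cl; rewrite [LHS]path_mul_basis /basis_mul anypath_compE.
Qed.

Lemma path_class_orth (u v v' w : Q) (q : qpath v' w) (p : qpath u v) :
  v' != v -> path_class R q * path_class R p = 0.
Proof.
move=> nv; rewrite [LHS]to_quotM [X in cl X]path_mul_basis /basis_mul.
by rewrite anypath_comp_neq //; apply/eqP.
Qed.

Lemma idem_mul (u v : Q) : idem R u * idem R v = if u == v then idem R u else 0.
Proof. by case: eqVneq => [->|/path_class_orth->]; rewrite ?path_class_comp. Qed.

Lemma idemM (u : Q) : idem R u * idem R u = idem R u.
Proof. by rewrite idem_mul eqxx. Qed.

Lemma idem_path (u v : Q) (p : qpath u v) : idem R v * path_class R p = path_class R p.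
Proof. by rewrite path_class_comp. Qed.

Lemma path_idem (u v : Q) (p : qpath u v) : path_class R p * idem R u = path_class R p.
Proof. by rewrite path_class_comp path_comp_nil. Qed.

Lemma arrow_path (u v w : Q) (a : arrow v w) (p : qpath u v) :
  arrow_class R a * path_class R p = path_class R (path_cons a p).
Proof. by rewrite path_class_comp. Qed.

Lemma to_quot_add (x y : kQ) : cl (x + y) = (cl x : B) + cl y.
Proof. by rewrite -[LHS]to_quotD. Qed.

Lemma to_quot_sum (I : Type) (r : seq I) (F : I -> kQ) :
  cl (\sum_(i <- r) F i) = \sum_(i <- r) (cl (F i) : B).
Proof. exact: (big_morph (cl : kQ -> B) to_quot_add erefl). Qed.

Lemma to_quot_scale c (x : kQ) : cl (c *: x) = kscalar c * (cl x : B).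
Proof.
by rewrite [RHS]to_quotM; congr cl; rewrite [RHS]path_mulZl [in RHS]path_mul1.
Qed.

Lemma sum_idem : \sum_(v : Q) idem R v = 1 :> B.
Proof. by rewrite -[LHS]to_quot_sum. Qed.

Lemma bound_alg_ind (S : B -> Prop) :
  (forall x y, S x -> S y -> S (x + y)) -> (forall c x, S x -> S (kscalar c * x)) ->
  S 0 -> (forall u v (p : qpath u v), S (path_class R p)) -> forall x, S x.
Proof.
move=> SD SZ S0 Sp; elim/quot_ind; apply: path_alg_ind => [|x y Sx Sy|c x Sx|].
- exact: S0.
- by rewrite to_quot_add; apply: SD.
- by rewrite to_quot_scale; apply: SZ.
- by case=> u [v p]; exact: (Sp u v p).
Qed.

Lemma bound_alg_rect (S : B -> Prop) :
  (forall x y, S x -> S y -> S (x + y)) -> (forall c x, S x -> S (kscalar c * x)) ->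
  S 0 -> (forall v, S (idem R v)) ->
  (forall x y, S x -> S y -> S (x * y)) ->
  (forall u v (a : arrow u v), S (arrow_class R a)) -> forall x, S x.
Proof.
move=> SD SZ S0 Se SM Sa; apply: bound_alg_ind => // u v.
by elim=> [|v' w a p Sp]; rewrite -?arrow_path; [exact: Se | exact: SM].
Qed.

Lemma lincomb_class (u v : Q) (r : lincomb k u v) :
  R r -> \sum_(t <- r) kscalar t.1 * path_class R t.2 = 0 :> B.
Proof.
move=> Rr; under eq_bigr do rewrite -to_quot_scale.
rewrite -to_quot_sum; apply/to_quot_eq; apply: IG_gen.
by exists u, v, r; split=> //; rewrite subr0.
Qed.

(** * The universal property of a bound path algebra *)

Section Lift.
Context (E : kalgType k) (e : Q -> E) (x : forall u v : Q, arrow u v -> E).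

Fixpoint path_val (u v : Q) (p : qpath u v) : E :=
  match p with
  | path_nil => e u
  | path_cons _ _ a p' => x a * path_val p'
  end.

Hypothesis e_mul : forall u v, e u * e v = if u == v then e u else 0.
Hypothesis e_x : forall u v (a : arrow u v), e v * x a = x a.
Hypothesis x_e : forall u v (a : arrow u v), x a * e u = x a.
Hypothesis x_rel : forall u v (r : lincomb k u v), R r ->
  \sum_(t <- r) kscalar t.1 * path_val t.2 = 0.

Lemma path_val_el (u v : Q) (p : qpath u v) : e v * path_val p = path_val p.
Proof. by case: p => [|v' w a p] /=; rewrite ?mulrA ?e_x // e_mul eqxx. Qed.

Lemma path_val_er (u v : Q) (p : qpath u v) : path_val p * e u = path_val p.
Proof. by elim: p => [|v' w a p IH] /=; rewrite -?mulrA ?IH // e_mul eqxx. Qed.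

Lemma path_val_comp (u v w : Q) (q : qpath v w) (p : qpath u v) :
  path_val (path_comp q p) = path_val q * path_val p.
Proof. by elim: q => [|v' w' a q IH] /=; rewrite ?path_val_el // IH mulrA. Qed.

Lemma path_val_orth (u v v' w : Q) (q : qpath v' w) (p : qpath u v) :
  v' != v -> path_val q * path_val p = 0.
Proof.
move=> nv; rewrite -path_val_er -mulrA -(path_val_el p) (mulrA (e v')) e_mul.
by rewrite (negPf nv) mul0r mulr0.
Qed.

Definition anypath_val (p : anypath Q) : E :=
  let: existT u (existT v p) := p in path_val p.

Definition alg_val (y : kQ) : E := \sum_(p <- msupp y) kscalar y@_p * anypath_val p.

Lemma alg_valw (d : {fset anypath Q}) (y : kQ) : (msupp y `<=` d)%fset ->
  alg_val y = \sum_(p <- d) kscalar y@_p * anypath_val p.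
Proof.
move=> le; rewrite /alg_val (big_fset_incl _ le) //= => p _ /mcoeff_outdom ->.
by rewrite kscalar0 mul0r.
Qed.

Lemma alg_valD : {morph alg_val : y z / y + z}.
Proof.
move=> y z; rewrite (alg_valw (msuppD_le y z)).
rewrite (alg_valw (fsubsetUl _ (msupp z))) (alg_valw (fsubsetUr (msupp y) _)).
by rewrite -big_split; apply: eq_bigr => p _; rewrite mcoeffD kscalarD mulrDl.
Qed.

Lemma alg_valZ c y : alg_val (c *: y) = kscalar c * alg_val y.
Proof.
rewrite (alg_valw (msuppZ_le c y)) mulr_sumr.
by apply: eq_bigr => p _; rewrite mcoeffZ kscalarM mulrA.
Qed.

Lemma alg_val0 : alg_val 0 = 0.
Proof. by have := alg_valZ 0 0; rewrite scale0r kscalar0 mul0r. Qed.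

Lemma alg_val_path (u v : Q) (p : qpath u v) : alg_val (path_elt k p) = path_val p.
Proof.
by rewrite (alg_valw msuppU_le) big_seq_fset1 mcoeffUU kscalar1 mul1r.
Qed.

Lemma alg_valM : {morph alg_val : y z / y * z}.
Proof.
move=> y z; move: y; apply: path_alg_ind => [|y y' IH IH'|c y IH|[v' [w q]]].
- by rewrite mul0r alg_val0 mul0r.
- by rewrite mulrDl !alg_valD mulrDl IH IH'.
- by rewrite -[LHS]/(alg_val (path_mul _ _)) path_mulZl !alg_valZ -mulrA -IH.
move: z; apply: path_alg_ind => [|z z' IH IH'|c z IH|[u [v p]]].
- by rewrite mulr0 alg_val0 mulr0.
- by rewrite mulrDr !alg_valD mulrDr IH IH'.
- rewrite -[LHS]/(alg_val (path_mul _ _)) path_mulZr !alg_valZ mulrA -kscalarC.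
  by rewrite -mulrA -IH.
rewrite -[LHS]/(alg_val (path_mul _ _)) path_mul_basis /basis_mul.
rewrite -/(Anypath p) -/(Anypath q).
rewrite -[<< Anypath q >>]/(path_elt k q) -[<< Anypath p >>]/(path_elt k p).
rewrite !alg_val_path; case: (eqVneq v' v) q => [->|nv] q.
  by rewrite anypath_compE -path_val_comp -alg_val_path.
by rewrite anypath_comp_neq ?alg_val0 ?path_val_orth //; apply/eqP.
Qed.

Lemma alg_val_ideal y : ideal_gen (rel_elts R) y -> alg_val y = 0.
Proof.
elim=> {y} [y [u [v [r [Rr ->]]]]||y z _ IHy _ IHz|y z _ IH|y z _ IH].
- rewrite (big_morph _ alg_valD alg_val0) -[RHS](x_rel Rr).
  by apply: eq_bigr => t _; rewrite alg_valZ alg_val_path.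
- exact: alg_val0.
- by rewrite alg_valD IHy IHz addr0.
- by rewrite alg_valM IH mulr0.
- by rewrite alg_valM IH mul0r.
Qed.

Definition bound_val (b : B) : E := alg_val (of_quot b).

Lemma bound_val_class y : bound_val (cl y) = alg_val y.
Proof.
rewrite /bound_val -[RHS]add0r -(alg_val_ideal (repr_rel (rel_elts R) y)).
by rewrite -alg_valD subrK.
Qed.

Lemma bound_valD : {morph bound_val : b c / b + c}.
Proof.
elim/quot_ind=> b; elim/quot_ind=> c.
by rewrite -to_quot_add !bound_val_class alg_valD.
Qed.

Lemma bound_valM : {morph bound_val : b c / b * c}.
Proof.
elim/quot_ind=> b; elim/quot_ind=> c.
by rewrite [_ * _]to_quotM !bound_val_class alg_valM.
Qed.

Lemma bound_valZ c : {morph bound_val : b / kscalar c * b >-> kscalar c * b}.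
Proof.
by elim/quot_ind=> b; rewrite -to_quot_scale !bound_val_class alg_valZ.
Qed.

Lemma bound_val_idem v : bound_val (idem R v) = e v.
Proof. by rewrite bound_val_class alg_val_path. Qed.

Lemma bound_val_arrow u v (a : arrow u v) : bound_val (arrow_class R a) = x a.
Proof. by rewrite bound_val_class alg_val_path /= x_e. Qed.

Hypothesis e_sum : \sum_v e v = 1.

Lemma bound_val0 : bound_val 0 = 0.
Proof. by rewrite bound_val_class alg_val0. Qed.

Lemma bound_val1 : bound_val 1 = 1.
Proof.
rewrite -sum_idem (big_morph _ bound_valD bound_val0) -e_sum.
by apply: eq_bigr => v _; rewrite bound_val_idem.
Qed.

Lemma bound_alg_lift : exists f : alghom B E,
  (forall v, f (idem R v) = e v) /\ (forall u v (a : arrow u v), f (arrow_class R a) = x a).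
Proof.
have fs c : bound_val (kscalar c) = kscalar c.
  by rewrite -[kscalar c in LHS]mulr1 bound_valZ bound_val1 mulr1.
by exists (mk_alghom bound_valD bound_valM bound_val1 fs); split;
  [exact: bound_val_idem | exact: bound_val_arrow].
Qed.
End Lift.
End BoundAlgebra.

Local Notation "g \oc f" := (lcomp g f) (at level 40, left associativity).

(** * Representations in abelian categories *)

Section LinearCategories.
Context (k : comNzRingType) (A : lincat k).

Lemma lcomp_suml (J : Type) (r : seq J) (P : pred J) (X Y Z : A)
    (F : J -> lhom Y Z) (g : lhom X Y) :
  (\sum_(i <- r | P i) F i) \oc g = \sum_(i <- r | P i) (F i \oc g).
Proof. exact: (big_morph (fun f => f \oc g) (fun a b => lcompDl a b g) (lcomp0l _ g)). Qed.

Lemma lcomp_sumr (J : Type) (r : seq J) (P : pred J) (X Y Z : A)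
    (F : J -> lhom X Y) (g : lhom Y Z) :
  g \oc (\sum_(i <- r | P i) F i) = \sum_(i <- r | P i) (g \oc F i).
Proof. exact: (big_morph (fun f => g \oc f) (fun a b => lcompDr g a b) (lcomp0r _ g)). Qed.

Lemma lcompBl (X Y Z : A) (g g' : lhom Y Z) (f : lhom X Y) :
  (g - g') \oc f = g \oc f - g' \oc f.
Proof. by rewrite lcompDl -scaleN1r lcompZl scaleN1r. Qed.

(** Z is the direct sum of the images of the idempotents [e s]. The maps [q s] and [p s] are the
    composites Z -> image -> M and M -> image -> Z, so that the images themselves need no names. *)
Definition is_splitting (I : finType) (M Z : A) (e : I -> lhom M M)
    (q : I -> lhom Z M) (p : I -> lhom M Z) : Prop :=
  (forall s t, q s \oc p t = if s == t then e s else 0) /\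
  \sum_s p s \oc q s = lid Z.

Section Splitting.
Context (I : finType) (M Z : A) (e : I -> lhom M M).
Context (q : I -> lhom Z M) (p : I -> lhom M Z) (qp : is_splitting e q p).

Lemma splitting_qp s : q s \oc p s = e s.
Proof. by rewrite (proj1 qp) eqxx. Qed.

Lemma splitting_pe s : p s \oc e s = p s.
Proof.
rewrite -[RHS]l1comp -(proj2 qp) lcomp_suml (bigD1 s) //= big1 => [|t nt].
  by rewrite addr0 -lcompA splitting_qp.
by rewrite -lcompA (proj1 qp) (negPf nt) lcomp0r.
Qed.

Lemma splitting_eq s : e s \oc q s = q s.
Proof.
rewrite -[RHS]lcomp1 -(proj2 qp) lcomp_sumr (bigD1 s) //= big1 => [|t nt].
  by rewrite addr0 lcompA splitting_qp.
by rewrite lcompA (proj1 qp) eq_sym (negPf nt) lcomp0l.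
Qed.

Lemma splitting_inj (Y : A) (f g : lhom Y Z) : (forall s, q s \oc f = q s \oc g) -> f = g.
Proof.
move=> fg; rewrite -[f]l1comp -[g]l1comp -(proj2 qp) !lcomp_suml.
by apply: eq_bigr => s _; rewrite -!lcompA fg.
Qed.
End Splitting.

Hypothesis A_abelian : is_abelian A.

(** The image of e is the kernel of 1 - e, and e itself factors through it because (1 - e) e = 0. *)
Lemma split_idempotent (X : A) (e : lhom X X) : e \oc e = e ->
  exists (K : A) (i : lhom K X) (r : lhom X K), r \oc i = lid K /\ i \oc r = e.
Proof.
move=> ee; have [K [i [i0 iU]]] := abelian_kernel A_abelian (lid X - e).
have ei : e \oc i = i.
  by apply/esym/eqP; rewrite -subr_eq0 -[X in X - _]l1comp -lcompBl i0.
have [|r [ir _]] := iU X e; first by rewrite lcompBl l1comp ee subrr.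
exists K, i, r; split=> //.
have [h [_ hU]] := iU K i i0.
rewrite -(hU (lid K)) ?lcomp1 //; apply/esym/hU.
by rewrite lcompA ir.
Qed.

Lemma binary_biproduct (X Y : A) :
  exists (Z : A) (a : lhom X Z) (a' : lhom Y Z) (b : lhom Z X) (b' : lhom Z Y),
  [/\ b \oc a = lid X, b' \oc a' = lid Y, b \oc a' = 0, b' \oc a = 0
    & a \oc b + a' \oc b' = lid Z].
Proof.
have [Z [a [b [ba ba0 ab]]]] := abelian_biproduct A_abelian X Y.
exists Z, (a true), (a false), (b true), (b false).
by rewrite -ab big_bool (ba true) (ba false) (ba0 true false) // (ba0 false true).
Qed.

Lemma finite_biproduct (I : finType) (Y : I -> A) : exists Z, is_biproduct Y Z.
Proof.
(* Summands are added one at a time along [enum I]. Indices not yet listed carry zero maps, so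
   orthogonality can be required of all indices from the start. *)
have [Z [inj [pr [pi pi0 sum1]]]] : exists (Z : A) (inj : forall i, lhom (Y i) Z)
    (pr : forall i, lhom Z (Y i)),
  [/\ forall i, i \in enum I -> pr i \oc inj i = lid (Y i),
      forall i j, i != j -> pr i \oc inj j = 0
    & \sum_(i <- enum I) inj i \oc pr i = lid Z].
  elim: (enum I) (enum_uniq I) => [_|i s IH /= /andP[ni /IH]].
    have [Z Z0] := abelian_zero A_abelian.
    exists Z, (fun=> 0), (fun=> 0); split=> // [i j _|]; first by rewrite lcomp0l.
    by rewrite big_nil; apply/esym; exact: (proj1 (Z0 Z)).
  move=> [Z [inj [pr [pi pi0 sum1]]]].
  have [W [a [a' [b [b' [ba b'a' ba' b'a ab]]]]]] := binary_biproduct (Y i) Z.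
  pose j0 (j : I) : lhom (Y j) W :=
    match i =P j with ReflectT eij => ecast x (lhom (Y x) W) eij a
                    | ReflectF _ => a' \oc inj j end.
  pose p0 (j : I) : lhom W (Y j) :=
    match i =P j with ReflectT eij => ecast x (lhom W (Y x)) eij b
                    | ReflectF _ => pr j \oc b' end.
  have j0i : j0 i = a by rewrite /j0; case: eqP => // e; rewrite eq_axiomK.
  have p0i : p0 i = b by rewrite /p0; case: eqP => // e; rewrite eq_axiomK.
  have j0n j : i != j -> j0 j = a' \oc inj j by rewrite /j0; case: eqP.
  have p0n j : i != j -> p0 j = pr j \oc b' by rewrite /p0; case: eqP.
  exists W, j0, p0; split=> [j|j l njl|].
  - rewrite inE; case: (eqVneq i j) => [<- _|nij]; first by rewrite j0i p0i ba.
    rewrite /= => js; rewrite j0n // p0n //.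
    by rewrite lcompA -(lcompA (pr j)) b'a' lcomp1 pi.
  - have [eij|nij] := eqVneq i j; have [eil|nil] := eqVneq i l.
    + by rewrite -eij -eil eqxx in njl.
    + by rewrite -eij p0i j0n // lcompA ba' lcomp0l.
    + by rewrite -eil j0i p0n // -lcompA b'a lcomp0r.
    + by rewrite j0n // p0n // lcompA -(lcompA (pr j)) b'a' lcomp1 pi0.
  - rewrite big_cons j0i p0i -ab; congr (_ + _).
    rewrite -[b']l1comp -sum1 lcomp_suml lcomp_sumr; apply: eq_big_seq => j js.
    have nij : i != j by apply: contraNneq ni => ->.
    by rewrite j0n // p0n // !lcompA.
exists Z, inj, pr; split=> // [i|]; first by rewrite pi // mem_enum.
by rewrite -big_enum.
Qed.

Lemma split_idempotents (I : finType) (M : A) (e : I -> lhom M M) :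
  (forall s, e s \oc e s = e s) ->
  exists (Z : A) (q : I -> lhom Z M) (p : I -> lhom M Z), is_splitting e q p.
Proof.
move=> ee; have /dep_choice[K /dep_choice[i /dep_choice[r ri]]] :=
  fun s => split_idempotent (ee s).
have [Z [inj [pr [pi pi0 sum1]]]] := finite_biproduct K.
exists Z, (fun s => i s \oc pr s), (fun s => inj s \oc r s); split=> [s t|].
  rewrite -lcompA (lcompA (pr s)); case: eqVneq => [<-|nst].
    by rewrite pi l1comp; have [] := ri s.
  by rewrite pi0 // lcomp0l lcomp0r.
rewrite -sum1; apply: eq_bigr => s _.
by rewrite -lcompA (lcompA (r s)); have [-> _] := ri s; rewrite l1comp.
Qed.
End LinearCategories.

Section RepIso.
Context (k : comNzRingType) (B : kalgType k) (A : lincat k).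

Lemma rep_actM (M : rep B A) (a b : B) :
  rep_act_hom M (a * b) = rep_act_hom M a \oc rep_act_hom M b.
Proof. by rewrite /rep_act_hom rmorphM. Qed.
Lemma rep_actD (M : rep B A) (a b : B) :
  rep_act_hom M (a + b) = rep_act_hom M a + rep_act_hom M b.
Proof. by rewrite /rep_act_hom rmorphD. Qed.
Lemma rep_act0 (M : rep B A) : rep_act_hom M 0 = 0.
Proof. by rewrite /rep_act_hom rmorph0. Qed.
Lemma rep_act1 (M : rep B A) : rep_act_hom M 1 = lid _.
Proof. by rewrite /rep_act_hom rmorph1. Qed.
Lemma rep_act_sum (M : rep B A) (J : Type) (r : seq J) (P : pred J) (F : J -> B) :
  rep_act_hom M (\sum_(i <- r | P i) F i) = \sum_(i <- r | P i) rep_act_hom M (F i).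
Proof. exact: (big_morph (rep_act_hom M) (rep_actD M) (rep_act0 M)). Qed.
Lemma rep_act_scalar (M : rep B A) (c : k) : rep_act_hom M (kscalar c) = c *: lid _.
Proof. by rewrite /rep_act_hom alghom_scalar. Qed.
Lemma rep_actZ (M : rep B A) (c : k) (b : B) :
  rep_act_hom M (kscalar c * b) = c *: rep_act_hom M b.
Proof. by rewrite rep_actM rep_act_scalar lcompZl l1comp. Qed.

Lemma rep_hom_iso (M N : Rep B A) (f : morph M N) (g : lhom (rep_ob N) (rep_ob M)) :
  g \oc sval f = lid _ -> sval f \oc g = lid _ -> is_iso f.
Proof.
move=> gf fg; have gb b : g \oc rep_act_hom N b = rep_act_hom M b \oc g.
  rewrite -[LHS]lcomp1 -fg lcompA -(lcompA g) -(svalP f b) !lcompA gf.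
  by rewrite l1comp.
by exists (exist _ g gb : rep_hom N M); split; apply: sig_eq.
Qed.

Section MkRep.
Context (X : A) (f : B -> lhom X X).
Hypothesis fD : {morph f : a b / a + b}.
Hypothesis fM : {morph f : a b / a * b >-> a \oc b}.
Hypothesis fs : forall c, f (kscalar c) = c *: lid X.

Fact mk_rep1 : f 1 = 1 :> endo X.
Proof. by rewrite -(@kscalar1 k B) [LHS]fs scale1r. Qed.

Definition mk_rep : Rep B A := MkRep (@mk_alghom k B (endo X) f fD fM mk_rep1 fs).

Lemma mk_rep_act b : rep_act_hom mk_rep b = f b.
Proof. by []. Qed.
End MkRep.
End RepIso.

(** * Representations of a bound path algebra as quiver representations *)

Section VertexFunctors.
Context (k : idomainType) (Q : quiver) (R : relations k Q) (A : lincat k).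
Local Notation B := (bound_alg R).

Lemma qrep_hom_iso (X Y : QRep R A) (f : morph X Y) (g : forall v, lhom (Y v) (X v)) :
  (forall v, g v \oc sval f v = lid _) -> (forall v, sval f v \oc g v = lid _) ->
  is_iso f.
Proof.
move=> gf fg.
have ga u v (a : arrow u v) : g v \oc qrep_arrow Y a = qrep_arrow X a \oc g u.
  rewrite -[LHS]lcomp1 -fg lcompA -(lcompA (g v)) -(svalP f _ _ a) !lcompA gf.
  by rewrite l1comp.
exists (exist _ g ga : qrep_hom Y X).
by split; apply: sig_eq; apply: functional_extensionality_dep => v.
Qed.

Lemma rep_act_arrow (M : rep B A) (u v : Q) (a : arrow u v) :
  rep_act_hom M (idem R v) \oc rep_act_hom M (arrow_class R a)
    \oc rep_act_hom M (idem R u) = rep_act_hom M (arrow_class R a).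
Proof. by rewrite -!rep_actM idem_path path_idem. Qed.

Section Existence.
Hypothesis A_abelian : is_abelian A.

Lemma vertex_functor_exists : exists V : functor (Rep B A) (QRep R A),
  is_vertex_functor V.
Proof.
have ee (x : rep B A * Q) :
    rep_act_hom x.1 (idem R x.2) \oc rep_act_hom x.1 (idem R x.2) =
    rep_act_hom x.1 (idem R x.2) by rewrite -rep_actM idemM.
have /dep_choice[Z /dep_choice[q /dep_choice[p pq]]] :=
  fun x => split_idempotent A_abelian (ee x).
have pq1 M v : p (M, v) \oc q (M, v) = lid _ by have [] := pq (M, v).
have qp M v : q (M, v) \oc p (M, v) = rep_act_hom M (idem R v) by have [] := pq (M, v).
pose x (M : rep B A) u v (a : arrow u v) :=
  p (M, v) \oc rep_act_hom M (arrow_class R a) \oc q (M, u).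
have xq M u v a : q (M, v) \oc x M u v a =
    rep_act_hom M (arrow_class R a) \oc q (M, u).
  by rewrite /x !lcompA qp -rep_actM idem_path.
have xp M u v a : x M u v a \oc p (M, u) =
    p (M, v) \oc rep_act_hom M (arrow_class R a).
  by rewrite /x -!lcompA qp -rep_actM path_idem.
(* Between the vertex images a path acts by the compression of its class in the algebra; relations
   of the algebra thus become relations of the quiver representation. *)
have x_path M u v (w : qpath u v) : Defs.path_map (x M) w =
    p (M, v) \oc rep_act_hom M (path_class R w) \oc q (M, u).
  elim: w => [|v' v'' a w /= ->]; first by rewrite -qp lcompA pq1 l1comp pq1.
  by rewrite !lcompA xp -(lcompA (p _)) -rep_actM arrow_path.
have x_rel M u v (r : lincomb k u v) : R r ->
    \sum_(t <- r) t.1 *: Defs.path_map (x M) t.2 = 0.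
  move=> /lincomb_class /(congr1 (rep_act_hom M)).
  rewrite rep_act0 rep_act_sum => r0.
  under eq_bigr => t _.
    by rewrite x_path -lcompZl -lcompZr -rep_actZ; over.
  by rewrite -lcomp_suml -lcomp_sumr r0 lcomp0r lcomp0l.
pose fv (M N : rep B A) (f : rep_hom M N) v := p (N, v) \oc sval f \oc q (M, v).
have fq M N (f : rep_hom M N) v : sval f \oc q (M, v) = q (N, v) \oc fv M N f v.
  by rewrite /fv !lcompA qp -(svalP f) -(lcompA _ _ (q _)) -qp -lcompA pq1 lcomp1.
have fa M N f u v (a : arrow u v) : fv M N f v \oc x M u v a = x N u v a \oc fv M N f u.
  rewrite /fv -lcompA xq lcompA -(lcompA (p _)) (svalP f).
  by rewrite [in RHS]lcompA [in RHS]lcompA xp lcompA.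
pose Fob M : QRep R A := MkQrep (x_rel M).
pose Fmap (M N : Rep B A) (f : morph M N) : morph (Fob M) (Fob N) := exist _ _ (fa _ _ f).
have F1 M : Fmap M M (idc M) = idc (Fob M).
  apply: sig_eq; apply: functional_extensionality_dep => v.
  by rewrite /= /fv /= lcomp1 pq1.
have FM (L M N : Rep B A) (g : morph M N) (f : morph L M) :
    Fmap _ _ (compc g f) = compc (Fmap _ _ g) (Fmap _ _ f).
  apply: sig_eq; apply: functional_extensionality_dep => v.
  by rewrite /= {1}/fv /= -!lcompA fq -/(fv _ _ _ _) !lcompA.
exists (Functor F1 FM).
exists (fun M v => q (M, v)), (fun M v => p (M, v)).
by split.
Qed.
End Existence.

Section Equivalence.
Context (V : functor (Rep B A) (QRep R A)).
Context (q : forall (M : Rep B A) (v : Q), lhom (V M v) (rep_ob M)).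
Context (p : forall (M : Rep B A) (v : Q), lhom (rep_ob M) (V M v)).
Hypothesis pq : forall M v, p M v \oc q M v = lid (V M v).
Hypothesis qp : forall M v, q M v \oc p M v = rep_act_hom M (idem R v).
Hypothesis V_arrow : forall M u v (a : arrow u v),
  qrep_arrow (V M) a = p M v \oc rep_act_hom M (arrow_class R a) \oc q M u.
Hypothesis V_map : forall M N (f : morph M N) v,
  sval (fmap V f) v = p N v \oc sval f \oc q M v.

Lemma vertex_pe M v : p M v \oc rep_act_hom M (idem R v) = p M v.
Proof. by rewrite -qp lcompA pq l1comp. Qed.

Lemma vertex_eq M v : rep_act_hom M (idem R v) \oc q M v = q M v.
Proof. by rewrite -qp -lcompA pq lcomp1. Qed.

Lemma vertex_pq0 M (u v : Q) : u != v -> p M u \oc q M v = 0.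
Proof.
move=> nuv; rewrite -vertex_pe -vertex_eq -lcompA (lcompA (rep_act_hom _ _)).
by rewrite -rep_actM idem_mul (negPf nuv) rep_act0 lcomp0l lcomp0r.
Qed.

Lemma vertex_sum M : \sum_v q M v \oc p M v = lid (rep_ob M).
Proof.
by under eq_bigr do rewrite qp; rewrite -rep_act_sum sum_idem rep_act1.
Qed.

Lemma vertex_arrowE M u v (a : arrow u v) :
  rep_act_hom M (arrow_class R a) = q M v \oc qrep_arrow (V M) a \oc p M u.
Proof. by rewrite V_arrow !lcompA qp -lcompA qp rep_act_arrow. Qed.

Lemma vertex_faithful (M N : Rep B A) (f g : morph M N) : fmap V f = fmap V g -> f = g.
Proof.
move=> fg; apply: sig_eq.
rewrite -[sval f]lcomp1 -[sval g]lcomp1 -vertex_sum !lcomp_sumr.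
apply: eq_bigr => v _; have := congr1 (fun h => q N v \oc sval h v) fg.
rewrite !V_map !lcompA !qp -!(svalP f) -!(svalP g) -!lcompA !vertex_eq => fgv.
by rewrite !lcompA fgv.
Qed.

Lemma vertex_full (M N : Rep B A) (g : morph (V M) (V N)) : exists f, fmap V f = g.
Proof.
pose f := \sum_v q N v \oc sval g v \oc p M v.
have pf v : p N v \oc f = sval g v \oc p M v.
  rewrite /f lcomp_sumr (bigD1 v) //= big1 => [|w nw].
    by rewrite !lcompA pq l1comp addr0.
  by rewrite !lcompA vertex_pq0 1?eq_sym // !lcomp0l.
have fq v : f \oc q M v = q N v \oc sval g v.
  rewrite /f lcomp_suml (bigD1 v) //= big1 => [|w nw].
    by rewrite -!lcompA pq lcomp1 addr0.
  by rewrite -!lcompA vertex_pq0 // !lcomp0r.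
have fb b : f \oc rep_act_hom M b = rep_act_hom N b \oc f.
  elim/bound_alg_rect: b => [b c IHb IHc|c b IH||v|b c IHb IHc|u v a].
  - by rewrite !rep_actD lcompDr lcompDl IHb IHc.
  - by rewrite !rep_actZ lcompZr lcompZl IH.
  - by rewrite !rep_act0 lcomp0r lcomp0l.
  - by rewrite -!qp lcompA fq -!lcompA pf.
  - by rewrite !rep_actM lcompA IHb -lcompA IHc lcompA.
  - rewrite !vertex_arrowE !lcompA fq -!lcompA pf !lcompA; congr (_ \oc _).
    by rewrite -!lcompA (svalP g).
exists (exist _ f fb); apply: sig_eq; apply: functional_extensionality_dep => v.
by rewrite V_map /= pf -lcompA pq lcomp1.
Qed.

Hypothesis A_abelian : is_abelian A.

(** The universal property of the algebra is applied to the endomorphisms of the direct sum of the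
    [X v], where a path acts by a matrix with a single entry. *)
Lemma qrep_total (X : QRep R A) :
  exists (M : rep B A) (inj : forall v, lhom (X v) (rep_ob M))
         (pr : forall v, lhom (rep_ob M) (X v)),
  [/\ forall v, pr v \oc inj v = lid (X v),
      forall v, rep_act_hom M (idem R v) = inj v \oc pr v
    & forall u v (a : arrow u v),
        rep_act_hom M (arrow_class R a) = inj v \oc qrep_arrow X a \oc pr u].
Proof.
have [Z [inj [pr [pi pi0 sum1]]]] := finite_biproduct A_abelian X.
pose e v : endo Z := inj v \oc pr v.
pose x u v (a : arrow u v) : endo Z := inj v \oc qrep_arrow X a \oc pr u.
have pri u (Y W : A) (f : lhom Y (X u)) (g : lhom (X u) W) :
    g \oc pr u \oc (inj u \oc f) = g \oc f.
  by rewrite -lcompA (lcompA (pr u)) pi l1comp.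
have e_mul u v : e u * e v = if u == v then e u else 0.
  rewrite -[e u * e v]/(_ \oc _); case: eqVneq => [<-|nuv]; first exact: pri.
  by rewrite -lcompA (lcompA (pr u)) pi0 // lcomp0l lcomp0r.
have ex u v (a : arrow u v) : e v * x u v a = x u v a.
  by rewrite -[LHS]/(_ \oc _) /x -(lcompA (inj v)) pri.
have xe u v (a : arrow u v) : x u v a * e u = x u v a.
  exact: pri.
have x_path u v (w : qpath u v) :
    path_val e x w = inj v \oc Defs.path_map (@qrep_arrow _ _ _ _ X) w \oc pr u.
  elim: w => [|v' w a p' /= ->]; first by rewrite /= lcomp1.
  by rewrite -[LHS]/(_ \oc _) -(lcompA (inj v')) pri !lcompA.
have x_rel u v (r : lincomb k u v) : R r ->
    \sum_(t <- r) kscalar t.1 * path_val e x t.2 = 0.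
  move=> Rr; rewrite -[RHS](lcomp0l _ (pr u)) -[X in X \oc _](lcomp0r _ (inj v)).
  rewrite -(qrep_rel X Rr) lcomp_sumr lcomp_suml; apply: eq_bigr => t _.
  rewrite x_path -[LHS]/((_ *: lid Z) \oc _) lcompZl l1comp.
  by rewrite -!lcompA -lcompZr -lcompZl.
have [f [fe fx]] := bound_alg_lift e_mul ex xe x_rel sum1.
by exists (MkRep f), inj, pr; split; [exact: pi | exact: fe | exact: fx].
Qed.

Lemma vertex_eso (X : QRep R A) : exists (M : Rep B A) (f : morph (V M) X), is_iso f.
Proof.
have [M [inj [pr [pi Me Mx]]]] := qrep_total X.
pose t v : lhom (V M v) (X v) := pr v \oc q M v.
have ta u v (a : arrow u v) : t v \oc qrep_arrow (V M) a = qrep_arrow X a \oc t u.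
  by rewrite /t V_arrow !lcompA -(lcompA _ (q M v)) qp Me Mx !lcompA pi !l1comp pi l1comp.
exists M, (exist _ t ta : qrep_hom (V M) X).
apply: (@qrep_hom_iso _ _ _ (fun v => p M v \oc inj v)) => v /=; rewrite /t.
  by rewrite -lcompA (lcompA (inj v)) -Me -qp !lcompA pq l1comp pq.
by rewrite -lcompA (lcompA (q M v)) qp Me !lcompA pi l1comp pi.
Qed.
End Equivalence.

Lemma vertex_equivalence (V : functor (Rep B A) (QRep R A)) :
  is_abelian A -> is_vertex_functor V -> is_equivalence V.
Proof.
move=> A_abelian [q [p [pq qp V_arrow V_map]]]; apply: equivalence_of_ff_eso.
- exact: vertex_faithful qp V_map.
- exact: vertex_full pq qp V_arrow V_map.
- exact: vertex_eso pq qp V_arrow A_abelian.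
Qed.
End VertexFunctors.

(** * Morita theory for sums of left ideals *)

Section ProjectiveSum.
Context (k : comNzRingType) (A' B : kalgType k) (I : finType) (e : I -> B).
Hypothesis ee : forall s, e s * e s = e s.
Local Notation P := (dsum (fun s => left_ideal (e s) : lmodType B) : lmodType B).

Definition coord (p : P) (s : I) : B := \val (p s).

Lemma coord_inj (p q : P) : coord p =1 coord q -> p = q.
Proof. by move=> pq; apply: functional_extensionality_dep => s; apply/val_inj/pq. Qed.

Lemma coordD (p q : P) s : coord (p + q) s = coord p s + coord q s.
Proof. by []. Qed.

Lemma coordZ b (p : P) s : coord (b *: p) s = b * coord p s.
Proof. by []. Qed.

Lemma coord0 s : coord 0 s = 0.
Proof. by []. Qed.

Lemma coord_sum (J : Type) (r : seq J) (S : pred J) (F : J -> P) s :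
  coord (\sum_(i <- r | S i) F i) s = \sum_(i <- r | S i) coord (F i) s.
Proof. exact: (big_morph (fun p => coord p s) (fun p q => coordD p q s) (coord0 s)). Qed.

Lemma coord_er (p : P) s : coord p s * e s = coord p s.
Proof.
rewrite /coord; case: (p s) => x /= /[dup] px /asboolP[a xe].
by rewrite [in RHS]xe [in LHS]xe -mulrA ee.
Qed.

Fact in_left_ideal_gen s : in_left_ideal (e s) (e s).
Proof. by apply/asboolP; exists 1; rewrite mul1r. Qed.

Definition gen (s : I) : P :=
  fun t => if t == s then (exist _ (e t) (in_left_ideal_gen t) : left_ideal (e t)) else 0.

Lemma coord_gen s t : coord (gen s) t = if t == s then e t else 0.
Proof. by rewrite /coord /gen; case: eqP. Qed.

Lemma coordE (p : P) : p = \sum_s coord p s *: gen s.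
Proof.
apply: coord_inj => t; rewrite coord_sum (bigD1 t) //= big1 => [|s nst].
  by rewrite coordZ coord_gen eqxx coord_er addr0.
by rewrite coordZ coord_gen eq_sym (negPf nst) mulr0.
Qed.

Lemma gen_e s : e s *: gen s = gen s.
Proof.
by apply: coord_inj => t; rewrite coordZ coord_gen; case: eqP => [->|]; rewrite ?ee ?mulr0.
Qed.

Section Extend.
Context (M : lmodType B).
Implicit Types c : I -> M.

(** A morphism out of P is a choice of elements of the [e s] M. Since [coord p s] is fixed by [e s]
    on the right, an arbitrary family c is admissible and only [e s *: c s] matters. *)
Definition extend_fun c (p : P) : M := \sum_s coord p s *: c s.
Fact extend_linear c : linear (extend_fun c).
Proof.
move=> b p q; rewrite /extend_fun scaler_sumr -big_split; apply: eq_bigr => s _.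
by rewrite coordD coordZ scalerDl scalerA.
Qed.
HB.instance Definition _ c :=
  GRing.isLinear.Build B P M *:%R (extend_fun c) (extend_linear c).
Definition extend c : lin P M := extend_fun c.

Lemma extend_gen c s : extend c (gen s) = e s *: c s.
Proof.
rewrite /= /extend_fun (bigD1 s) //= big1 ?addr0 => [|t nts].
  by rewrite coord_gen eqxx.
by rewrite coord_gen (negPf nts) scale0r.
Qed.

Lemma lin_genE (h : lin P M) (p : P) : h p = \sum_s coord p s *: h (gen s).
Proof. by rewrite {1}(coordE p) raddf_sum; apply: eq_bigr => s _; exact: linearZ. Qed.

Lemma lin_gen_eq (h h' : lin P M) : (forall s, h (gen s) = h' (gen s)) -> h = h'.
Proof.
by move=> hh; apply: linP => p; rewrite !lin_genE; apply: eq_bigr => s _; rewrite hh.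
Qed.

Lemma lin_gen_e (h : lin P M) s : e s *: h (gen s) = h (gen s).
Proof. by rewrite -linearZ gen_e. Qed.
End Extend.

Section Matrices.
Context (phi : alghom A' (end_op P)).

(** Row s holds the coordinates of the image of the generator s. In the opposite endomorphism
    algebra such matrices multiply in the usual order. *)
Definition mat (a : A') (s t : I) : B := coord (phi a (gen s)) t.

Lemma mat_er a s t : mat a s t * e t = mat a s t.
Proof. exact: coord_er. Qed.

Lemma mat_el a s t : e s * mat a s t = mat a s t.
Proof. by rewrite -coordZ -linearZ gen_e. Qed.

Lemma phi_gen a s : phi a (gen s) = \sum_t mat a s t *: gen t.
Proof. exact: coordE. Qed.

Lemma hom_mod_gen (M : lmodType B) a (h : hom_mod phi M) s :
  (a *: h) (gen s) = \sum_t mat a s t *: h (gen t).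
Proof. by rewrite -lin_genE. Qed.

Lemma matM a b s u : mat (a * b) s u = \sum_t mat a s t * mat b t u.
Proof.
rewrite /mat rmorphM /= (lin_genE (phi b)) coord_sum; apply: eq_bigr => t _.
by rewrite coordZ.
Qed.

Lemma matD a b s t : mat (a + b) s t = mat a s t + mat b s t.
Proof. by rewrite /mat rmorphD. Qed.

Lemma mat_sum (J : Type) (r : seq J) (S : pred J) (F : J -> A') s t :
  mat (\sum_(i <- r | S i) F i) s t = \sum_(i <- r | S i) mat (F i) s t.
Proof.
by rewrite (big_morph (fun a => mat a s t) (id1 := 0) (op1 := +%R)) // => [a b|];
  rewrite ?matD // /mat rmorph0.
Qed.

Lemma mat_scalar c s t : mat (kscalar c) s t = if t == s then kscalar c * e t else 0.
Proof.
rewrite /mat alghom_scalar -[X in coord X _]/(kscalar c *: gen s) coordZ coord_gen.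
by case: eqP; rewrite ?mulr0.
Qed.

Lemma mat1 s t : mat 1 s t = if t == s then e t else 0.
Proof. by rewrite -(@kscalar1 k) mat_scalar kscalar1 mul1r. Qed.

Lemma mat_scale c a s t : mat (kscalar c * a) s t = kscalar c * mat a s t.
Proof.
rewrite matM (bigD1 s) //= big1 ?addr0 => [|x nx].
  by rewrite mat_scalar eqxx -mulrA mat_el.
by rewrite mat_scalar (negPf nx) mul0r.
Qed.

Hypothesis phi_bij : bijective phi.

Lemma mat_inj a b : (forall s t, mat a s t = mat b s t) -> a = b.
Proof.
move=> ab; apply: (bij_inj phi_bij); apply: lin_gen_eq => s.
by rewrite !phi_gen; apply: eq_bigr => t _; rewrite ab.
Qed.

Lemma mat_surj (m : I -> I -> B) :
  exists a, forall s t, mat a s t = e s * m s t * e t.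
Proof.
have [psi _ phiK] := phi_bij.
exists (psi (extend (fun s => \sum_t m s t *: gen t))) => s t.
rewrite /mat phiK extend_gen coordZ coord_sum (bigD1 t) //= big1 => [|x nx].
  by rewrite coordZ coord_gen eqxx addr0 mulrA.
by rewrite coordZ coord_gen eq_sym (negPf nx) mulr0.
Qed.
End Matrices.
End ProjectiveSum.

Lemma fin_gen_finType (B : pzRingType) (M : lmodType B) (T : finType) (x : T -> M) :
  (forall y, exists c : T -> B, y = \sum_t c t *: x t) -> fin_gen M.
Proof.
move=> gx; exists #|T|, (fun i => x (enum_val i)) => y.
have [c ->] := gx y; exists (fun i => c (enum_val i)).
by rewrite (reindex (@enum_val T T)) //=; apply: onW_bij; exact: enum_val_bij.
Qed.

Lemma bij_lin_iso (B : pzRingType) (M N : Mod B) (f : morph M N) (g : N -> M) :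
  cancel (f : lin M N) g -> cancel g (f : lin M N) -> is_iso f.
Proof.
move=> fK gK; have gl : linear g.
  by move=> a x y; apply: (can_inj fK); rewrite linearP !gK.
pose gm := GRing.isLinear.Build B N M *:%R g gl.
pose g' : {linear N -> M} := HB.pack g gm.
by exists (g' : lin N M); split; apply: linP.
Qed.

Section CornerModule.
Context (B A' : pzRingType) (beta : B -> A').
Hypothesis betaD : {morph beta : b c / b + c}.
Hypothesis betaM : {morph beta : b c / b * c}.
Context (N : lmodType A').

(** The subgroup beta(1) N, described as the fixed points of the idempotent beta(1). As beta is not
    assumed unital, B acts unitally only there. *)
Definition in_corner : pred N := fun x => beta 1 *: x == x.
Fact corner_zmod : zmod_closed in_corner.
Proof.
split=> [|x y]; rewrite /in_corner !unfold_in /in_corner ?scaler0 //.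
by rewrite scalerBr => /eqP-> /eqP->.
Qed.
HB.instance Definition _ := GRing.isZmodClosed.Build N in_corner corner_zmod.

(* The hypotheses on beta are arguments because the module structure needs them. *)
Definition corner_of & {morph beta : b c / b + c} & {morph beta : b c / b * c} : Type :=
  {x : N | in_corner x}.
Local Notation corner := (corner_of betaD betaM).
HB.instance Definition _ := SubChoice.on corner.
HB.instance Definition _ := [SubChoice_isSubZmodule of corner by <:].

Fact corner_scale_in b x : in_corner (beta b *: x).
Proof. by rewrite /in_corner scalerA -betaM mul1r. Qed.
Definition corner_scale b (x : corner) : corner :=
  exist _ (beta b *: val x) (corner_scale_in b (val x)).
Fact corner_scaleA a b x : corner_scale a (corner_scale b x) = corner_scale (a * b) x.
Proof. by apply: val_inj; rewrite /= scalerA betaM. Qed.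
Fact corner_scale1 : left_id 1 corner_scale.
Proof. by move=> x; apply: val_inj => /=; apply/eqP; exact: (valP x). Qed.
Fact corner_scaleDr : right_distributive corner_scale +%R.
Proof. by move=> a x y; apply: val_inj; exact: scalerDr. Qed.
Fact corner_scaleDl x : {morph corner_scale^~ x : a b / a + b}.
Proof. by move=> a b; apply: val_inj; rewrite /= betaD scalerDl. Qed.
HB.instance Definition _ := GRing.Zmodule_isLmodule.Build B corner
  corner_scaleA corner_scale1 corner_scaleDr corner_scaleDl.

Lemma corner_valZ b (x : corner) : val (b *: x) = beta b *: val x.
Proof. by []. Qed.
End CornerModule.

Section MoritaModules.
Context (k : comNzRingType) (A' B : kalgType k) (I : finType) (e : I -> B).
Local Notation P := (dsum (fun s => left_ideal (e s) : lmodType B) : lmodType B).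
Hypothesis ee : forall s, e s * e s = e s.
Context (J : {set I}).
Hypothesis sum_J : \sum_(s in J) e s = 1.
Context (phi : alghom A' (end_op P)).
Hypothesis phi_bij : bijective phi.
Local Notation mat := (mat phi).

(** This is how P generates all modules: b -> (b e_s) and (b_s) -> sum b_s exhibit B as a retract of
    the part of P indexed by J, so M is recovered from the values of Hom(P, M) at the generators in
    J. *)
Lemma scale_sum_J (M : lmodType B) (x : M) : x = \sum_(s in J) e s *: x.
Proof. by rewrite -scaler_suml sum_J scale1r. Qed.

Let h (M : lmodType B) (t : I) (x : M) : hom_mod phi M :=
  extend e (fun s => if s == t then x else 0).

Let h_gen (M : lmodType B) t (x : M) s :
  h t x (gen e s) = if s == t then e t *: x else 0.
Proof.
by rewrite -[LHS]/(extend _ _ _) extend_gen //; case: eqP => [->|]; rewrite ?scaler0.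
Qed.

Let mu_ex (s t : I) (b : B) :
  exists a, forall s' t', mat a s' t' = e s' * (if (s' == s) && (t' == t) then b else 0) * e t'.
Proof. exact: (mat_surj phi_bij (fun s' t' => if (s' == s) && (t' == t) then b else 0)). Qed.

Let mu s t b : A' := sval (cid (mu_ex s t b)).

Let mat_mu s t b s' t' :
  mat (mu s t b) s' t' = if (s' == s) && (t' == t) then e s * b * e t else 0.
Proof.
rewrite /mu; case: cid => a /= ->; case: andP => [[/eqP-> /eqP->]//|].
by rewrite mulr0 mul0r.
Qed.

Let mu_gen (M : lmodType B) s t b (f : hom_mod phi M) s' :
  (mu s t b *: f) (gen e s') = if s' == s then (e s * b) *: f (gen e t) else 0.
Proof.
rewrite hom_mod_gen //; case: eqP => [->|ns].
  rewrite (bigD1 t) //= big1 ?addr0 => [|x nx].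
    by rewrite mat_mu !eqxx -[LHS]scalerA (lin_gen_e ee (f : lin P M)).
  by rewrite mat_mu eqxx (negPf nx) scale0r.
by rewrite big1 // => x _; rewrite mat_mu; case: eqP => // _; rewrite scale0r.
Qed.

Let eval_sum (M : lmodType B) (T : Type) (r : seq T) (S : pred T)
    (F : T -> hom_mod phi M) p :
  (\sum_(i <- r | S i) F i : hom_mod phi M) p = \sum_(i <- r | S i) F i p.
Proof. exact: (big_morph (fun f : hom_mod phi M => f p) (fun f g => erefl) erefl). Qed.

Lemma hom_mod_fin_gen (M : fgmod B) : fin_gen (hom_mod phi M).
Proof.
have [m [y gy]] := fgmod_fg M.
apply: (@fin_gen_finType _ _ ('I_m * I)%type (fun it => h it.2 (y it.1))) => f.
have /choice[b fb] : forall s, exists b : 'I_m -> B, f (gen e s) = \sum_i b i *: y i.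
  by move=> s; exact: gy.
(* Write f(gen s) as the sum over i of [b s i *: y i] and insert 1 = sum over J of the [e t] before
   [y i]; the matrix unit [mu s t (b s i)] carries the value of [h t (y i)] at the generator t to
   the generator s. *)
exists (fun it => if it.2 \in J then \sum_s mu s it.2 (b s it.1) else 0).
apply: lin_gen_eq => // s; rewrite eval_sum -[LHS](lin_gen_e ee (f : lin P M)) fb.
rewrite scaler_sumr.
rewrite -(pair_bigA _ (fun i t => ((if t \in J then \sum_s mu s t (b s i) else 0)
   *: h t (y i)) (gen e s))).
apply: eq_bigr => i _; rewrite scalerA {1}(scale_sum_J (y i)) scaler_sumr big_mkcond.
apply: eq_bigr => t _; case: ifP => _; last by rewrite scale0r.
rewrite scaler_suml eval_sum (bigD1 s) // big1 => [|x /andP[_ nx]].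
  by rewrite mu_gen eqxx h_gen eqxx [RHS]addr0.
by rewrite mu_gen eq_sym (negPf nx).
Qed.

Lemma hom_functor_faithful (fg : forall M : fgmod B, fin_gen (hom_mod phi M))
    (M N : Mod B) (f g : morph M N) :
  fmap (hom_functor fg) f = fmap (hom_functor fg) g -> f = g.
Proof.
move=> fg_eq; apply: linP => m; rewrite (scale_sum_J m) !raddf_sum.
apply: eq_bigr => t _.
have := congr1 (fun F : lin (hom_mod phi M) (hom_mod phi N) => F (h t m) (gen e t)) fg_eq.
by rewrite /= /hom_mod_map /= !h_gen eqxx.
Qed.

Lemma hom_functor_full (fg : forall M : fgmod B, fin_gen (hom_mod phi M))
    (M N : Mod B) (G : lin (hom_mod phi M) (hom_mod phi N)) :
  exists f : morph M N, fmap (hom_functor fg) f = G.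
Proof.
(* The formula is forced: m is the sum over J of the [e t *: m], and [e t *: m] is the value of
   [h t m] at the generator t. *)
pose f m := \sum_(t in J) G (h t m) (gen e t).
have hD t : {morph h t : x y / x + y}.
  move=> x y; apply: (lin_gen_eq ee) => s; rewrite -[RHS]/(h t x _ + h t y _) !h_gen.
  by case: eqP; rewrite ?addr0 // scalerDr.
(* G is linear over A', so it commutes with the matrix units, and these generate all the
   compatibilities required of f. *)
have GhE (g : hom_mod phi M) s t : t \in J ->
    G (h t (g (gen e s))) (gen e t) = e t *: (e s *: G g (gen e s)).
  move=> tJ; have -> : h t (g (gen e s)) = mu t s 1 *: g.
    by apply: (lin_gen_eq ee) => y; rewrite h_gen mu_gen mulr1.
  by rewrite linearZ mu_gen eqxx mulr1 (lin_gen_e ee (G g : lin P N)).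
have hmu t b m : h t (b *: m) = \sum_(s in J) mu t s b *: h s m.
  apply: (lin_gen_eq ee) => y; rewrite eval_sum h_gen.
  under eq_bigr do rewrite mu_gen.
  case: eqP => _; last by rewrite big1.
  rewrite {1}(scale_sum_J m) !scaler_sumr; apply: eq_bigr => s _.
  by rewrite h_gen eqxx [LHS]scalerA.
have Gmu t s b g : G (mu t s b *: g) (gen e t) = (e t * b) *: G g (gen e s).
  by rewrite linearZ mu_gen eqxx.
have f_lin : linear f.
  move=> b m m'; rewrite /f scaler_sumr.
  under eq_bigr do rewrite hD hmu raddfD raddf_sum.
  rewrite big_split; congr (_ + _).
  under eq_bigr do rewrite eval_sum.
  rewrite exchange_big; apply: eq_bigr => s sJ.
  under eq_bigr do rewrite Gmu.
  by rewrite /= -scaler_suml -mulr_suml sum_J mul1r.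
pose fm := GRing.isLinear.Build B M N *:%R f f_lin.
pose f' : {linear M -> N} := HB.pack f fm.
exists (f' : lin M N); apply: linP => g; apply: (lin_gen_eq ee) => s.
rewrite -[LHS]/(\sum_(t in J) G (h t (g (gen e s))) (gen e t)).
under eq_bigr => t tJ do rewrite GhE //.
by rewrite -scale_sum_J (lin_gen_e ee (G g : lin P N)).
Qed.

(* The algebra B is identified with the corner algebra of A' cut out by beta 1,
   and u s, w s exhibit A' as generated by that corner.                       *)
Lemma corner_data : exists (beta : B -> A') (u w : I -> A'),
  [/\ {morph beta : b c / b + c} /\ {morph beta : b c / b * c},
      forall c b, beta (kscalar c * b) = kscalar c * beta b,
      forall s, w s * u s = beta (e s),
      forall s t, s != t -> w s * u t = 0
    & [/\ \sum_s u s * w s = 1,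
          forall s, u s * beta (e s) = u s,
          forall s, beta (e s) * w s = w s,
          forall a t, a * u t = \sum_s u s * beta (mat a s t)
        & forall s x, exists b, beta 1 * x * u s = beta b]].
Proof.
have corner_ex (K L : pred I) (b : B) : exists a, forall s t,
    mat a s t = if K s && L t then e s * b * e t else 0.
  have [a aE] := mat_surj phi_bij (fun s t => if K s && L t then b else 0).
  by exists a => s t; rewrite aE; case: ifP; rewrite ?mulr0 ?mul0r.
(* Read through the retraction of the J-part of P onto B, [beta b] is right multiplication by b on
   B, [u i] is the inclusion of B e_i into B, and [w i] is right multiplication by e_i from B to B
   e_i. *)
have /choice[beta betaE] : forall b, exists a, forall s t,
    mat a s t = if (s \in J) && (t \in J) then e s * b * e t else 0.
  by move=> b; exact: (corner_ex (mem J) (mem J)).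
have /choice[u uE] : forall i, exists a, forall s t,
    mat a s t = if (s == i) && (t \in J) then e s * 1 * e t else 0.
  by move=> i; exact: (corner_ex (pred1 i) (mem J)).
have /choice[w wE] : forall i, exists a, forall s t,
    mat a s t = if (s \in J) && (t == i) then e s * 1 * e t else 0.
  by move=> i; exact: (corner_ex (mem J) (pred1 i)).
(* Each matrix identity below amounts to inserting 1 = sum over J of the [e x] between two
   factors. *)
have sum_mid b c : \sum_x (if x \in J then b * e x * (e x * c) else 0) = b * c.
  rewrite -big_mkcond /= -[b in RHS]mulr1 -sum_J mulr_sumr mulr_suml.
  by apply: eq_bigr => x _; rewrite mulrA -(mulrA b) ee.
have sum_at (i : I) (F : I -> B) : \sum_x (if x == i then F x else 0) = F i.
  by rewrite -big_mkcond big_pred1_eq.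
exists beta, u, w; split.
- split=> b c; apply: (mat_inj ee phi_bij) => s t.
    by rewrite matD !betaE; case: ifP; rewrite ?mulrDr ?mulrDl // addr0.
  rewrite (matM ee); under eq_bigr do rewrite !betaE.
  rewrite betaE /=; case: (s \in J) => /=; last by rewrite big1 // => x _; rewrite mul0r.
  case: (t \in J) => /=; last by rewrite big1 // => x _; rewrite andbF mulr0.
  have -> : e s * (b * c) * e t = (e s * b) * (c * e t) by rewrite !mulrA.
  rewrite -sum_mid; apply: eq_bigr => x _.
  by rewrite andbT; case: ifP; rewrite ?mulr0 // !mulrA.
- move=> c b; apply: (mat_inj ee phi_bij) => s t.
  rewrite (mat_scale ee) !betaE; case: ifP; rewrite ?mulr0 // => _.
  by rewrite (mulrA (e s)) -kscalarC !mulrA.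
- move=> i; apply: (mat_inj ee phi_bij) => s t.
  rewrite (matM ee); under eq_bigr do rewrite wE uE.
  rewrite betaE /=; case: (s \in J) => /=; last by rewrite big1 // => x _; rewrite mul0r.
  case: (t \in J) => /=; last by rewrite big1 // => x _; rewrite andbF mulr0.
  have -> : e s * e i * e t = e s * 1 * e i * (e i * 1 * e t).
    by rewrite !mulr1 [RHS]mulrA -[in RHS](mulrA (e s) (e i)) ee.
  rewrite -(sum_at i (fun x => e s * 1 * e x * (e x * 1 * e t))).
  by apply: eq_bigr => x _; rewrite andbT; case: ifP; rewrite ?mul0r.
- move=> i j nij; apply: (mat_inj ee phi_bij) => s t.
  rewrite (matM ee) big1 => [|x _]; first by rewrite /mat rmorph0.
  rewrite wE uE /=; case: eqP => [->|_]; last by rewrite andbF mul0r.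
  by rewrite (negPf nij) mulr0.
split.
- apply: (mat_inj ee phi_bij) => s t; rewrite mat_sum mat1.
  rewrite -(sum_at s (fun=> if t == s then e t else 0)); apply: eq_bigr => i _.
  rewrite (matM ee); under eq_bigr do rewrite uE wE.
  rewrite /= eq_sym; case: eqP => [->|_] /=; last by rewrite big1 // => x _; rewrite mul0r.
  case: eqP => [->|_]; last by rewrite big1 // => x _; rewrite andbF mulr0.
  rewrite -[RHS]ee -[RHS]sum_mid; apply: eq_bigr => x _.
  by rewrite andbT; case: ifP; rewrite ?mul0r ?mulr1.
- move=> i; apply: (mat_inj ee phi_bij) => s t.
  rewrite (matM ee); under eq_bigr do rewrite uE betaE.
  rewrite uE /=; case: eqP => [->|_] /=; last by rewrite big1 // => x _; rewrite mul0r.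
  case: (t \in J) => /=; last by rewrite big1 // => x _; rewrite andbF mulr0.
  rewrite mulr1 -[in RHS](ee i) -[RHS]mulrA -[RHS]sum_mid; apply: eq_bigr => x _.
  by rewrite andbT; case: ifP; rewrite ?mul0r ?mulr1 // !mulrA.
- move=> i; apply: (mat_inj ee phi_bij) => s t.
  rewrite (matM ee); under eq_bigr do rewrite wE betaE.
  rewrite wE /=; case: (s \in J) => /=; last by rewrite big1 // => x _; rewrite mul0r.
  case: eqP => [->|_] /=; last by rewrite big1 // => x _; rewrite andbF mulr0.
  rewrite mulr1 -[in RHS](ee i) [RHS]mulrA -[RHS]sum_mid; apply: eq_bigr => x _.
  by rewrite andbT; case: ifP; rewrite ?mul0r ?mulr1 // !mulrA.
- move=> a i; apply: (mat_inj ee phi_bij) => s t.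
  rewrite mat_sum (matM ee); under eq_bigr do rewrite uE /=.
  under [in RHS]eq_bigr do rewrite (matM ee).
  have [tJ|tJ] := boolP (t \in J); last first.
    rewrite big1 => [|x _]; last by rewrite andbF mulr0.
    rewrite big1 // => x _; rewrite big1 // => y _.
    by rewrite betaE /= (negPf tJ) andbF mulr0.
  have -> : \sum_x mat a s x * (if (x == i) && true then e x * 1 * e t else 0) =
      mat a s i * e t.
    rewrite (bigD1 i) //= eqxx big1 ?addr0 => [|x nx].
      by rewrite mulr1 mulrA (mat_er ee).
    by rewrite (negPf nx) mulr0.
  rewrite (bigD1 s) //= [X in _ + X]big1 ?addr0 => [|y ny]; last first.
    by rewrite big1 // => x _; rewrite uE /= eq_sym (negPf ny) mul0r.
  rewrite -[in LHS](mat_el ee phi a s i) -mulrA -[LHS]sum_mid; apply: eq_bigr => x _.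
  rewrite uE betaE /= eqxx tJ andbT; case: ifP; rewrite ?mul0r ?mulr1 // => _.
  by rewrite !mulrA.
- move=> i x; exists (\sum_(y in J) mat x y i); apply: (mat_inj ee phi_bij) => s t.
  have xu y : mat (x * u i) y t = if t \in J then mat x y i * e t else 0.
    rewrite (matM ee); under eq_bigr do rewrite uE /=.
    rewrite (bigD1 i) //= eqxx big1 ?addr0 /= => [|z nz].
      by case: ifP; rewrite ?mulr0 // mulr1 mulrA (mat_er ee).
    by rewrite (negPf nz) mulr0.
  rewrite -mulrA (matM ee) betaE /=; under eq_bigr do rewrite betaE xu /=.
  case: (t \in J); last by rewrite andbF big1 // => y _; rewrite mulr0.
  rewrite andbT; case: (s \in J) => /=; last by rewrite big1 // => y _; rewrite mul0r.
  rewrite mulr_sumr mulr_suml [RHS]big_mkcond; apply: eq_bigr => y _.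
  by case: ifP; rewrite ?mul0r // mulr1 -[in RHS](mat_el ee) !mulrA.
Qed.

(** The preimage of N is its corner beta(1) N. The elements [w s] map N into the corner, and sum
    [u s * w s] = 1 reassembles N from these images. *)
Lemma hom_functor_eso (fg : forall M : fgmod B, fin_gen (hom_mod phi M)) (N : Mod A') :
  exists (M : Mod B) (f : morph (hom_functor fg M) N), is_iso f.
Proof.
have [beta [u [w [[betaD betaM] betaZ wu wu0 [uw ub bw au corner]]]]] := corner_data.
pose C := corner_of N betaD betaM.
have wC s (x : N) : in_corner beta (w s *: x).
  by rewrite /in_corner scalerA -[w s]bw mulrA -betaM mul1r.
have C_fg : fin_gen C.
  have [m [y gy]] := fgmod_fg N.
  apply: (@fin_gen_finType _ _ ('I_m * I)%type
    (fun it => exist _ (w it.2 *: y it.1) (wC it.2 (y it.1)) : C)) => z.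
  have [c zE] := gy (val z).
  have /choice[b bE] : forall it : 'I_m * I, exists b : B,
    beta 1 * c it.1 * u it.2 = beta b by move=> it; exact: corner.
  exists (fun it => b (it.1, it.2)); apply: val_inj.
  rewrite raddf_sum -[LHS](eqP (valP z)) zE scaler_sumr.
  rewrite -(pair_bigA _ (fun i s => val (b (i, s) *: (exist _ (w s *: y i) (wC s (y i)) : C)))).
  apply: eq_bigr => i _; rewrite -[y i in LHS]scale1r -uw scaler_suml !scaler_sumr.
  by apply: eq_bigr => s _; rewrite corner_valZ -bE !scalerA !mulrA.
pose M : Mod B := FgMod C_fg.
pose f (g : hom_mod phi M) : N := \sum_s u s *: val (g (gen e s)).
have f_lin : linear f.
  move=> a g g'; rewrite /f scaler_sumr.
  have evalD s : val ((a *: g + g') (gen e s)) =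
    val ((a *: g) (gen e s)) + val (g' (gen e s)) by [].
  under eq_bigr do rewrite evalD scalerDr.
  rewrite big_split; congr (_ + _).
  under [RHS]eq_bigr do rewrite scalerA au scaler_suml.
  rewrite exchange_big; apply: eq_bigr => s _.
  rewrite hom_mod_gen // raddf_sum scaler_sumr; apply: eq_bigr => t _.
  by rewrite -[RHS]scalerA.
pose fm := GRing.isLinear.Build A' (hom_mod phi M) N *:%R f f_lin.
pose f' : {linear hom_mod phi M -> N} := HB.pack f fm.
pose g (x : N) : hom_mod phi M := extend e (fun s => exist _ (w s *: x) (wC s x) : C).
have g_gen x s : val (g x (gen e s)) = w s *: x.
  rewrite -[g x _]/(extend _ _ _) extend_gen //.
  by rewrite corner_valZ /= scalerA bw.
exists M, (f' : lin (hom_ob fg M) N); apply: (@bij_lin_iso _ (hom_ob fg M) N _ g).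
- move=> q; apply: (lin_gen_eq ee) => s; apply: val_inj; rewrite g_gen.
  rewrite -[f' q]/(f q) /f scaler_sumr (bigD1 s) //= big1 => [|t nt].
    by rewrite addr0 scalerA wu -corner_valZ (lin_gen_e ee (q : lin P C)).
  by rewrite scalerA wu0 ?scale0r // eq_sym.
- move=> x; rewrite -[LHS]/(\sum_s u s *: val (g x (gen e s))).
  under eq_bigr do rewrite g_gen scalerA.
  by rewrite -scaler_suml uw scale1r.
Qed.

Lemma hom_functor_equivalence :
  exists fg : forall M : fgmod B, fin_gen (hom_mod phi M),
    is_equivalence (hom_functor fg).
Proof.
exists hom_mod_fin_gen; apply: equivalence_of_ff_eso.
- exact: hom_functor_faithful.
- exact: hom_functor_full.
- exact: hom_functor_eso.
Qed.
End MoritaModules.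

(** * The same Morita equivalence for representations in an abelian category *)

Section MoritaRepresentations.
Context (k : comNzRingType) (A' B : kalgType k) (I : finType) (e : I -> B).
Local Notation P := (dsum (fun s => left_ideal (e s) : lmodType B) : lmodType B).
Hypothesis ee : forall s, e s * e s = e s.
Context (phi : alghom A' (end_op P)) (A : lincat k).
Local Notation mat := (mat phi).

(* F M is the direct sum over s of the images of the idempotents e s on M. *)
Definition is_sum_functor (F : functor (Rep B A) (Rep A' A))
    (q : forall (M : Rep B A) (s : I), lhom (rep_ob (F M)) (rep_ob M))
    (p : forall (M : Rep B A) (s : I), lhom (rep_ob M) (rep_ob (F M))) : Prop :=
  [/\ forall M, is_splitting (fun s => rep_act_hom M (e s)) (q M) (p M),
      forall (M : Rep B A) a s,
        q M s \oc rep_act_hom (F M) a = \sum_t rep_act_hom M (mat a s t) \oc q M t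
    & forall (M N : Rep B A) (f : morph M N) s,
        q N s \oc sval (fmap F f) = sval f \oc q M s].

Lemma sum_functor_exists : is_abelian A -> 
  exists (F : functor (Rep B A) (Rep A' A)) q p, @is_sum_functor F q p.
Proof.
move=> A_abelian.
have ee' (M : rep B A) s : rep_act_hom M (e s) \oc rep_act_hom M (e s) =
  rep_act_hom M (e s) by rewrite -rep_actM ee.
have /dep_choice[Z /dep_choice[q /dep_choice[p qp]]] :=
  fun M => split_idempotents A_abelian (ee' M).
pose act (M : rep B A) a := \sum_s p M s \oc \sum_t (rep_act_hom M (mat a s t) \oc q M t).
have q_sum (M : rep B A) (Y : A) (G : I -> lhom Y (rep_ob M)) s :
    q M s \oc (\sum_s p M s \oc G s) = rep_act_hom M (e s) \oc G s.
  rewrite lcomp_sumr (bigD1 s) //= big1 => [|t nt].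
    by rewrite lcompA (splitting_qp (qp M)) addr0.
  by rewrite lcompA (proj1 (qp M)) eq_sym (negPf nt) lcomp0l.
have qact M a s : q M s \oc act M a = \sum_t rep_act_hom M (mat a s t) \oc q M t.
  rewrite q_sum lcomp_sumr; apply: eq_bigr => t _.
  by rewrite lcompA -rep_actM (mat_el ee).
have actD M : {morph act M : a b / a + b}.
  move=> a b; apply: (splitting_inj (qp M)) => s.
  rewrite lcompDr !qact -big_split; apply: eq_bigr => t _.
  by rewrite matD rep_actD lcompDl.
have actM M : {morph act M : a b / a * b >-> a \oc b}.
  move=> a b; apply: (splitting_inj (qp M)) => s.
  rewrite lcompA !qact lcomp_suml.
  under [RHS]eq_bigr do rewrite -lcompA qact lcomp_sumr.
  rewrite exchange_big; apply: eq_bigr => t _.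
  rewrite (matM ee) rep_act_sum lcomp_suml; apply: eq_bigr => x _.
  by rewrite rep_actM lcompA.
have actS M c : act M (kscalar c) = c *: lid (Z M).
  apply: (splitting_inj (qp M)) => s.
  rewrite qact (bigD1 s) //= big1 => [|t nt].
    rewrite mat_scalar eqxx rep_actZ lcompZl lcompZr lcomp1 addr0.
    by rewrite (splitting_eq (qp M)).
  by rewrite mat_scalar (negPf nt) rep_act0 lcomp0l.
pose Fob (M : Rep B A) : Rep A' A := mk_rep (actD M) (actM M) (actS M).
have Fob_act M a : rep_act_hom (Fob M) a = act M a by exact: mk_rep_act.
pose fm (M N : rep B A) (f : rep_hom M N) := \sum_s p N s \oc (sval f \oc q M s).
have qf M N f s : q N s \oc fm M N f = sval f \oc q M s.
  by rewrite q_sum lcompA -(svalP f) -lcompA (splitting_eq (qp M)).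
have fm_act M N f a : fm M N f \oc rep_act_hom (Fob M) a = rep_act_hom (Fob N) a \oc fm M N f.
  rewrite !Fob_act; apply: (splitting_inj (qp N)) => s.
  rewrite !lcompA qf -lcompA !qact lcomp_sumr lcomp_suml; apply: eq_bigr => t _.
  by rewrite lcompA (svalP f) -!lcompA qf.
pose Fmap (M N : Rep B A) (f : morph M N) : morph (Fob M) (Fob N) :=
  exist _ (fm M N f) (fm_act M N f).
have F1 M : Fmap M M (idc M) = idc (Fob M).
  apply: sig_eq; apply: (splitting_inj (qp M)) => s.
  by rewrite [LHS]qf /= l1comp lcomp1.
have FM (L M N : Rep B A) (g : morph M N) (f : morph L M) :
    Fmap _ _ (compc g f) = compc (Fmap _ _ g) (Fmap _ _ f).
  apply: sig_eq; apply: (splitting_inj (qp N)) => s.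
  by rewrite [LHS]qf /= lcompA qf -!lcompA qf.
by exists (Functor F1 FM), q, p; split.
Qed.

Section SumFunctor.
Context (F : functor (Rep B A) (Rep A' A)).
Context (q : forall (M : Rep B A) (s : I), lhom (rep_ob (F M)) (rep_ob M)).
Context (p : forall (M : Rep B A) (s : I), lhom (rep_ob M) (rep_ob (F M))).
Hypothesis qp : forall M, is_splitting (fun s => rep_act_hom M (e s)) (q M) (p M).
Hypothesis q_act : forall (M : Rep B A) a s,
  q M s \oc rep_act_hom (F M) a = \sum_t rep_act_hom M (mat a s t) \oc q M t.
Hypothesis q_map : forall (M N : Rep B A) (f : morph M N) s,
  q N s \oc sval (fmap F f) = sval f \oc q M s.

Definition induced_map (X : A) (M : Rep B A) (f : hom_rep X (F M)) :
  hom_mod phi (hom_rep X M) := extend e (fun s => q M s \oc f : hom_rep X M).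

Lemma induced_map_gen (X : A) (M : Rep B A) (f : hom_rep X (F M)) s :
  induced_map f (gen e s) = q M s \oc f.
Proof.
rewrite -[LHS]/(extend _ _ _) extend_gen // -[LHS]/(rep_act_hom _ _ \oc _).
by rewrite lcompA (splitting_eq (qp M)).
Qed.

Lemma induced_map_act (X : A) (M : Rep B A) a (f : hom_rep X (F M)) :
  induced_map (rep_act_hom (F M) a \oc f) = a *: induced_map f.
Proof.
apply: (lin_gen_eq ee) => s; rewrite hom_mod_gen // induced_map_gen.
rewrite lcompA q_act lcomp_suml.
by apply: eq_bigr => t _; rewrite induced_map_gen -lcompA.
Qed.

Fact induced_map_linear (X : A) (M : Rep B A) : linear (@induced_map X M).
Proof.
move=> a f g; rewrite -induced_map_act; apply: (lin_gen_eq ee) => s.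
rewrite -[RHS]/(induced_map _ (gen e s) + induced_map g (gen e s)).
by rewrite !induced_map_gen -lcompDr.
Qed.
HB.instance Definition _ (X : A) (M : Rep B A) :=
  GRing.isLinear.Build A' (hom_rep X (F M)) (hom_mod phi (hom_rep X M)) *:%R
    (@induced_map X M) (@induced_map_linear X M).

Lemma sum_functor_induced : is_induced phi F.
Proof.
exists (fun X M => @induced_map X M : lin (hom_rep X (F M)) (hom_mod phi (hom_rep X M))).
split.
- move=> X M.
  exists (fun h : hom_mod phi (hom_rep X M) =>
    \sum_s p M s \oc ((h (gen e s) : hom_rep X M) : lhom X (rep_ob M))).
    move=> f; rewrite -[RHS]l1comp -(proj2 (qp M)) lcomp_suml.
    by apply: eq_bigr => s _; rewrite -lcompA -induced_map_gen.
  move=> h; apply: (lin_gen_eq ee) => s; rewrite [LHS]induced_map_gen.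
  rewrite lcomp_sumr (bigD1 s) //= big1 => [|t nt].
    rewrite lcompA (splitting_qp (qp M)) [LHS]addr0.
    exact: (lin_gen_e ee (h : lin P (hom_rep X M))).
  by rewrite lcompA (proj1 (qp M)) eq_sym (negPf nt) lcomp0l.
- move=> X Y M g f x; rewrite /= /extend_fun lcomp_suml; apply: eq_bigr => s _.
  rewrite -[LHS]/(rep_act_hom M _ \oc (q M s \oc (f \oc g))).
  by rewrite -[RHS]/(rep_act_hom M _ \oc (q M s \oc f) \oc g) !lcompA.
- move=> X M N h f x; rewrite /= /extend_fun lcomp_sumr; apply: eq_bigr => s _.
  rewrite -[LHS]/(rep_act_hom N _ \oc (q N s \oc (_ \oc _))).
  rewrite -[RHS]/(sval h \oc (rep_act_hom M _ \oc (q M s \oc _))).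
  by rewrite (lcompA (q N s)) q_map !lcompA (svalP h).
Qed.

Hypothesis phi_bij : bijective phi.
Context (J : {set I}).
Hypothesis sum_J : \sum_(s in J) e s = 1.

(** The element a does not depend on M. Hence a morphism from F M to F N intertwines the maps p_s b
    q_t on both sides, which is what fullness uses. *)
Lemma sum_functor_unit (s t : I) (b : B) :
  exists a, forall M : Rep B A, rep_act_hom (F M) a = p M s \oc rep_act_hom M b \oc q M t.
Proof.
have [a aE] := mat_surj phi_bij (fun s' t' => if (s' == s) && (t' == t) then b else 0).
exists a => M; apply: (splitting_inj (qp M)) => s'; rewrite q_act.
rewrite (bigD1 t) //= big1 ?addr0 => [|t' nt]; last first.
  by rewrite aE (negPf nt) andbF mulr0 mul0r rep_act0 lcomp0l.
rewrite aE eqxx andbT !lcompA (proj1 (qp M)).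
case: eqP => [->|_]; last by rewrite mulr0 mul0r rep_act0 !lcomp0l.
by rewrite !rep_actM -lcompA (splitting_eq (qp M)).
Qed.

Lemma sum_J_id (M : Rep B A) : \sum_(s in J) q M s \oc p M s = lid (rep_ob M).
Proof.
under eq_bigr do rewrite (splitting_qp (qp M)).
by rewrite -rep_act_sum sum_J rep_act1.
Qed.

Lemma sum_functor_faithful (M N : Rep B A) (f g : morph M N) :
  fmap F f = fmap F g -> f = g.
Proof.
move=> fg; apply: sig_eq; rewrite -[sval f]lcomp1 -[sval g]lcomp1 -sum_J_id.
rewrite !lcomp_sumr; apply: eq_bigr => s _.
by rewrite !lcompA -!q_map fg.
Qed.

Lemma sum_functor_full (M N : Rep B A) (g : morph (F M) (F N)) : exists f, fmap F f = g.
Proof.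
have gU s t b : sval g \oc (p M s \oc rep_act_hom M b \oc q M t) =
    p N s \oc rep_act_hom N b \oc q N t \oc sval g.
  by have [a aE] := sum_functor_unit s t b; rewrite -!aE (svalP g).
pose f := \sum_(s in J) q N s \oc sval g \oc p M s.
have fb b : f \oc rep_act_hom M b = rep_act_hom N b \oc f.
  transitivity (\sum_(s in J) \sum_(t in J)
      q N s \oc (sval g \oc (p M s \oc rep_act_hom M b \oc q M t)) \oc p M t).
    rewrite /f lcomp_suml; apply: eq_bigr => s _.
    rewrite -[LHS]lcomp1 -sum_J_id lcomp_sumr; apply: eq_bigr => t _.
    by rewrite !lcompA.
  rewrite exchange_big /f lcomp_sumr; apply: eq_bigr => t _.
  under eq_bigr do rewrite gU !lcompA.
  by rewrite -!lcomp_suml sum_J_id l1comp !lcompA.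
exists (exist _ f fb); apply: sig_eq; apply: (splitting_inj (qp N)) => r.
rewrite q_map /= lcomp_suml.
transitivity (\sum_(s in J) q N s \oc (sval g \oc (p M s \oc rep_act_hom M 1 \oc q M r))).
  by apply: eq_bigr => s _; rewrite rep_act1 lcomp1 !lcompA.
under eq_bigr do rewrite gU rep_act1 lcomp1 !lcompA.
by rewrite -!lcomp_suml sum_J_id l1comp.
Qed.

Hypothesis A_abelian : is_abelian A.

(** The corner construction for modules, with the submodule beta(1) N replaced by the object C
    through which the idempotent action of beta(1) splits. *)
Lemma sum_functor_eso (N : Rep A' A) :
  exists (M : Rep B A) (f : morph (F M) N), is_iso f.
Proof.
have [beta [u [w [[betaD betaM] betaZ wu wu0 [uw ub bw au _]]]]] :=
  corner_data ee sum_J phi_bij.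
have bb : rep_act_hom N (beta 1) \oc rep_act_hom N (beta 1) = rep_act_hom N (beta 1).
  by rewrite -rep_actM -betaM mulr1.
have [C [i [r [ri ir]]]] := split_idempotent A_abelian bb.
pose act b := r \oc rep_act_hom N (beta b) \oc i.
have r1 : r \oc rep_act_hom N (beta 1) = r by rewrite -ir lcompA ri l1comp.
have i1 : rep_act_hom N (beta 1) \oc i = i by rewrite -ir -lcompA ri lcomp1.
have actD : {morph act : a b / a + b}.
  by move=> a b; rewrite /act betaD rep_actD lcompDr lcompDl.
have actM : {morph act : a b / a * b >-> a \oc b}.
  move=> a b; rewrite /act !lcompA -(lcompA _ i) ir.
  by rewrite -!(lcompA r) -!rep_actM -!betaM mulr1.
have actS c : act (kscalar c) = c *: lid C.
  by rewrite /act -[kscalar c]mulr1 betaZ rep_actZ lcompZr lcompZl r1 ri.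
have [M [i' [r' [Mact ri' ir']]]] : exists (M : Rep B A)
    (i' : lhom (rep_ob M) (rep_ob N)) (r' : lhom (rep_ob N) (rep_ob M)),
  [/\ forall b, rep_act_hom M b = r' \oc rep_act_hom N (beta b) \oc i',
      r' \oc i' = lid _ & i' \oc r' = rep_act_hom N (beta 1)].
  by exists (mk_rep actD actM actS), i, r; split.
pose f := \sum_s rep_act_hom N (u s) \oc i' \oc q M s.
pose g := \sum_s p M s \oc r' \oc rep_act_hom N (w s).
have u1 s : rep_act_hom N (u s) \oc rep_act_hom N (beta 1) = rep_act_hom N (u s).
  by rewrite -rep_actM -[u s]ub -mulrA -betaM mulr1.
have f_act a : f \oc rep_act_hom (F M) a = rep_act_hom N a \oc f.
  rewrite lcomp_suml lcomp_sumr.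
  under [RHS]eq_bigr do rewrite !lcompA -rep_actM au rep_act_sum !lcomp_suml.
  rewrite exchange_big; apply: eq_bigr => s _.
  rewrite -lcompA q_act lcomp_sumr; apply: eq_bigr => t _.
  by rewrite Mact !lcompA -(lcompA _ i' r') ir' u1 rep_actM.
have qg s : q M s \oc g = r' \oc rep_act_hom N (w s).
  rewrite /g lcomp_sumr (bigD1 s) //= big1 ?addr0 => [|t nt]; last first.
    by rewrite !lcompA (proj1 (qp M)) eq_sym (negPf nt) !lcomp0l.
  rewrite !lcompA (splitting_qp (qp M)) Mact -(lcompA _ i' r') ir' -!lcompA.
  by rewrite -!rep_actM mulrA -betaM mulr1 bw.
exists M, (exist _ f f_act : rep_hom (F M) N).
apply: (@rep_hom_iso _ _ _ _ _ _ g) => /=.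
- apply: (splitting_inj (qp M)) => s; rewrite lcomp1 lcompA qg lcomp_sumr.
  rewrite (bigD1 s) //= big1 ?addr0 => [|t nt]; last first.
    rewrite !lcompA -(lcompA r') -rep_actM wu0 1?eq_sym //.
    by rewrite rep_act0 lcomp0r !lcomp0l.
  by rewrite !lcompA -(lcompA r') -rep_actM wu -Mact (splitting_eq (qp M)).
- rewrite lcomp_suml -(@rep_act1 _ _ _ N) -uw rep_act_sum; apply: eq_bigr => s _.
  by rewrite -lcompA qg lcompA -(lcompA _ i' r') ir' u1 rep_actM.
Qed.

Lemma sum_functor_equivalence : is_equivalence F.
Proof.
apply: equivalence_of_ff_eso; [exact: sum_functor_faithful | exact: sum_functor_full |].
exact: sum_functor_eso.
Qed.
End SumFunctor.
End MoritaRepresentations.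

(** * The simplicial structure on families indexed by subsets *)

(* A subset S of {1, ..., j} is encoded by the list of bits of length j whose
   entry of index i - 1 tells whether i is in S. A cochain c on the simplices
   0 u S of the simplex [0, ..., j] extends uniquely to all simplices, its value
   at a simplex U not containing 0 being [nochain c U].                       *)
Section SubsetOperators.
Context (M : zmodType) (del : M -> M).
Implicit Types (c : seq bool -> M) (s : seq bool).

(** For S = {u_0 < u_1 < ...} this is the sum of (-1)^i c(S - u_i). The boundary of 0 u S is S minus
    the alternating sum of the 0 u (S - u_i), so a chain map f satisfies f(S) = del (f(0 u S)) +
    [alt_sum], the formula of [nochain]. *)
Fixpoint alt_sum c s : M :=
  match s with
  | [::] => 0
  | true :: s' => c (false :: s') - alt_sum (fun x => c (true :: x)) s'
  | false :: s' => alt_sum (fun x => c (false :: x)) s'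
  end.

(** Image of a subset under the coface that misses the vertex i + 1. *)
Fixpoint skip_bit i s : seq bool :=
  match i, s with
  | i'.+1, b :: s' => b :: skip_bit i' s'
  | _, _ => false :: s
  end.

(** The codegeneracy identifying the vertices i + 1 and i + 2: a simplex containing both becomes
    degenerate, hence the value 0. *)
Fixpoint merge_bits i c s : M :=
  match i, s with
  | 0, a :: b :: s' => if a && b then 0 else c ((a || b) :: s')
  | i'.+1, b :: s' => merge_bits i' (fun x => c (b :: x)) s'
  | _, _ => 0
  end.

Definition nochain c s : M := del (c s) + alt_sum c s.

(** The coface of d_0 sends 0 u S to the simplex {1} u (S + 1), which misses 0 and has the bits
    [true :: s]. The other cofaces fix the vertex 0. *)
Definition face i c s : M :=
  if i is i'.+1 then c (skip_bit i' s) else nochain c (true :: s).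

Definition degen i c s : M :=
  if i is i'.+1 then merge_bits i' c s
  else if s is false :: s' then c s' else 0.

Lemma size_skip_bit i s : size (skip_bit i s) = (size s).+1.
Proof. by elim: i s => [|i IH] [|b s] //=; rewrite IH. Qed.

Lemma count_skip_bit i s : count id (skip_bit i s) = count id s.
Proof. by elim: i s => [|i IH] [|b s] //=; rewrite IH. Qed.

Lemma eq_alt_sum c c' s :
  (forall x, size x = size s -> c x = c' x) -> alt_sum c s = alt_sum c' s.
Proof.
elim: s c c' => [|[] s IH] c c' cc //=.
  by rewrite cc // (IH _ (fun x => c' (true :: x))) // => x sx; apply: cc; rewrite /= sx.
by apply: IH => x sx; apply: cc; rewrite /= sx.
Qed.

Lemma alt_sumD c c' s : alt_sum (fun x => c x + c' x) s = alt_sum c s + alt_sum c' s.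
Proof.
elim: s c c' => [|[] s IH] c c' /=; rewrite ?addr0 //.
by rewrite (IH (fun x => c _)) opprD addrACA.
Qed.

Lemma alt_sumN c s : alt_sum (fun x => - c x) s = - alt_sum c s.
Proof.
by elim: s c => [|[] s IH] c /=; rewrite ?oppr0 // (IH (fun x => c _)) opprB opprK addrC.
Qed.

Lemma alt_sum0 s : alt_sum (fun=> 0) s = 0.
Proof. by elim: s => [|[] s IH] //=; rewrite IH subrr. Qed.

Lemma alt_sum_alt_sum c s : alt_sum (alt_sum c) s = 0.
Proof.
elim: s c => [|[] s IH] c //=.
by rewrite alt_sumD alt_sumN IH oppr0 addr0 subrr.
Qed.

Lemma alt_sum_skip i c s : alt_sum (fun x => c (skip_bit i x)) s = alt_sum c (skip_bit i s).
Proof.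
elim: i s c => [|i IH] [|[] s] c //=; first by rewrite (IH _ (fun x => c (true :: x))).
exact: (IH _ (fun x => c (false :: x))).
Qed.

Lemma eq_merge_bits i c c' s : (i.+1 < size s)%N ->
  (forall x, (size x).+1 = size s -> c x = c' x) -> merge_bits i c s = merge_bits i c' s.
Proof.
elim: i s c c' => [|i IH] [|a s] c c' //=.
  by case: s => [|b s] // _ cc; rewrite cc.
by rewrite ltnS => lti cc; apply: IH => // x sx; apply: cc; rewrite -sx.
Qed.

Lemma merge_bitsD i c c' s :
  merge_bits i (fun x => c x + c' x) s = merge_bits i c s + merge_bits i c' s.
Proof.
elim: i s c c' => [|i IH] [|a s] c c' /=; rewrite ?addr0 //.
by case: s => [|b s]; [rewrite addr0 | case: ifP; rewrite ?addr0].
Qed.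

Lemma merge_bitsN i c s : merge_bits i (fun x => - c x) s = - merge_bits i c s.
Proof.
elim: i s c => [|i IH] [|a s] c /=; rewrite ?oppr0 //.
by case: s => [|b s]; [rewrite oppr0 | case: ifP; rewrite ?oppr0].
Qed.

Lemma alt_sum_merge i c s : (i.+1 < size s)%N ->
  alt_sum (merge_bits i c) s = merge_bits i (alt_sum c) s.
Proof.
elim: i s c => [|i IH] [|a s] c //=.
  case: s => [|b s] // _; case: a b => [] [] /=; rewrite ?alt_sum0 ?subr0 ?subrr //.
rewrite ltnS => lti; have IHs c' := IH s c' lti.
case: a => /=; last by rewrite IHs.
by rewrite IHs merge_bitsD merge_bitsN.
Qed.

Hypothesis delD : {morph del : x y / x + y}.
Hypothesis del_del : forall x, del (del x) = 0.

Lemma del0 : del 0 = 0.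
Proof. by apply: (addIr (del 0)); rewrite -delD !add0r. Qed.

Lemma delN x : del (- x) = - del x.
Proof. by apply: (addIr (del x)); rewrite -delD !addNr del0. Qed.

Lemma alt_sum_del c s : alt_sum (fun x => del (c x)) s = del (alt_sum c s).
Proof.
elim: s c => [|[] s IH] c /=; rewrite ?del0 //.
by rewrite (IH (fun x => c _)) delD delN.
Qed.

Lemma merge_bits_del i c s : merge_bits i (fun x => del (c x)) s = del (merge_bits i c s).
Proof.
elim: i s c => [|i IH] [|a s] c /=; rewrite ?del0 //.
by case: s => [|b s]; [rewrite del0 | case: ifP; rewrite ?del0].
Qed.

(** The forced values satisfy the chain map equation on the simplices without 0 as well; this is
    where the square of [del] has to vanish. *)
Lemma nochain_nochain c s : alt_sum (nochain c) s = del (nochain c s).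
Proof.
by rewrite /nochain alt_sumD alt_sum_alt_sum alt_sum_del delD del_del addr0 add0r.
Qed.

Lemma nochain_skip i c s : nochain (fun x => c (skip_bit i x)) s = nochain c (skip_bit i s).
Proof. by rewrite /nochain alt_sum_skip. Qed.

Lemma nochain_merge i c s : (i.+1 < size s)%N ->
  nochain (merge_bits i c) s = merge_bits i (nochain c) s.
Proof. by move=> lti; rewrite /nochain alt_sum_merge // merge_bitsD merge_bits_del. Qed.

Lemma face0_face0 c s : face 0 (face 0 c) s = face 0 (face 1 c) s.
Proof.
have /= := nochain_nochain c (true :: true :: s).
(* In the chain map equation for {1, 2} u (S + 2), the term omitting the vertex 1 is the one
   produced by d_1 and then d_0; the remaining terms make up d_0 applied twice. *)
move=> /(canRL (addrNK _)) => e.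
by rewrite /= (nochain_skip 0 c) [in RHS]/skip_bit e.
Qed.

Lemma skip_skip i j s : (j <= i)%N -> (i <= size s)%N ->
  skip_bit i.+1 (skip_bit j s) = skip_bit j (skip_bit i s).
Proof. by elim: j i s => [|j IH] [|i] [|b s] //= ji si; rewrite -IH. Qed.

Lemma face_face i j c s : (j < i)%N -> (i <= (size s).+2)%N ->
  face j (face i c) s = face i.-1 (face j c) s.
Proof.
case: i => // i; case: j => [|j] /=; rewrite ltnS.
  case: i => [|i] _ _; first by rewrite face0_face0.
  exact: (nochain_skip i.+1 c (true :: s)).
case: i => // i; rewrite !ltnS => ji si; exact: (congr1 c (skip_skip ji si)).
Qed.

Lemma merge_skip_lt i j c s : (j <= i)%N -> (i.+1 < size s)%N ->
  merge_bits i.+1 c (skip_bit j s) = merge_bits i (fun x => c (skip_bit j x)) s.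
Proof.
elim: j i c s => [|j IH] [|i] c [|b s] //=.
by rewrite !ltnS; exact: (IH i (fun x => c (b :: x))).
Qed.

Lemma face_degen_lt i j c s : (j < i)%N -> (i <= size s)%N ->
  face j (degen i c) s = degen i.-1 (face j c) s.
Proof.
case: i => // i; case: j => [|j] /=; rewrite ltnS.
  case: i => [|i] _ si.
    case: s si => [|b s] // _; rewrite /nochain /=.
    by case: b; rewrite /= ?del0 ?add0r ?alt_sum0 ?subr0 ?subrr //.
  exact: (@nochain_merge i.+1 c (true :: s)).
by case: i => // i ji si; exact: merge_skip_lt.
Qed.

Lemma face_degen_id i j c s : (j == i) || (j == i.+1) -> (i <= size s)%N ->
  face j (degen i c) s = c s.
Proof.
have merge_id n x c' : (n < size x)%N -> merge_bits n c' (skip_bit n x) = c' x /\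
    merge_bits n c' (skip_bit n.+1 x) = c' x.
  elim: n x c' => [|n IHn] [|a x] c' //=; last first.
    by rewrite ltnS => nx; exact: (IHn x (fun y => c' (a :: y))).
  by case: a => /=; case: x.
case: i => [|i] /=.
  case: j => [|[|j]] //= _ _.
  rewrite /nochain /= del0 add0r (_ : alt_sum _ s = 0) ?subr0 //.
  exact: alt_sum0.
by move=> ji si; have [ei ej] := merge_id i s c si; case/orP: ji => /eqP->.
Qed.

Lemma face_degen_gt i j c s : (i.+1 < j)%N -> (j <= (size s).+1)%N -> (i < size s)%N ->
  face j (degen i c) s = degen i (face j.-1 c) s.
Proof.
have merge_gt n m c' x : (n < m)%N -> (m <= size x)%N -> (n.+1 < size x)%N ->
    merge_bits n c' (skip_bit m.+1 x) = merge_bits n (fun y => c' (skip_bit m y)) x.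
  elim: n m x c' => [|n IHn] [|m] [|a x] c' //=.
    by case: x => [|b x] //=; case: (a && b).
  rewrite !ltnS => nm mx nx; exact: (IHn m x (fun y => c' (a :: y))).
case: j => [|[|j]] //=; case: i => [|i]; rewrite !ltnS => ij js si.
  by case: s si js => [|[] s].
by case: j ij js => // j ij js; exact: (merge_gt i j.+1 c s ij (ltnW js) si).
Qed.

Lemma merge_bits0 i s : merge_bits i (fun=> 0) s = 0.
Proof. by elim: i s => [|i IH] [|a s] //=; case: s => [|b s] //; case: ifP. Qed.

Lemma degen_degen i j c s : (i < j)%N -> (j < size s)%N ->
  degen j (degen i c) s = degen i (degen j.-1 c) s.
Proof.
have merge_merge n m c' x : (n <= m)%N -> (m.+2 < size x)%N ->
    merge_bits m.+1 (merge_bits n c') x = merge_bits n (merge_bits m c') x.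
  elim: n m x c' => [|n IHn] [|m] [|a x] c' //=.
  - by case: x => [|b [|d x]] // _ _; case: a b d => [] [] [].
  - by case: x => [|b x] // _ _; case: a b => [] [] //=; rewrite merge_bits0.
  - by rewrite !ltnS; exact: (IHn m x (fun y => c' (a :: y))).
case: j => // j; case: s => [|a s] //; case: i => [|i] /=; rewrite !ltnS => ij js.
  case: j ij js => [|j] _ js; last by case: a; rewrite /= ?merge_bits0.
  by case: s js => [|b s] //; case: a b => [] [].
by case: j ij js => // j ij js; exact: (merge_merge i j c (a :: s) ij js).
Qed.
End SubsetOperators.

Section SubsetOperatorsExtra.
Context (M : zmodType) (del : M -> M).
Implicit Types (c : seq bool -> M) (s : seq bool).
Hypothesis delD : {morph del : x y / x + y}.
Local Notation face := (face del).

Lemma eq_face i c c' s :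
  (forall x, size x = (size s).+1 -> c x = c' x) -> face i c s = face i c' s.
Proof.
move=> cc; case: i => [|i]; last by rewrite /= cc // size_skip_bit.
rewrite /= /nochain (cc (true :: s)) //; congr (_ + _).
by apply: eq_alt_sum => x sx; apply: cc.
Qed.

Lemma eq_degen i c c' s : (i < size s)%N ->
  (forall x, (size x).+1 = size s -> c x = c' x) -> degen i c s = degen i c' s.
Proof.
case: i => [|i] si cc /=; last exact: eq_merge_bits.
by case: s si cc => [|[] s] // _ cc; apply: cc.
Qed.

Section Graded.
Context (P : nat -> M -> Prop).
Hypothesis P0 : forall m, P m 0.
Hypothesis PB : forall m x y, P m x -> P m y -> P m (x - y).

Lemma alt_sum_graded c s m d : (forall x, P (d + count id x) (c x)) ->
  count id s = m.+1 -> P (d + m) (alt_sum c s).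
Proof.
elim: s c m d => [|[] s IH] c m d Pc //= => [[sm]|sm]; last first.
  by apply: IH => // x; exact: (Pc (false :: x)).
apply: PB; first by rewrite -sm; exact: (Pc (false :: s)).
(* For m = 0 the rest of the subset is empty, and so is the alternating sum over it. *)
case: m sm => [|m] sm.
  suff -> : forall c', alt_sum c' s = 0 by [].
  elim: s sm {IH} => [|[] s IH] //= s0 c'; exact: IH.
rewrite addnS -addSn; apply: IH => // x.
by have := Pc (true :: x); rewrite /= addnA addn1.
Qed.

Hypothesis Pdel : forall m x, P m.+1 x -> P m (del x).

Lemma face_graded i c s : (forall x, P (count id x) (c x)) ->
  P (count id s) (face i c s).
Proof.
move=> Pc; case: i => [|i] /=; last by rewrite -(count_skip_bit i).
rewrite /nochain -[alt_sum _ _]opprK.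
apply: PB; first by apply: Pdel; exact: (Pc (true :: s)).
rewrite -[- _]add0r; apply: PB => //.
exact: (@alt_sum_graded c (true :: s) (count id s) 0).
Qed.

Lemma degen_graded i c s : (forall x, P (count id x) (c x)) ->
  P (count id s) (degen i c s).
Proof.
have merge d n c' x : (forall y, P (d + count id y) (c' y)) ->
    P (d + count id x) (merge_bits n c' x).
  elim: n x c' d => [|n IH] [|a x] c' d Pc //=.
    case: x => [|b x] //; case: ifP => // /negbT ab.
    have -> : (d + count id [:: a, b & x] = d + count id ((a || b) :: x))%N.
      by case: a b ab => [] [] //=; rewrite ?add0n.
    exact: Pc.
  rewrite /= addnA; apply: IH => y.
  by have := Pc (a :: y); rewrite /= addnA.
move=> Pc; case: i => [|i] /=; last exact: (merge 0).
by case: s => [|[] s] //=; rewrite add0n.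
Qed.
End Graded.

Lemma skip_bit_false i s : false \in skip_bit i s.
Proof.
elim: i s => [|i IH] [|b s]; rewrite /= ?inE ?eqxx //.
by rewrite IH orbT.
Qed.

(** A proper subset of {1, ..., j} is in the image of a positive coface, so the positive faces
    together see every component except the top one. *)
Lemma false_skip_bit s : false \in s ->
  exists i s', [/\ (i <= size s')%N, size s = (size s').+1 & s = skip_bit i s'].
Proof.
elim: s => // -[] s IH /=; rewrite inE /= => sf; last by exists 0%N, s.
have [i [s' [is' ss se]]] := IH sf.
by exists i.+1, (true :: s'); split; rewrite //= ?ss // -se.
Qed.

Lemma nseq_true s : false \notin s -> s = nseq (size s) true.
Proof. by elim: s => // -[] s IH; rewrite inE //= => /IH {1}->. Qed.

Lemma count_nseq_true m : count id (nseq m true) = m.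
Proof. by rewrite count_nseq mul1n. Qed.

Lemma alt_sum_top c s : (forall x, false \in x -> c x = 0) -> alt_sum c s = 0.
Proof.
elim: s c => [|b s IH] c c0 //=; have {}IH : alt_sum (fun x => c (b :: x)) s = 0.
  by apply: IH => x fx; apply: c0; rewrite inE fx orbT.
by case: b IH => //= ->; rewrite c0 ?inE // subr0.
Qed.

(** Removing an element from a subset leaves a proper one, where c vanishes. This is how d_0 turns
    into the differential on the normalized part. *)
Lemma face0_top c s : (forall x, false \in x -> c x = 0) ->
  face 0 c s = del (c (true :: s)).
Proof. by move=> c0; rewrite /= /nochain alt_sum_top // addr0. Qed.

Lemma degen_top i c m : (i < m)%N -> degen i c (nseq m true) = 0.
Proof.
have merge n m' c' : merge_bits n c' (nseq m' true) = 0.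
  by elim: n m' c' => [|n IH] [|m'] c' //=; case: m'.
by case: i => [|i] /=; [case: m | rewrite merge].
Qed.
End SubsetOperatorsExtra.

Section Naturality.
Context (M N : zmodType) (delM : M -> M) (delN : N -> N) (g : M -> N).
Hypothesis gB : {morph g : x y / x - y}.
Hypothesis g_del : forall x, g (delM x) = delN (g x).

Let g0 : g 0 = 0. Proof. by rewrite -(subrr 0) gB subrr. Qed.
Let gD : {morph g : x y / x + y}.
Proof. by move=> x y; rewrite -[y in LHS]opprK gB -[- y]sub0r gB g0 sub0r opprK. Qed.

Lemma alt_sum_nat c s : alt_sum (fun x => g (c x)) s = g (alt_sum c s).
Proof.
elim: s c => [|[] s IH] c /=; first by rewrite g0.
  by rewrite gB (IH (fun x => c (true :: x))).
exact: (IH (fun x => c (false :: x))).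
Qed.

Lemma face_nat i c s : face delN i (fun x => g (c x)) s = g (face delM i c s).
Proof.
by case: i => [|i] //=; rewrite /nochain gD g_del (alt_sum_nat c (true :: s)).
Qed.

Lemma degen_nat i c s : degen i (fun x => g (c x)) s = g (degen i c s).
Proof.
have merge n x c' : merge_bits n (fun y => g (c' y)) x = g (merge_bits n c' x).
  elim: n x c' => [|n IH] [|a x] c'; rewrite /= ?g0 //.
  by case: x => [|b x]; rewrite ?g0 //; case: ifP; rewrite ?g0.
by case: i => [|i]; [case: s => [|[] s]; rewrite /= ?g0 | exact: merge].
Qed.
End Naturality.

(** * The morphism from A to End_B(P)^op *)

(** The recursion is that of Pascal's triangle, so the position of a subset in this list ranges over
    exactly the ordinals that index the copies of P_i at j. *)
Fixpoint bit_seqs (j i : nat) : seq (seq bool) :=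
  if j is j'.+1 then
    map (cons false) (bit_seqs j' i)
      ++ (if i is i'.+1 then map (cons true) (bit_seqs j' i') else [::])
  else if i is 0 then [:: [::]] else [::].

Lemma size_bit_seqs j i : size (bit_seqs j i) = 'C(j, i).
Proof.
elim: j i => [|j IH] [|i] //=; rewrite size_cat ?size_map IH ?bin0 //.
by rewrite IH binS.
Qed.

Lemma mem_bit_seqs j i s : (s \in bit_seqs j i) = (size s == j) && (count id s == i).
Proof.
elim: j i s => [|j IH] [|i] [|b s] //=; rewrite ?mem_cat ?inE //=.
- by apply/negbTE/negP => /orP[/mapP[]|].
- rewrite orbF eqSS; case: b; rewrite /= ?add0n.
    by rewrite andbF; apply/negbTE/mapP => -[].
  by rewrite mem_map ?IH // => x y [].
- by apply/negbTE/negP => /orP[] /mapP[].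
- rewrite eqSS; case: b; rewrite /= ?add0n ?add1n ?eqSS.
    rewrite (mem_map (f := cons true)) ?IH => [|x y [] //].
    by case: mapP => // -[].
  rewrite (mem_map (f := cons false)) ?IH => [|x y [] //].
  by rewrite orbC; case: mapP => // -[].
Qed.

Lemma uniq_bit_seqs j i : uniq (bit_seqs j i).
Proof.
have cons_inj (b : bool) : injective (cons b) by move=> x y [].
elim: j i => [|j IH] [|i] //=; rewrite cat_uniq !map_inj_uniq // !IH //= andbT.
by apply/hasPn => x /mapP[y _ ->]; apply/mapP => -[].
Qed.

Lemma pascalE n (i j : 'I_n) : pascal n i j = 'C(j, i).
Proof. by rewrite mxE. Qed.

Section SummandBits.
Context (n : nat).
Local Notation idx := {j : 'I_n & summands j}.
Implicit Types s t : idx.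

Definition bits s : seq bool :=
  nth [::] (bit_seqs (tag s) (tag (tagged s))) (tagged (tagged s)).

Lemma bits_in s : bits s \in bit_seqs (tag s) (tag (tagged s)).
Proof.
case: s => j [i r]; apply: mem_nth.
by rewrite size_bit_seqs -pascalE; exact: (ltn_ord r).
Qed.

Lemma size_bits s : size (bits s) = tag s.
Proof. by have := bits_in s; rewrite mem_bit_seqs => /andP[/eqP]. Qed.

Lemma count_bits s : count id (bits s) = tag (tagged s).
Proof. by have := bits_in s; rewrite mem_bit_seqs => /andP[_ /eqP]. Qed.

Lemma bits_inj : injective bits.
Proof.
move=> s t st; have := size_bits s; have := count_bits s; rewrite st count_bits size_bits.
move: s t st => [j [i r]] [j' [i' r']] /= st /val_inj ei /val_inj ej.
subst i' j'; do 2!f_equal; apply: val_inj => /=; apply/eqP.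
rewrite -(nth_uniq [::] _ _ (uniq_bit_seqs j i)); first exact/eqP.
  by rewrite size_bit_seqs -pascalE; exact: (ltn_ord r).
by rewrite size_bit_seqs -pascalE; exact: (ltn_ord r').
Qed.

Lemma bits_surj x : (size x < n)%N -> exists s, bits s = x.
Proof.
move=> xn; have cn : (count id x < n)%N := leq_ltn_trans (count_size _ _) xn.
have xin : x \in bit_seqs (Ordinal xn) (Ordinal cn) by rewrite mem_bit_seqs !eqxx.
have ri : (index x (bit_seqs (Ordinal xn) (Ordinal cn)) <
    pascal n (Ordinal cn) (Ordinal xn))%N.
  by rewrite pascalE -size_bit_seqs index_mem.
pose r : summands (Ordinal xn) := Tagged (fun i => 'I_(pascal n i _)) (Ordinal ri).
exists (Tagged (fun j => summands j) r).
by rewrite /bits /= nth_index.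
Qed.

(** The value is [None] exactly on the lists of length at least n. *)
Definition idx_of x : option idx := [pick s | bits s == x].

Lemma bitsK s : idx_of (bits s) = Some s.
Proof. by rewrite /idx_of; case: pickP => [t /eqP/bits_inj->|/(_ s)]; rewrite ?eqxx. Qed.

Lemma idx_ofP x : (size x < n)%N -> exists2 s, idx_of x = Some s & bits s = x.
Proof. by move=> /bits_surj[s <-]; exists s; rewrite ?bitsK. Qed.

Lemma idx_of_size x s : idx_of x = Some s -> bits s = x.
Proof. by rewrite /idx_of; case: pickP => // t /eqP <- [->]. Qed.
End SummandBits.

(** * The differential and the grading inside the chain algebra *)

Section ChainAlgebra.
Context (k : idomainType) (n : nat).
Local Notation B := (chain_alg k n).
Local Notation idB := (idem (@chain_rel k n)).

Fact eqb_of_eq (i j : nat) : i = j -> i == j.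
Proof. by move/eqP. Qed.

(** Extended by 0 to all pairs of vertices, so that one element, the unrestricted sum
    [differential], acts as the differential in every degree. *)
Definition dB (u v : 'I_n) : B :=
  if @eqP nat u v.+1 is ReflectT uv then
    arrow_class (@chain_rel k n) (D (eqb_of_eq uv) : @arrow (chain_quiver n) u v) else 0.

Lemma dBE (u v : 'I_n) (uv : u == v.+1 :> nat) :
  dB u v = arrow_class (@chain_rel k n) (D uv : @arrow (chain_quiver n) u v).
Proof.
rewrite /dB; case: eqP => [e|/eqP]; last by rewrite uv.
by rewrite (bool_irrelevance (eqb_of_eq e) uv).
Qed.

Lemma dB0 (u v : 'I_n) : u != v.+1 :> nat -> dB u v = 0.
Proof. by rewrite /dB; case: eqP. Qed.

Lemma idB_dB u v w : idB w * dB u v = if w == v then dB u v else 0.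
Proof.
rewrite /dB; case: eqP => [uv|_]; last by rewrite mulr0; case: ifP.
case: eqP => [->|/eqP nw]; first exact: idem_path.
exact: (path_class_orth (Q := chain_quiver n)).
Qed.

Lemma dB_idB u v w : dB u v * idB w = if w == u then dB u v else 0.
Proof.
rewrite /dB; case: eqP => [uv|_]; last by rewrite mul0r; case: ifP.
case: eqP => [->|/eqP nw]; first exact: path_idem.
by apply: (path_class_orth (Q := chain_quiver n)); rewrite eq_sym.
Qed.

Lemma dB_dB u v w v' : dB v w * dB u v' = 0.
Proof.
have [->|nv] := eqVneq v' v; last first.
  have := dB_idB v w v; rewrite eqxx => <-.
  by rewrite -mulrA idB_dB eq_sym (negPf nv) mulr0.
rewrite /dB; case: eqP => [vw|_]; last by rewrite mul0r.
case: eqP => [uv|_]; last by rewrite mulr0.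
rewrite [LHS](path_class_comp (Q := chain_quiver n)).
have := lincomb_class (Rel_d_d k
  (D (eqb_of_eq vw) : @arrow (chain_quiver n) v w)
  (D (eqb_of_eq uv) : @arrow (chain_quiver n) u v)).
by rewrite big_seq1 kscalar1 mul1r.
Qed.

Definition differential : B := \sum_u \sum_v dB u v.

Lemma differential_sq : differential * differential = 0.
Proof.
rewrite mulr_suml big1 // => v _; rewrite mulr_suml big1 // => w _.
rewrite mulr_sumr big1 // => u _; rewrite mulr_sumr big1 // => v' _.
exact: dB_dB.
Qed.

(** Degrees are natural numbers here, with value 0 from n on, which lets the shift from m to m + 1
    be stated without a bound. *)
Definition degree_idem (m : nat) : B := \sum_(v : 'I_n | v == m :> nat) idB v.

Lemma degree_idemE (v : 'I_n) : degree_idem v = idB v.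
Proof. by rewrite /degree_idem (big_pred1 v). Qed.

Lemma differential_idem (u : 'I_n) : differential * idB u = \sum_v dB u v.
Proof.
rewrite mulr_suml (bigD1 u) //= [X in _ + X]big1 ?addr0 => [|w nw].
  by rewrite mulr_suml; apply: eq_bigr => v _; rewrite dB_idB eqxx.
by rewrite mulr_suml big1 // => v _; rewrite dB_idB eq_sym (negPf nw).
Qed.

Lemma degree_idem_differential m :
  degree_idem m * differential = differential * degree_idem m.+1.
Proof.
rewrite {2}/degree_idem [RHS]mulr_sumr; under [RHS]eq_bigr do rewrite differential_idem.
rewrite {1}/differential [LHS]mulr_sumr [RHS]big_mkcond; apply: eq_bigr => u _.
rewrite mulr_sumr.
transitivity (\sum_(v : 'I_n | v == m :> nat) dB u v).
  rewrite /degree_idem [RHS]big_mkcond; apply: eq_bigr => v _.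
  rewrite mulr_suml; under eq_bigr do rewrite idB_dB.
  rewrite -big_mkcondr big_mkcond /= (bigD1 v) //= eqxx andbT big1 ?addr0 // => w nw.
  by rewrite (negPf nw) andbF.
case: eqP => [um|um]; last first.
  by rewrite big1 // => v /eqP vm; apply: dB0; apply/eqP; rewrite vm.
rewrite big_mkcond; apply: eq_bigr => v _; case: eqP => // vm.
by rewrite dB0 // um eqSS eq_sym; apply/eqP.
Qed.

End ChainAlgebra.

Section ArrowOperators.
Context (k : idomainType) (n : nat).
Local Notation B := (chain_alg k n).
Local Notation Q := (simp_quiver n).

Definition del (M : lmodType B) (x : M) : M := differential k n *: x.

Lemma delD (M : lmodType B) : {morph @del M : x y / x + y}.
Proof. by move=> x y; rewrite /del scalerDr. Qed.

Lemma del_del (M : lmodType B) (x : M) : del (del x) = 0.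
Proof. by rewrite /del scalerA differential_sq scale0r. Qed.

Definition arrow_op (M : lmodType B) (u v : 'I_n) (a : simp_arrow u v)
    (c : seq bool -> M) (s : seq bool) : M :=
  match a with Pi i _ _ => face (@del M) i c s | Iota i _ _ => degen i c s end.

Lemma eq_arrow_op (M : lmodType B) (u v : 'I_n) (a : simp_arrow u v)
    (c c' : seq bool -> M) s :
  size s = v -> (forall x, size x = u -> c x = c' x) ->
  arrow_op a c s = arrow_op a c' s.
Proof.
case: a => i uv iu sv cc /=.
  by apply: eq_face => x sx; apply: cc; rewrite sx sv (eqP uv).
apply: eq_degen => [|x]; rewrite sv (eqP uv) //.
by case=> sx; exact: cc.
Qed.

Lemma arrow_op_nat (M N : lmodType B) (g : lin M N) (u v : 'I_n) (a : simp_arrow u v)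
    (c : seq bool -> M) s :
  arrow_op a (fun x => g (c x)) s = g (arrow_op a c s).
Proof.
case: a => i uv iu /=; last by apply: degen_nat; exact: raddfB.
by apply: face_nat => [|x]; [exact: raddfB | exact: linearZ].
Qed.

Definition graded (M : lmodType B) (m : nat) (x : M) : Prop := degree_idem k n m *: x = x.

Lemma arrow_op_graded (M : lmodType B) (u v : 'I_n) (a : simp_arrow u v)
    (c : seq bool -> M) s :
  (forall x, graded (count id x) (c x)) -> graded (count id s) (arrow_op a c s).
Proof.
have g0 m : @graded M m 0 by exact: scaler0.
have gB m (x y : M) : graded m x -> graded m y -> graded m (x - y).
  by rewrite /graded scalerBr => -> ->.
have gdel m (x : M) : graded m.+1 x -> graded m (del x).
  by rewrite /graded /del => {2}<-; rewrite !scalerA degree_idem_differential.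
by move=> gc; case: a => i uv iu /=; [exact: face_graded | exact: degen_graded].
Qed.
End ArrowOperators.

(** * The simplicial generators as endomorphisms of P *)

Section DoldKanAction.
Context (k : idomainType) (n : nat).
Local Notation B := (chain_alg k n).
Local Notation Q := (simp_quiver n).
Local Notation idx := {j : 'I_n & summands j}.
Local Notation P := (DK_module k n).
Local Notation E := (end_op P).

Definition summand_idem (s : idx) : B := idem (@chain_rel k n) (tag (tagged s)).
Local Notation e := summand_idem.

Lemma summand_idemM s : e s * e s = e s.
Proof. exact: idemM. Qed.

Definition dk_gen (s : idx) : P := gen e s.

Definition dk_extend (M : lmodType B) (c : idx -> M) : lin P M := extend e c.

Lemma dk_extend_gen (M : lmodType B) (c : idx -> M) s :
  dk_extend c (dk_gen s) = e s *: c s.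
Proof. exact: extend_gen. Qed.

Lemma dk_gen_eq (M : lmodType B) (h h' : lin P M) :
  (forall s, h (dk_gen s) = h' (dk_gen s)) -> h = h'.
Proof. exact: (lin_gen_eq summand_idemM). Qed.

Lemma dk_gen_e (M : lmodType B) (h : lin P M) s : e s *: h (dk_gen s) = h (dk_gen s).
Proof. exact: (lin_gen_e summand_idemM). Qed.

(** The universal cochain: a morphism h out of P amounts to the cochain x -> h ([bit_gen] x). Lists
    that are too long receive 0. *)
Definition bit_gen (x : seq bool) : P := if idx_of n x is Some s then dk_gen s else 0.

Lemma bit_genK s : bit_gen (bits s) = dk_gen s.
Proof. by rewrite /bit_gen bitsK. Qed.

Lemma bit_gen_graded x : graded (count id x) (bit_gen x).
Proof.
rewrite /graded /bit_gen; case xs: idx_of => [s|]; last by rewrite scaler0.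
rewrite -(idx_of_size xs) count_bits degree_idemE.
exact: (dk_gen_e (lin_id P)).
Qed.

Lemma bit_gen_eq (M : lmodType B) (h h' : lin P M) :
  (forall x, (size x < n)%N -> h (bit_gen x) = h' (bit_gen x)) -> h = h'.
Proof. by move=> hh; apply: dk_gen_eq => s; rewrite -bit_genK hh // size_bits. Qed.

Definition vertex_proj (v : 'I_n) : E :=
  dk_extend (fun s => if tag s == v then dk_gen s else 0).

Lemma vertex_projE v (p : P) : vertex_proj v p = fun s => if tag s == v then p s else 0.
Proof.
apply: coord_inj => s.
have -> : vertex_proj v p =
    \sum_t coord p t *: (if tag t == v then gen e t else 0) by [].
rewrite coord_sum (bigD1 s) //= big1 ?addr0 => [|t ts]; rewrite coordZ.
  rewrite /coord; case: eqP => _; last by rewrite mulr0.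
  by rewrite -/(coord (gen e s) s) coord_gen eqxx (coord_er summand_idemM p s).
by case: eqP => _; rewrite ?mulr0 // coord_gen eq_sym (negPf ts) mulr0.
Qed.

Lemma vertex_proj_gen v x : vertex_proj v (bit_gen x) = if size x == v then bit_gen x else 0.
Proof.
rewrite /bit_gen; case xs: idx_of => [s|]; last by rewrite raddf0; case: ifP.
rewrite [LHS]dk_extend_gen -(idx_of_size xs) size_bits.
have -> : (val (tag s) == v) = (tag s == v) by [].
case: ifP => _; last by rewrite scaler0.
exact: (dk_gen_e (lin_id P)).
Qed.

(** The operator applied to the universal cochain. The factor [e s] hidden in [dk_extend] changes
    nothing, because the operators preserve the condition that the value at S has degree |S|. *)
Definition arrow_map (u v : 'I_n) (a : simp_arrow u v) : E :=
  dk_extend (fun s => if tag s == v then arrow_op a bit_gen (bits s) else 0).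

(** By naturality of the operators in the coefficients, precomposition with the endomorphism is the
    operator on cochains with values in any M. *)
Lemma arrow_map_gen (M : lmodType B) (h : lin P M) u v (a : simp_arrow u v) x :
  (size x < n)%N ->
  h (arrow_map a (bit_gen x)) =
    if size x == v then arrow_op a (fun y => h (bit_gen y)) x else 0.
Proof.
move=> /idx_ofP[s _ <-]; rewrite bit_genK [arrow_map _ _]dk_extend_gen size_bits.
have -> : (val (tag s) == v) = (tag s == v) by [].
case: ifP => _; last by rewrite scaler0 raddf0.
rewrite [RHS]arrow_op_nat /summand_idem -degree_idemE -count_bits.
congr (h _); apply: arrow_op_graded => y; exact: bit_gen_graded.
Qed.

Lemma arrow_map_bit u v (a : simp_arrow u v) x : (size x < n)%N ->
  arrow_map a (bit_gen x) = if size x == v then arrow_op a bit_gen x else 0.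
Proof. exact: (arrow_map_gen (lin_id P)). Qed.

(** In the opposite algebra the factor b reaches the generator first, but its operator is then
    evaluated on the cochain of a; words in the arrows thus become words in the operators without
    reversal. *)
Lemma arrow_map2 u v w (a : simp_arrow u v) (b : simp_arrow v w) x : (size x < n)%N ->
  (arrow_map b * arrow_map a : E) (bit_gen x) =
    if size x == w then arrow_op b (arrow_op a bit_gen) x else 0.
Proof.
move=> xn; rewrite -[LHS]/(arrow_map a (arrow_map b (bit_gen x))) arrow_map_gen //.
case: eqP => // sx; apply: eq_arrow_op => // y sy.
have yn : (size y < n)%N by rewrite sy.
by rewrite arrow_map_bit // sy eqxx.
Qed.

Lemma vertex_projM u v : vertex_proj u * vertex_proj v = if u == v then vertex_proj u else 0.
Proof.
apply: bit_gen_eq => x xn; rewrite -[LHS]/(vertex_proj v (vertex_proj u _)) vertex_proj_gen.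
case: eqP => [xu|xu].
  rewrite vertex_proj_gen xu -[(u == v :> nat)]/(u == v).
  by case: (u == v); rewrite // vertex_proj_gen xu eqxx.
by rewrite raddf0; case: (u == v); rewrite // vertex_proj_gen; move/eqP/negPf: xu => ->.
Qed.

Lemma vertex_proj_sum : \sum_v vertex_proj v = 1.
Proof.
apply: bit_gen_eq => x xn.
rewrite (big_morph (fun f : E => f (bit_gen x)) (fun f g => erefl) erefl).
rewrite (bigD1 (Ordinal xn)) //= vertex_proj_gen eqxx big1 ?addr0 // => v nv.
by rewrite vertex_proj_gen; case: eqP => // xv; case/eqP: nv; apply: val_inj.
Qed.

Lemma proj_arrow u v (a : simp_arrow u v) : vertex_proj v * arrow_map a = arrow_map a.
Proof.
apply: bit_gen_eq => x xn; rewrite -[LHS]/(arrow_map a (vertex_proj v _)) vertex_proj_gen.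
case: ifP => // xv; rewrite raddf0.
by rewrite arrow_map_bit // xv.
Qed.

Lemma arrow_proj u v (a : simp_arrow u v) : arrow_map a * vertex_proj u = arrow_map a.
Proof.
apply: bit_gen_eq => x xn; rewrite -[LHS]/(vertex_proj u (arrow_map a _)).
rewrite arrow_map_gen // arrow_map_bit //; case: eqP => // sx.
by apply: eq_arrow_op => // y sy; rewrite vertex_proj_gen sy eqxx.
Qed.

Lemma dk_action_exists : exists phi : alghom (simp_alg k n) E,
  (forall v, phi (idem (@simp_rel k n) v) = vertex_proj v) /\
  (forall u v (a : @arrow Q u v), phi (arrow_class (@simp_rel k n) a) = arrow_map a).
Proof.
apply: (@bound_alg_lift k Q (@simp_rel k n) E vertex_proj arrow_map).
- exact: vertex_projM.
- exact: proj_arrow.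
- exact: arrow_proj.
- move=> u v r Rr.
  (* Every relation except the one with a trivial path equates two words of length two, which
     reduces it to an identity of operators on lists of length v. *)
  have rel2 (w w' : Q) (b : @arrow Q w v) (a : @arrow Q u w) (b' : @arrow Q w' v)
      (a' : @arrow Q u w') :
    (forall x, size x = v ->
      arrow_op b (arrow_op a bit_gen) x = arrow_op b' (arrow_op a' bit_gen) x) ->
    \sum_(t <- rel_eq k (arrow2 b a) (arrow2 b' a'))
      kscalar t.1 * @path_val k Q E vertex_proj arrow_map u v t.2 = 0.
    move=> ba; rewrite big_cons big_seq1 /= kscalar1 kscalarN1 mul1r mulN1r !arrow_proj.
    apply/eqP; rewrite subr_eq0; apply/eqP; apply: bit_gen_eq => x xn.
    by rewrite !arrow_map2 //; case: eqP => // /ba.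
  case: u v r / Rr rel2.
  + move=> u v w i j uv vw iu jv ju iv ji; apply => x xw /=.
    by apply: (face_face (@delD k n P) (@del_del k n P)) ji _; rewrite xw -(eqP vw) -(eqP uv).
  + move=> u v w i j uv wu iu jv ju iw ji; apply => x xw /=.
    by apply: (face_degen_lt (@delD k n P)) ji _; rewrite xw.
  + move=> u v i j uv iu jv ij _; rewrite big_cons big_seq1 /= kscalar1 kscalarN1.
    rewrite mul1r mulN1r !arrow_proj; apply/eqP; rewrite subr_eq0; apply/eqP.
    apply: bit_gen_eq => x xn; rewrite arrow_map2 // vertex_proj_gen.
    case: eqP => // xu; apply: (face_degen_id (@delD k n P)) ij _; by rewrite xu.
  + move=> u v w i j uv wu iu jv ju iw ij; apply => x xw /=.
    apply: face_degen_gt ij _ _; rewrite xw -?(eqP uv) //.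
    by rewrite (eqP wu).
  + move=> u v w i j uv vw iu jv ju iv ij; apply => x xw /=.
    apply: (degen_degen) ij _.
    by rewrite xw (eqP vw).
- exact: vertex_proj_sum.
Qed.
End DoldKanAction.

(** * The normalization idempotents *)

Lemma rel_eq_class (k : idomainType) (Q : quiver) (R : relations k Q) (u v : Q)
    (p q : qpath u v) : R u v (rel_eq k p q) -> path_class R p = path_class R q.
Proof.
move=> /lincomb_class; rewrite big_cons big_seq1 /= kscalar1 kscalarN1 mul1r mulN1r.
by move=> /eqP; rewrite subr_eq0 => /eqP.
Qed.

Section SimplicialAlgebra.
Context (k : idomainType) (n : nat).
Local Notation A := (simp_alg k n).
Local Notation Q := (simp_quiver n).
Local Notation R := (@simp_rel k n).

(** Generators are indexed by natural numbers and vanish out of range: [face_elt m i] is d_i from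
    degree m + 1 to m, and [degen_elt m i] is s_i from degree m to m + 1. *)
Definition vertex_elt (m : nat) : A :=
  if @eqP bool (m < n)%N true is ReflectT mn then idem R (Ordinal mn : Q) else 0.

Definition face_elt (m i : nat) : A :=
  if @eqP bool (m.+1 < n)%N true is ReflectT mn then
    if @eqP bool (i <= m.+1)%N true is ReflectT im then
      arrow_class R (@Pi n (Ordinal mn) (Ordinal (ltnW mn)) i (eqb_of_eq (erefl m.+1)) im
        : @arrow Q (Ordinal mn) (Ordinal (ltnW mn))) else 0
  else 0.

Definition degen_elt (m i : nat) : A :=
  if @eqP bool (m.+1 < n)%N true is ReflectT mn then
    if @eqP bool (i <= m)%N true is ReflectT im then
      arrow_class R (@Iota n (Ordinal (ltnW mn)) (Ordinal mn) i (eqb_of_eq (erefl m.+1)) im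
        : @arrow Q (Ordinal (ltnW mn)) (Ordinal mn)) else 0
  else 0.

Lemma vertex_eltE (v : 'I_n) : vertex_elt v = idem R v.
Proof.
rewrite /vertex_elt; case: eqP => [mn|]; last by rewrite ltn_ord.
by congr idem; apply: val_inj.
Qed.

Lemma face_eltE (u v : 'I_n) i (uv : u == v.+1 :> nat) (iu : (i <= u)%N) :
  face_elt v i = arrow_class R (Pi i uv iu : @arrow Q u v).
Proof.
case: u v uv iu => [u un] [v vn] /= uv; have eu := eqP uv; subst u => iu.
rewrite /face_elt; case: eqP => [mn|]; last by rewrite un.
case: eqP => [im|]; last by rewrite iu.
rewrite (bool_irrelevance im iu) (bool_irrelevance un mn).
by rewrite (bool_irrelevance vn (ltnW mn)) (bool_irrelevance uv (eqb_of_eq (erefl v.+1))).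
Qed.

Lemma degen_eltE (u v : 'I_n) i (uv : v == u.+1 :> nat) (iu : (i <= u)%N) :
  degen_elt u i = arrow_class R (Iota i uv iu : @arrow Q u v).
Proof.
case: u v uv iu => [u un] [v vn] /= uv iu; have ev := eqP uv; subst v.
rewrite /degen_elt; case: eqP => [mn|]; last by rewrite vn.
case: eqP => [im|]; last by rewrite iu.
rewrite (bool_irrelevance im iu) (bool_irrelevance vn mn).
by rewrite (bool_irrelevance un (ltnW mn)) (bool_irrelevance uv (eqb_of_eq (erefl u.+1))).
Qed.

Lemma arrow_class2 (u v w : Q) (b : arrow v w) (a : arrow u v) :
  arrow_class R b * arrow_class R a = path_class R (arrow2 b a).
Proof. exact: path_class_comp. Qed.

Lemma vertex_eltM m : vertex_elt m * vertex_elt m = vertex_elt m.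
Proof. by rewrite /vertex_elt; case: eqP => [mn|]; rewrite ?mulr0 // idemM. Qed.

Lemma vertex_elt_orth m l : m != l -> vertex_elt m * vertex_elt l = 0.
Proof.
rewrite /vertex_elt; case: eqP => [mn|]; rewrite ?mul0r //.
case: eqP => [ln|]; rewrite ?mulr0 // => ml.
by rewrite idem_mul -[_ == _]/(m == l) (negPf ml).
Qed.

Lemma vertex_face m i : vertex_elt m * face_elt m i = face_elt m i.
Proof.
rewrite /face_elt; case: eqP => [mn|]; rewrite ?mulr0 //.
case: eqP => [im|]; rewrite ?mulr0 //.
by rewrite -[vertex_elt _]/(vertex_elt (Ordinal (ltnW mn) : 'I_n)) vertex_eltE [LHS]idem_path.
Qed.

Lemma face_vertex m i : face_elt m i * vertex_elt m.+1 = face_elt m i.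
Proof.
rewrite /face_elt; case: eqP => [mn|]; rewrite ?mul0r //.
case: eqP => [im|]; rewrite ?mul0r //.
by rewrite -[vertex_elt _]/(vertex_elt (Ordinal mn : 'I_n)) vertex_eltE [LHS]path_idem.
Qed.

Lemma vertex_degen m i : vertex_elt m.+1 * degen_elt m i = degen_elt m i.
Proof.
rewrite /degen_elt; case: eqP => [mn|]; rewrite ?mulr0 //.
case: eqP => [im|]; rewrite ?mulr0 //.
by rewrite -[vertex_elt _]/(vertex_elt (Ordinal mn : 'I_n)) vertex_eltE [LHS]idem_path.
Qed.

Lemma degen_vertex m i : degen_elt m i * vertex_elt m = degen_elt m i.
Proof.
rewrite /degen_elt; case: eqP => [mn|]; rewrite ?mul0r //.
case: eqP => [im|]; rewrite ?mul0r //.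
by rewrite -[vertex_elt _]/(vertex_elt (Ordinal (ltnW mn) : 'I_n)) vertex_eltE [LHS]path_idem.
Qed.

Section Relations.
Context (m : nat) (mn : (m.+2 < n)%N).
Let w : 'I_n := Ordinal (ltnW (ltnW mn)).
Let v : 'I_n := Ordinal (ltnW mn).
Let u : 'I_n := Ordinal mn.
Let vw : v == w.+1 :> nat. Proof. exact: eqxx. Qed.
Let uv : u == v.+1 :> nat. Proof. exact: eqxx. Qed.

Lemma face_face_elt i j : (j < i)%N -> (i <= m.+2)%N ->
  face_elt m j * face_elt m.+1 i = face_elt m i.-1 * face_elt m.+1 j.
Proof.
case: i => // i ji im.
have jv : (j <= v)%N by exact: leq_trans ji im.
have ju : (j <= u)%N by exact: leqW jv.
have iv : (i <= v)%N by exact: im.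
rewrite (face_eltE vw jv) (face_eltE uv (im : (i.+1 <= u)%N)) (face_eltE vw iv) (face_eltE uv ju).
rewrite !arrow_class2; apply: rel_eq_class.
exact: Rel_pi_pi ji.
Qed.

Lemma face_degen_elt_gt i j : (i.+1 < j)%N -> (j <= m.+2)%N ->
  face_elt m.+1 j * degen_elt m.+1 i = degen_elt m i * face_elt m j.-1.
Proof.
case: j => // j ij jm.
have jv : (j <= v)%N by exact: jm.
have iv : (i <= v)%N by apply: leq_trans (ltnW ij) jm.
have iw : (i <= w)%N by have := leq_trans ij jm; rewrite ltnS.
rewrite (face_eltE uv (jm : (j.+1 <= u)%N)) (degen_eltE uv iv) (degen_eltE vw iw).
rewrite (face_eltE vw jv) !arrow_class2; apply: rel_eq_class.
exact: Rel_pi_iota_gt ij.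
Qed.

Lemma degen_degen_elt i j : (i < j)%N -> (j <= m.+1)%N ->
  degen_elt m.+1 j * degen_elt m i = degen_elt m.+1 i * degen_elt m j.-1.
Proof.
case: j => // j ij jm.
have jv : (j.+1 <= v)%N by exact: jm.
have iv : (i <= v)%N by apply: leq_trans (ltnW ij) jm.
have iw : (i <= w)%N by apply: leq_trans ij jm.
have jw : (j <= w)%N by exact: jm.
rewrite (degen_eltE uv jv) (degen_eltE vw iw) (degen_eltE uv iv) (degen_eltE vw jw).
rewrite !arrow_class2; apply: rel_eq_class.
exact: Rel_iota_iota ij.
Qed.

Lemma face_degen_elt_lt i j : (j < i)%N -> (i <= m.+1)%N ->
  face_elt m.+1 j * degen_elt m.+1 i = degen_elt m i.-1 * face_elt m j.
Proof.
case: i => // i ji im.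
have iv : (i.+1 <= v)%N by exact: im.
have jv : (j <= v)%N by apply: leq_trans (ltnW ji) im.
have ju : (j <= u)%N by exact: leqW jv.
have iw : (i <= w)%N by exact: im.
rewrite (face_eltE uv ju) (degen_eltE uv iv) (degen_eltE vw iw) (face_eltE vw jv).
rewrite !arrow_class2; apply: rel_eq_class.
exact: Rel_pi_iota_lt ji.
Qed.
End Relations.

Lemma face_degen_elt_id m i j : (m.+1 < n)%N -> (j == i) || (j == i.+1) -> (i <= m)%N ->
  face_elt m j * degen_elt m i = vertex_elt m.
Proof.
move=> mn ij im; pose v : 'I_n := Ordinal (ltnW mn); pose u : 'I_n := Ordinal mn.
have uv : u == v.+1 :> nat by exact: eqxx.
have iv : (i <= v)%N by exact: im.
have ju : (j <= u)%N by case/orP: ij => /eqP-> //; exact: leqW.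
rewrite (face_eltE uv ju) (degen_eltE uv iv) -[vertex_elt _]/(vertex_elt v) vertex_eltE.
rewrite arrow_class2; apply: rel_eq_class.
exact: Rel_pi_iota_id ij.
Qed.
End SimplicialAlgebra.

Section NormalizationIdempotent.
Context (k : idomainType) (n : nat).
Local Notation A := (simp_alg k n).
Local Notation Q := (simp_quiver n).
Local Notation R := (@simp_rel k n).
Local Notation V := (vertex_elt k n).
Local Notation d := (face_elt k n).
Local Notation s := (degen_elt k n).

Fixpoint partial_norm (m j : nat) : A :=
  if j is j'.+1 then partial_norm m j' * (1 - s m j' * d m j) else V m.+1.

Section PartialNorm.
Context (m : nat) (mn : (m.+1 < n)%N).
Local Notation T := (partial_norm m).

(** For j + 1 < i, d_i s_j d_(j+1) = s_j d_(i-1) d_(j+1) = s_j d_(j+1) d_i, so d_i moves to the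
    right past each of the factors present. *)
Lemma face_partial_norm_gt i j : (j < i)%N -> (i <= m.+1)%N ->
  exists y, d m i * T j = y * d m i.
Proof.
elim: j => [|j IH] ji im; first by exists 1; rewrite mul1r face_vertex.
have [y yE] := IH (ltnW ji) im.
case: m mn i ji im y yE {IH} => [|m'] mn' i ji im y yE.
  by case: i ji im {yE} => [|[]].
exists (y * (1 - s m' j * d m' j.+1)).
rewrite /= mulrA yE -!mulrA mulrBr mulr1 mulrBl mul1r mulrA.
rewrite (face_degen_elt_gt k mn' ji im) -(mulrA (s m' j)) -(mulrA (s m' j)).
by rewrite (face_face_elt k mn' ji im).
Qed.

(** Once d_i has passed the factors before it, it meets 1 - s_(i-1) d_i, and d_i s_(i-1) is the
    identity. *)
Lemma face_partial_norm i j : (0 < i)%N -> (i <= j)%N -> (j <= m.+1)%N -> d m i * T j = 0.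
Proof.
elim: j => [|j IH] i0; first by rewrite leqn0 => /eqP ei; rewrite ei in i0.
rewrite leq_eqVlt => /orP[/eqP->|ij] jm; last first.
  by rewrite /= mulrA IH ?mul0r // ltnW.
have [y yE] := face_partial_norm_gt (ltnSn j) jm.
rewrite /= mulrA yE -mulrA mulrBr mulr1 mulrA face_degen_elt_id ?eqxx ?orbT //.
by rewrite vertex_face subrr mulr0.
Qed.

(** The last factor kills s_(j-1). For smaller i, (1 - s_(j-1) d_j) s_i = s_i (1 - s_(j-2) d_(j-1)),
    so s_i moves left to the shorter product. *)
Lemma partial_norm_degen i j : (i < j)%N -> (j <= m.+1)%N -> T j * s m i = 0.
Proof.
elim: j i => // j IH i; rewrite ltnS leq_eqVlt => /orP[/eqP->|ij] jm.
  rewrite /= -mulrA mulrBl mul1r -mulrA face_degen_elt_id ?eqxx ?orbT //.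
  by rewrite degen_vertex subrr mulr0.
rewrite /= -mulrA mulrBl mul1r -mulrA.
case: m mn IH jm => [|m'] mn' IH jm.
  by move: (leq_ltn_trans (leq0n i) ij) jm; case: j {IH ij}.
rewrite (face_degen_elt_gt k mn') // mulrA (degen_degen_elt k mn' ij) // -mulrA.
by rewrite mulrBr !mulrA IH ?(ltnW jm) // !mul0r subrr.
Qed.

Lemma partial_norm_left j : exists y : nat -> A, V m.+1 - T j = \sum_(i < j) s m i * y i.
Proof.
elim: j => [|j [y yE]]; first by exists (fun=> 0); rewrite big_ord0 subrr.
exists (fun i => if (i < j)%N then y i - y i * s m j * d m j.+1 else d m j.+1).
rewrite big_ord_recr /= ltnn.
under eq_bigr => i _ do rewrite ltn_ord mulrBr !mulrA.
rewrite sumrB -yE -!mulr_suml -yE (mulrBl _ (V _)) vertex_degen (mulrBl _ (s m j)).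
by rewrite opprB -[RHS]addrA subrK mulrBr mulr1 mulrA opprB addrA addrAC.
Qed.

Lemma partial_norm_right j : exists y : nat -> A, V m.+1 - T j = \sum_(i < j) y i * d m i.+1.
Proof.
elim: j => [|j [y yE]]; first by exists (fun=> 0); rewrite big_ord0 subrr.
exists (fun i => if (i < j)%N then y i else T j * s m j).
rewrite big_ord_recr /= ltnn.
under eq_bigr => i _ do rewrite ltn_ord.
by rewrite -yE mulrBr mulr1 mulrA opprB addrA addrAC.
Qed.
End PartialNorm.

Definition norm_idem (m : nat) : A := if m is m'.+1 then partial_norm m' m else V 0.
Local Notation eps := norm_idem.

Lemma vertex_norm m : V m * eps m = eps m.
Proof.
case: m => [|m]; first exact: vertex_eltM.
suff VT j : V m.+1 * partial_norm m j = partial_norm m j by exact: VT.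
by elim: j => [|j IH]; rewrite /= ?vertex_eltM // mulrA IH.
Qed.

Lemma face_norm m i : (m.+1 < n)%N -> (i <= m)%N -> d m i.+1 * eps m.+1 = 0.
Proof. by move=> mn im; exact: face_partial_norm. Qed.

Lemma norm_degen m i : (m.+1 < n)%N -> (i <= m)%N -> eps m.+1 * s m i = 0.
Proof. by move=> mn im; exact: partial_norm_degen. Qed.

Lemma norm_left m : exists y : nat -> A, V m.+1 - eps m.+1 = \sum_(i < m.+1) s m i * y i.
Proof. exact: partial_norm_left. Qed.

(** V - eps lies in the left ideal generated by the positive faces, so eps fixes whatever they kill;
    in particular it is idempotent. *)
Lemma norm_fix m x : V m.+1 * x = x -> (forall i, (i <= m)%N -> d m i.+1 * x = 0) ->
  eps m.+1 * x = x.
Proof.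
move=> Vx dx; have [y yE] := partial_norm_right m m.+1.
apply/esym/eqP; rewrite -subr_eq0 -[X in X - _]Vx -mulrBl yE mulr_suml big1 // => i _.
by rewrite -mulrA dx ?mulr0 // -ltnS.
Qed.

Lemma norm_vertex m : eps m * V m = eps m.
Proof.
case: m => [|m]; first exact: vertex_eltM.
have [z zE] := partial_norm_right m m.+1.
rewrite -[eps _](subKr (V m.+1)) zE mulrBl vertex_eltM mulr_suml; congr (_ - _).
by apply: eq_bigr => i _; rewrite -mulrA face_vertex.
Qed.

Lemma norm_idemM m : (m < n)%N -> eps m * eps m = eps m.
Proof.
case: m => [|m] mn; first exact: vertex_eltM.
by apply: norm_fix => [|i im]; [exact: vertex_norm | exact: face_norm].
Qed.

(** d_0 preserves the common kernel of the positive faces because d_i d_0 = d_0 d_(i+1). *)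
Lemma norm_face0 m : (m.+1 < n)%N ->
  eps m * (d m 0 * eps m.+1) = d m 0 * eps m.+1.
Proof.
case: m => [|m] mn; first by rewrite mulrA vertex_face.
apply: norm_fix => [|i im]; first by rewrite mulrA vertex_face.
rewrite mulrA -(face_face_elt k mn (ltn0Sn i.+1)) // -mulrA face_norm //.
by rewrite mulr0.
Qed.

Lemma face0_face0_norm m : (m.+2 < n)%N -> d m 0 * (d m.+1 0 * eps m.+2) = 0.
Proof.
move=> mn; rewrite mulrA -(face_face_elt k mn (ltn0Sn 0)) // -mulrA face_norm //.
by rewrite mulr0.
Qed.

Lemma norm_orth m l : m != l -> eps m * eps l = 0.
Proof.
move=> ml; rewrite -norm_vertex -(vertex_norm l) -mulrA (mulrA (V m)).
by rewrite vertex_elt_orth // mul0r mulr0.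
Qed.

(** By induction on the degree: V_(m+1) - eps_(m+1) is a sum of terms s_i y_i, and s_i = s_i V_m
    passes through degree m. *)
Lemma norm_ideal x : ideal_gen (fun y => exists v : 'I_n, y = eps v) x.
Proof.
have V_ideal m : (m < n)%N -> ideal_gen (fun y => exists v : 'I_n, y = eps v) (V m).
  elim: m => [|m IH] mn; first by apply: IG_gen; exists (Ordinal mn).
  have [y yE] := norm_left m; rewrite -[V _](subrK (eps m.+1)) yE.
  apply: IG_add; last by apply: IG_gen; exists (Ordinal mn).
  elim/big_ind: _ => [|a b Ia Ib|i _]; [exact: IG_0 | exact: IG_add |].
  by apply: IG_mulr; rewrite -degen_vertex; apply/IG_mull/IH/ltnW.
rewrite -[x]mulr1; apply: IG_mull; rewrite -sum_idem.
elim/big_ind: _ => [|a b Ia Ib|v _]; [exact: IG_0 | exact: IG_add |].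
by rewrite -vertex_eltE; apply: V_ideal.
Qed.

(** The map sends 1 to the sum of the eps, in general not 1; it embeds a corner, which is why it is
    not given as an [alghom]. *)
Lemma norm_map_exists : exists psi : chain_alg k n -> A,
  [/\ {morph psi : a b / a + b}, {morph psi : a b / a * b},
      forall c, {morph psi : b / kscalar c * b >-> kscalar c * b},
      forall v, psi (idem (@chain_rel k n) v) = eps (v : 'I_n)
    & forall u v (a : @arrow (chain_quiver n) u v),
        psi (arrow_class (@chain_rel k n) a) = d (v : 'I_n) 0 * eps (u : 'I_n)].
Proof.
pose e (v : chain_quiver n) : A := eps (v : 'I_n).
pose x (u v : chain_quiver n) (a : @arrow (chain_quiver n) u v) : A :=
  d (v : 'I_n) 0 * eps (u : 'I_n).
have e_mul u v : e u * e v = if u == v then e u else 0.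
  case: eqVneq => [->|nuv]; first by rewrite norm_idemM.
  by rewrite norm_orth.
have e_x u v a : e v * @x u v a = x u v a.
  case: a => uv; rewrite /e /x; move: (ltn_ord u); rewrite (eqP uv).
  exact: norm_face0.
have x_e u v a : @x u v a * e u = x u v a by rewrite /x -mulrA norm_idemM.
have x_rel u v (r : lincomb k u v) : chain_rel r ->
    \sum_(t <- r) kscalar t.1 * path_val e x t.2 = 0.
  move=> Rr; case: u v r / Rr => u v w b a; rewrite big_seq1 /= x_e kscalar1 mul1r.
  case: b a => vw [uv]; rewrite -(e_x u v (D uv)) mulrA x_e.
  rewrite /x -mulrA -/(e v) -[d v 0 * _]/(x u v (D uv)) e_x /x.
  by move: (ltn_ord u); rewrite (eqP uv) (eqP vw); exact: face0_face0_norm.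
exists (bound_val e x); split.
- exact: (bound_valD (R := @chain_rel k n) e_mul e_x x_rel).
- exact: (bound_valM (R := @chain_rel k n) e_mul e_x x_rel).
- exact: (bound_valZ (R := @chain_rel k n) e_mul e_x x_rel).
- exact: (bound_val_idem (R := @chain_rel k n) e_mul e_x x_rel).
- exact: (bound_val_arrow (R := @chain_rel k n) e_mul e_x x_e x_rel).
Qed.
End NormalizationIdempotent.

(** * Bijectivity *)

Section DoldKanBijective.
Context (k : idomainType) (n : nat).
Local Notation A := (simp_alg k n).
Local Notation B := (chain_alg k n).
Local Notation Q := (simp_quiver n).
Local Notation R := (@simp_rel k n).
Local Notation P := (DK_module k n).
Local Notation E := (end_op P).
Local Notation V := (vertex_elt k n).
Local Notation d := (face_elt k n).
Local Notation s := (degen_elt k n).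
Local Notation eps := (norm_idem k n).
Local Notation idB := (idem (@chain_rel k n)).
Local Notation g := (@bit_gen k n).

Context (phi : alghom A E).
Hypothesis phi_idem : forall v, phi (idem R v) = vertex_proj k v.
Hypothesis phi_arrow : forall u v (a : @arrow Q u v),
  phi (arrow_class R a) = arrow_map k a.

Lemma phiM a b p : phi (a * b) p = phi b (phi a p).
Proof. by rewrite rmorphM. Qed.

Lemma phi_vertex (v : 'I_n) x : phi (V v) (g x) = if size x == v then g x else 0.
Proof. by rewrite vertex_eltE phi_idem vertex_proj_gen. Qed.

Lemma phi_face (m i : nat) (h : lin P P) x : (m.+1 < n)%N -> (i <= m.+1)%N -> size x = m ->
  h (phi (d m i) (g x)) = face (@del k n P) i (fun y => h (g y)) x.
Proof.
move=> mn im sx; pose v : 'I_n := Ordinal (ltnW mn); pose u : 'I_n := Ordinal mn.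
have uv : u == v.+1 :> nat by exact: eqxx.
rewrite -[m]/(val v) (face_eltE k uv (im : (i <= u)%N)) phi_arrow.
by rewrite arrow_map_gen ?sx ?eqxx //; exact: ltnW.
Qed.

Lemma phi_degen (m i : nat) (h : lin P P) x : (m.+1 < n)%N -> (i <= m)%N -> size x = m.+1 ->
  h (phi (s m i) (g x)) = degen i (fun y => h (g y)) x.
Proof.
move=> mn im sx; pose v : 'I_n := Ordinal (ltnW mn); pose u : 'I_n := Ordinal mn.
have vu : u == v.+1 :> nat by exact: eqxx.
rewrite -[m]/(val v) (degen_eltE k vu (im : (i <= v)%N)) phi_arrow.
by rewrite arrow_map_gen ?sx ?eqxx.
Qed.

(* [nseq v true] encodes the nondegenerate top simplex. *)
Lemma phi_norm (v : 'I_n) x :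
  phi (eps v) (g x) = if x == nseq v true then g x else 0.
Proof.
case: ifP => [/eqP->|xv].
  apply/eqP; rewrite -subr_eq0 -[X in _ - X](_ : phi (V v) (g (nseq v true)) = _); last first.
    by rewrite phi_vertex size_nseq eqxx.
  rewrite -opprB oppr_eq0 -[_ - _]/((phi (V v) - phi (eps v) : E) _) -rmorphB.
  case: v => [[|m] mn] /=; first by rewrite subrr rmorph0.
  (* V - eps is a sum of terms s_i y_i. In the opposite algebra s_i acts first, and it kills the
     generator of the full simplex, which the codegeneracy makes degenerate. *)
  have [y ->] := norm_left k n m.
  rewrite rmorph_sum (big_morph (fun f : E => f _) (fun f f' => erefl) erefl) big1 // => i _.
  rewrite phiM (phi_degen _ mn (ltn_ord i)) /= ?size_nseq //.
  exact: (@degen_top _ i _ m.+1 (ltn_ord i)).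
rewrite -vertex_norm phiM phi_vertex; case: eqP => [sx|_]; last exact: raddf0.
have fx : false \in x.
  by apply: contraFT xv => /nseq_true; rewrite sx => /eqP.
(* A generator other than the top one is the image of a generator under a positive face, and
   positive faces are annihilated by eps. *)
have [i [x' [ix sx' ->]]] := false_skip_bit fx.
move: (ltn_ord v); rewrite -sx sx' => xn.
have := congr1 (fun f : E => f (g x')) (congr1 phi (face_norm k xn ix)).
by rewrite rmorph0 phiM (phi_face _ xn).
Qed.

Section NormMap.
Context (psi : B -> A).
Hypothesis psiD : {morph psi : a b / a + b}.
Hypothesis psiM : {morph psi : a b / a * b}.
Hypothesis psiZ : forall c, {morph psi : b / kscalar c * b}.
Hypothesis psi_idem : forall v, psi (idB v) = eps (v : 'I_n).
Hypothesis psi_arrow : forall u v (a : @arrow (chain_quiver n) u v),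
  psi (arrow_class (@chain_rel k n) a) = d (v : 'I_n) 0 * eps (u : 'I_n).

Local Notation top v := (g (nseq v true)).

Lemma psi0 : psi 0 = 0.
Proof. by apply: (addIr (psi 0)); rewrite -psiD !add0r. Qed.

Lemma top_idem (v w : 'I_n) : idB v *: top w = if v == w then top w else 0.
Proof.
have := bit_gen_graded k n (nseq w true); rewrite /graded count_nseq_true degree_idemE.
move=> tw; rewrite -[in LHS]tw scalerA idem_mul; case: eqP => [->|_]; first exact: tw.
exact: scale0r.
Qed.

Lemma lin_comb (h : lin P P) (c : 'I_n -> B) (x : 'I_n -> P) :
  h (\sum_v c v *: x v) = \sum_v c v *: h (x v).
Proof. by rewrite raddf_sum; apply: eq_bigr => v _; exact: linearZ. Qed.

(** On the top generators, which span a copy of B in P, [psi b] acts as right multiplication by b.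
    This is what makes the corner of A faithful to B. *)
Lemma phi_psi b (v : 'I_n) :
  phi (psi b) (top v) = \sum_(w : 'I_n) (idB v * b * idB w) *: top w.
Proof.
elim/bound_alg_rect: b v => [b c IHb IHc|c b IH||u|b c IHb IHc|u w a] v.
- rewrite psiD rmorphD -[LHS]/(phi _ _ + phi _ _) IHb IHc -big_split.
  by apply: eq_bigr => w _; rewrite mulrDr mulrDl scalerDl.
- rewrite psiZ phiM alghom_scalar -[phi (psi b) _]/(phi (psi b) (kscalar c *: top v)).
  rewrite linearZZ IH scaler_sumr; apply: eq_bigr => w _.
  by rewrite scalerA !mulrA kscalarC.
- by rewrite psi0 rmorph0 big1 // => w _; rewrite mulr0 mul0r scale0r.
- rewrite psi_idem phi_norm.
  have -> : (nseq v true == nseq u true) = (v == u).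
    by apply/eqP/eqP => [/(congr1 size)|->] //; rewrite !size_nseq => /val_inj.
  case: eqVneq => [<-|nuv]; last first.
    by rewrite big1 // => w _; rewrite idem_mul (negPf nuv) mul0r scale0r.
  rewrite (bigD1 v) //= big1 => [|w nw]; first by rewrite addr0 !idemM top_idem eqxx.
  by rewrite idemM idem_mul eq_sym (negPf nw) scale0r.
- rewrite psiM phiM IHb lin_comb.
  under eq_bigr => w _ do rewrite IHc scaler_sumr.
  rewrite exchange_big; apply: eq_bigr => w' _.
  under eq_bigr => w _ do rewrite scalerA.
  rewrite -scaler_suml; congr (_ *: _).
  rewrite -[c in RHS]mul1r -sum_idem mulr_suml !mulr_sumr mulr_suml.
  by apply: eq_bigr => w _; rewrite !mulrA -(mulrA _ (idB w) (idB w)) idemM.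
- case: a => uw; rewrite psi_arrow -(dBE k uw).
  under eq_bigr => w' _ do rewrite idB_dB.
  case: (eqVneq v w) uw => [<-|nvw] uw; last first.
    rewrite -vertex_face -mulrA phiM phi_vertex size_nseq.
    rewrite -[(v == w :> nat)]/(v == w) (negPf nvw) raddf0.
    by rewrite big1 // => w' _; rewrite mul0r scale0r.
  have un : (v.+1 < n)%N by rewrite -(eqP uw) ltn_ord.
  (* Followed by eps, the cochain is supported on the top simplex, so that d_0 reduces to the
     differential. *)
  rewrite phiM (phi_face _ un) ?size_nseq // face0_top => [|y fy]; last first.
    rewrite phi_norm; case: eqP fy => // ->.
    by rewrite mem_nseq andbF.
  have -> : true :: nseq v true = nseq u true by rewrite (eqP uw).
  rewrite phi_norm eqxx (bigD1 u) //= dB_idB eqxx big1 => [|w' nw].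
    have := bit_gen_graded k n (nseq u true); rewrite /graded count_nseq_true degree_idemE.
    move=> tu; rewrite addr0 /del -[in LHS]tu scalerA differential_idem.
    rewrite (bigD1 v) //= big1 ?addr0 // => v' nv; apply: dB0.
    by rewrite (eqP uw) eqSS eq_sym.
  by rewrite dB_idB (negPf nw) scale0r.
Qed.

(** Sums of words in degeneracies applied to the image of psi. It is shown to be the whole left
    ideal generated by that image. *)
Inductive degen_closure : A -> Prop :=
| Degen_psi b : degen_closure (psi b)
| Degen_add x y : degen_closure x -> degen_closure y -> degen_closure (x + y)
| Degen_degen m i x : (m.+1 < n)%N -> (i <= m)%N ->
    degen_closure x -> degen_closure (s m i * x).

Lemma degen_closure_scale c x : degen_closure x -> degen_closure (kscalar c * x).
Proof.
elim=> [b|y z _ IHy _ IHz|m i y mn im _ IH].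
- by rewrite -psiZ; exact: Degen_psi.
- by rewrite mulrDr; exact: Degen_add.
- by rewrite mulrA kscalarC -mulrA; exact: Degen_degen.
Qed.

Lemma psi_sum b : psi b = \sum_(v : 'I_n) eps v * psi b.
Proof.
rewrite -[b in LHS]mul1r -sum_idem mulr_suml (big_morph psi psiD psi0).
by apply: eq_bigr => v _; rewrite psiM psi_idem.
Qed.

Lemma degen_closure0 : degen_closure 0.
Proof. by rewrite -psi0; exact: Degen_psi. Qed.

Lemma degen_closure_sum (I : finType) (F : I -> A) :
  (forall i, degen_closure (F i)) -> degen_closure (\sum_i F i).
Proof.
by move=> F_in; elim/big_ind: _ => // *; [exact: degen_closure0 | exact: Degen_add].
Qed.

Lemma degen_closure_vertex m x : degen_closure x -> degen_closure (V m * x).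
Proof.
elim=> [b|y z _ IHy _ IHz|l i y ln il dy _].
- rewrite psi_sum mulr_sumr; apply: degen_closure_sum => v.
  rewrite mulrA -vertex_norm mulrA; have [->|nv] := eqVneq m v.
    by rewrite vertex_eltM vertex_norm -psi_idem -psiM; exact: Degen_psi.
  by rewrite vertex_elt_orth // !mul0r; exact: degen_closure0.
- by rewrite mulrDr; exact: Degen_add.
- rewrite -vertex_degen !mulrA; have [->|nl] := eqVneq m l.+1.
    by rewrite vertex_eltM vertex_degen; exact: Degen_degen.
  by rewrite vertex_elt_orth // !mul0r; exact: degen_closure0.
Qed.

(** The simplicial identities push d_j through the degeneracies until it cancels or reaches the
    image of psi, where positive faces vanish and d_0 stays inside. *)
Lemma degen_closure_face m j x : (m.+1 < n)%N -> (j <= m.+1)%N ->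
  degen_closure x -> degen_closure (d m j * x).
Proof.
move=> mn jm dx; elim: dx m j mn jm => [b|y z _ IHy _ IHz|l i y ln il dy IH] m j mn jm.
- rewrite psi_sum mulr_sumr; apply: degen_closure_sum => v; rewrite mulrA.
  have [ev|nv] := eqVneq m.+1 v; last first.
    rewrite -face_vertex -(mulrA _ (V _)) -vertex_norm (mulrA (V _)).
    by rewrite vertex_elt_orth // !(mul0r, mulr0); exact: degen_closure0.
  rewrite -ev; case: j jm => [|j] jm; last first.
    by rewrite face_norm // mul0r; exact: degen_closure0.
  pose w : 'I_n := Ordinal (ltnW mn).
  have vw : v == w.+1 :> nat by rewrite -ev.
  have -> : d m 0 * eps m.+1 = psi (arrow_class (@chain_rel k n)
      (D vw : @arrow (chain_quiver n) v w)) by rewrite psi_arrow ev.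
  by rewrite -psiM; exact: Degen_psi.
- by rewrite mulrDr; apply: Degen_add; [exact: IHy | exact: IHz].
- have [el|nl] := eqVneq m l; last first.
    rewrite -face_vertex -vertex_degen !mulrA -(mulrA _ (V _) (V _)) vertex_elt_orth //.
    by rewrite mulr0 !mul0r; exact: degen_closure0.
  subst l; rewrite mulrA.
  have [ij|] := boolP ((j == i) || (j == i.+1)).
    by rewrite face_degen_elt_id //; exact: degen_closure_vertex.
  rewrite negb_or => /andP[nji nji1].
  (* For m = 0 only s_0 with d_0 or d_1 can occur, and these are the cases where face and degeneracy
     cancel. *)
  have m_gt0 : (0 < m)%N by case: m i j il jm nji nji1 {IH mn ln} => [|//] [|//] [|[|]].
  case: m ln il mn jm m_gt0 IH => // m ln il mn jm _ IH.
  have [ji|ij] := leqP j i.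
    have lt_ji : (j < i)%N by rewrite ltn_neqAle nji.
    rewrite (face_degen_elt_lt k mn lt_ji il) -mulrA.
    case: i il ji lt_ji nji nji1 => // i il ji lt_ji nji nji1.
    apply: Degen_degen => //; first exact: ltnW.
    by apply: IH; [exact: ltnW | exact: leq_trans ji il].
  have gt_ji : (i.+1 < j)%N by rewrite ltn_neqAle eq_sym nji1.
  rewrite (face_degen_elt_gt k mn gt_ji jm) -mulrA.
  case: j jm ij nji nji1 gt_ji => // j jm ij nji nji1 gt_ji.
  apply: Degen_degen; [exact: ltnW | | apply: IH; [exact: ltnW | exact: jm]].
  by have := leq_trans gt_ji jm; rewrite !ltnS.
Qed.

Lemma degen_closure_mull a x : degen_closure x -> degen_closure (a * x).
Proof.
elim/bound_alg_rect: a x => [a b IHa IHb|c a IH||v|a b IHa IHb|u v a] x dx.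
- by rewrite mulrDl; apply: Degen_add; [exact: IHa | exact: IHb].
- by rewrite -mulrA; apply/degen_closure_scale/IH.
- by rewrite mul0r; exact: degen_closure0.
- by rewrite -vertex_eltE; exact: degen_closure_vertex.
- by rewrite -mulrA; apply/IHa/IHb.
- have un := ltn_ord u; have vn := ltn_ord v.
  case: a => i uv iu.
    rewrite -(face_eltE k uv iu); apply: degen_closure_face dx; rewrite -(eqP uv) //.
  rewrite -(degen_eltE k uv iu); apply: Degen_degen => //.
  by rewrite -(eqP uv).
Qed.

(** Since eps kills every degeneracy on its right, only the words without degeneracies survive. *)
Lemma norm_closure (v : 'I_n) x : degen_closure x -> exists b, eps v * x = psi b.
Proof.
elim=> [b|y z _ [b yb] _ [c zc]|m i y mn im _ [b yb]].
- by exists (idB v * b); rewrite psiM psi_idem.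
- by exists (b + c); rewrite mulrDr yb zc psiD.
- exists 0; rewrite psi0 mulrA.
  have [->|nv] := eqVneq (v : nat) m.+1; first by rewrite norm_degen // mul0r.
  by rewrite -norm_vertex -vertex_degen !mulrA -(mulrA _ (V _) (V _)) vertex_elt_orth //
    mulr0 !mul0r.
Qed.

Lemma norm_corner (v w : 'I_n) a : exists b, eps v * a * eps w = psi b.
Proof.
rewrite -mulrA; apply/norm_closure/degen_closure_mull.
by rewrite -psi_idem; exact: Degen_psi.
Qed.

Lemma top_coord (v w : 'I_n) (b : B) :
  (idB v * b * idB w) *: top w = 0 -> idB v * b * idB w = 0.
Proof.
have [t tE] : exists t : {j : 'I_n & summands j}, bits t = nseq w true.
  by apply: bits_surj; rewrite size_nseq.
have ew : idB (tag (tagged t)) = idB w.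
  by rewrite -degree_idemE -count_bits tE count_nseq_true degree_idemE.
move=> /(congr1 (fun p => coord p t)).
by rewrite -tE bit_genK coordZ coord_gen eqxx coord0 ew -(mulrA _ (idB w)) idemM.
Qed.

Lemma phi_psi_inj b : phi (psi b) = 0 -> b = 0.
Proof.
move=> pb; rewrite -[b]mulr1 -[b]mul1r -sum_idem mulr_suml mulr_suml big1 // => v _.
rewrite mulr_sumr big1 // => w _; apply: top_coord.
have := congr1 (fun f : E => phi (eps w) (f (top v))) pb.
rewrite phi_psi lin_comb -[RHS]/(phi (eps w) 0) raddf0 (bigD1 w) //= big1 => [|u nu].
  by rewrite phi_norm eqxx addr0.
rewrite phi_norm; case: eqP => [/(congr1 size)|_]; last by rewrite scaler0.
by rewrite !size_nseq => /val_inj uw; rewrite uw eqxx in nu.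
Qed.

Lemma phi_inj : injective phi.
Proof.
have ker_mull a b : phi b = 0 -> phi (a * b) = 0 by rewrite rmorphM => ->; rewrite mulr0.
have ker_mulr a b : phi a = 0 -> phi (a * b) = 0 by rewrite rmorphM => ->; rewrite mul0r.
have ker_norm (v w : 'I_n) a : phi a = 0 -> eps v * a * eps w = 0.
  move=> pa; have [b eb] := norm_corner v w a; rewrite eb.
  suff -> : b = 0 by rewrite psi0.
  by apply: phi_psi_inj; rewrite -eb; apply/ker_mulr/ker_mull.
(* The left factor is expanded over the ideal generated by the eps; [ker_all] does the same on the
   right, and taking 1 for that factor gives the claim. *)
have ker_left (w : 'I_n) x a : phi a = 0 -> x * a * eps w = 0.
  move=> pa; elim: (norm_ideal x) a pa => {x} [x [v ->]||x y _ IHx _ IHy|b x _ IH|b x _ IH] a pa.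
  - exact: ker_norm.
  - by rewrite !mul0r.
  - by rewrite !mulrDl IHx ?IHy ?addr0.
  - by rewrite -!mulrA (mulrA x) IH ?mulr0.
  - by rewrite -(mulrA x) IH // ker_mull.
have ker_all x a : phi a = 0 -> a * x = 0.
  move=> pa; elim: (norm_ideal x) a pa => {x} [x [w ->]||x y _ IHx _ IHy|b x _ IH|b x _ IH] a pa.
  - by rewrite -[a]mul1r ker_left.
  - by rewrite mulr0.
  - by rewrite mulrDr IHx ?IHy ?addr0.
  - by rewrite mulrA IH // ker_mulr.
  - by rewrite mulrA IH ?mul0r.
move=> a b ab; apply/eqP; rewrite -subr_eq0 -[a - b]mulr1; apply/eqP/ker_all.
by rewrite rmorphB ab subrr.
Qed.

Lemma phi_surj f : exists a, phi a = f.
Proof.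
have norm_surj (v w : 'I_n) (h : E) : exists a, phi (eps v) * h * phi (eps w) = phi a.
  have [t tE] : exists t : {j : 'I_n & summands j}, bits t = nseq w true.
    by apply: bits_surj; rewrite size_nseq.
  (* A morphism between top summands is right multiplication by an element of e_v B e_w, namely the
     coordinate at [top w] of the image of [top v]. *)
  exists (psi (idB v * coord (h (top v)) t * idB w)); apply: bit_gen_eq => x xn.
  rewrite -[LHS]/(phi (eps w) (h (phi (eps v) (g x)))) phi_norm.
  case: eqP => [->|xv]; last first.
    rewrite !raddf0 -!mulrA psiM phiM psi_idem phi_norm.
    by case: eqP => // _; rewrite raddf0.
  rewrite phi_psi (bigD1 w) //= big1 => [|u nu]; last first.
    rewrite !mulrA -(mulrA _ (idB w)) (@idem_mul _ (chain_quiver n) _ w u).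
    by rewrite eq_sym (negPf nu) mulr0 scale0r.
  rewrite addr0 !mulrA idemM -(mulrA _ (idB w)) idemM.
  have -> : idB v * coord (h (top v)) t = coord (h (top v)) t.
    by rewrite -coordZ -[idB v *: _]linearZZ top_idem eqxx.
  rewrite -scalerA top_idem eqxx (lin_genE (@summand_idemM k n) (phi (eps w))).
  rewrite (bigD1 t) //= big1 => [|t' nt].
    by rewrite addr0 -/(dk_gen k t) -bit_genK phi_norm tE eqxx.
  rewrite -/(dk_gen k t') -bit_genK phi_norm; case: eqP => [tt|_]; last by rewrite scaler0.
  by case/eqP: nt; apply: bits_inj; rewrite tt tE.
have surj_left v x (h : E) : exists a, phi (eps (v : 'I_n)) * h * phi x = phi a.
  elim: (norm_ideal x) h => {x} [x [w ->]||x y _ IHx _ IHy|b x _ IH|b x _ IH] h.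
  - exact: norm_surj.
  - by exists 0; rewrite !rmorph0 mulr0.
  - have [a1 e1] := IHx h; have [a2 e2] := IHy h.
    by exists (a1 + a2); rewrite !rmorphD mulrDr e1 e2.
  - have [a ea] := IH (h * phi b).
    by exists a; rewrite -ea rmorphM !mulrA.
  - have [a ea] := IH h.
    by exists (a * b); rewrite !rmorphM mulrA ea.
have surj_all x (h : E) : exists a, phi x * h = phi a.
  elim: (norm_ideal x) h => {x} [x [v ->]||x y _ IHx _ IHy|b x _ IH|b x _ IH] h.
  - by have [a ea] := surj_left v 1 h; exists a; rewrite -ea rmorph1 mulr1.
  - by exists 0; rewrite !rmorph0 mul0r.
  - have [a1 e1] := IHx h; have [a2 e2] := IHy h.
    by exists (a1 + a2); rewrite !rmorphD mulrDl e1 e2.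
  - have [a ea] := IH h.
    by exists (b * a); rewrite !rmorphM -mulrA ea.
  - have [a ea] := IH (phi b * h).
    by exists a; rewrite -ea rmorphM !mulrA.
by have [a ea] := surj_all 1 f; exists a; rewrite -ea rmorph1 mul1r.
Qed.
End NormMap.

Lemma dk_action_bijective : bijective phi.
Proof.
have [psi [psiD psiM psiZ psi_idem psi_arrow]] := norm_map_exists k n.
have phi_i := phi_inj psiD psiM psiZ psi_idem psi_arrow.
have /choice[f fK] := phi_surj psiD psiM psiZ psi_idem psi_arrow.
by exists f => // a; apply: phi_i; rewrite fK.
Qed.
End DoldKanBijective.

(** * The Dold-Kan correspondence *)

Section Normalization.
Context (k : idomainType) (n : nat) (A : lincat k).
Local Notation Q := (simp_quiver n).

Lemma joint_kernel_unique (X K : A) (S : forall Y : A, lhom X Y -> Prop) (i : lhom K X)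
    (T : A) (f g : lhom T K) :
  is_joint_kernel S i -> i \oc f = i \oc g -> f = g.
Proof.
move=> [i0 iU] fg; have [|h [_ hU]] := iU T (i \oc g).
  by move=> Y s Ss; rewrite lcompA i0 // lcomp0l.
by rewrite -(hU f fg) -(hU g).
Qed.

(** Kernels are iterated: the next map is restricted to the joint kernel of the previous ones. *)
Lemma finite_joint_kernel (I : finType) (X : A) (Y : I -> A) (f : forall t, lhom X (Y t)) :
  is_abelian A -> exists (K : A) (i : lhom K X), (forall t, f t \oc i = 0) /\
    forall (T : A) (g : lhom T X), (forall t, f t \oc g = 0) ->
      exists! h : lhom T K, i \oc h = g.
Proof.
move=> A_abelian.
have [K [i [i0 iU]]] : exists (K : A) (i : lhom K X),
    (forall t, t \in enum I -> f t \oc i = 0) /\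
    forall (T : A) (g : lhom T X), (forall t, t \in enum I -> f t \oc g = 0) ->
      exists! h : lhom T K, i \oc h = g.
  elim: (enum I) => [|t s [K [i [i0 iU]]]].
    exists X, (lid X); split=> // T g _; exists g.
    by split=> [|h <-]; rewrite l1comp.
  have [L [j [j0 jU]]] := abelian_kernel A_abelian (f t \oc i).
  exists L, (i \oc j); split=> [t'|T g g0].
    rewrite inE => /orP[/eqP->|t's]; first by rewrite lcompA j0.
    by rewrite lcompA i0 // lcomp0l.
  have [|h [ih hU]] := iU T g.
    by move=> t' t's; apply: g0; rewrite inE t's orbT.
  have [|l [jl lU]] := jU T h.
    by rewrite -lcompA ih g0 // mem_head.
  exists l; split; first by rewrite -lcompA jl.
  by move=> l' il'; apply: lU; apply/esym/hU; rewrite lcompA.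
exists K, i; split=> [t|T g g0]; first by rewrite i0 // mem_enum.
by apply: iU => t _; exact: g0.
Qed.

Lemma positive_joint_kernel (X : SimpObj n A) (u : 'I_n) : is_abelian A ->
  exists (K : A) (i : lhom K (X u)), is_joint_kernel (@positive_face k n A X u) i.
Proof.
move=> A_abelian.
(* The positive faces out of u as one finite family: a face index is at most u and hence below n,
   and pairs that name no positive face contribute the zero map. *)
pose f (vi : 'I_n * 'I_n) : lhom (X u) (X vi.1) :=
  if @eqP nat u vi.1.+1 is ReflectT uv then
    if @eqP bool (vi.2 <= u)%N true is ReflectT iu then
      if (0 < vi.2)%N then
        qrep_arrow X (@Pi n u vi.1 vi.2 (eqb_of_eq uv) iu : @arrow Q u vi.1)
      else 0
    else 0
  else 0.
have fE (v i : 'I_n) (uv : u == v.+1 :> nat) (iu : (i <= u)%N) : (0 < i)%N ->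
    f (v, i) = qrep_arrow X (Pi i uv iu : @arrow Q u v).
  move=> i0; rewrite /f /=; case: eqP => [uv'|]; last by rewrite (eqP uv).
  case: eqP => [iu'|]; last by rewrite iu.
  by rewrite i0 (bool_irrelevance (eqb_of_eq uv') uv) (bool_irrelevance iu' iu).
have [K [i [i0 iU]]] := finite_joint_kernel f A_abelian.
exists K, i; split=> [Y g []|T g g0].
  move=> v j uv ju j0; have jn := leq_ltn_trans ju (ltn_ord u).
  by have := i0 (v, Ordinal jn); rewrite (fE v (Ordinal jn) uv ju j0).
apply: iU => -[v j]; rewrite /f /=.
case: eqP => [uv|_]; last by rewrite lcomp0l.
case: eqP => [ju|_]; last by rewrite lcomp0l.
case: ifP => [j0|_]; last by rewrite lcomp0l.
exact: g0 (Positive_face X (eqb_of_eq uv) ju j0).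
Qed.

Lemma simp_face_face (X : SimpObj n A) (u v w : 'I_n) (i j : nat) (uv : u == v.+1 :> nat)
    (vw : v == w.+1 :> nat) (iu : (i <= u)%N) (jv : (j <= v)%N) (ju : (j <= u)%N)
    (iv : (i.-1 <= v)%N) : (j < i)%N ->
  qrep_arrow X (Pi j vw jv : @arrow Q v w) \oc qrep_arrow X (Pi i uv iu : @arrow Q u v) =
  qrep_arrow X (Pi i.-1 vw iv : @arrow Q v w) \oc qrep_arrow X (Pi j uv ju : @arrow Q u v).
Proof.
move=> ji; have := qrep_rel X (Rel_pi_pi k uv vw iu jv ju iv ji).
rewrite big_cons big_seq1 /= !lcomp1 scale1r scaleN1r => /eqP.
by rewrite subr_eq0 => /eqP.
Qed.

Lemma normalization_exists : is_abelian A ->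
  exists N : functor (SimpObj n A) (Chain n A), is_normalization N.
Proof.
move=> A_abelian.
have /dep_choice[K /dep_choice[i iK]] :=
  fun Xu : SimpObj n A * 'I_n => positive_joint_kernel Xu.1 Xu.2 A_abelian.
have i_inj X u (T : A) (f g : lhom T (K (X, u))) :
    i (X, u) \oc f = i (X, u) \oc g -> f = g.
  exact: joint_kernel_unique (iK (X, u)).
have i0 (X : SimpObj n A) (u v : 'I_n) j (uv : u == v.+1 :> nat) (ju : (j <= u)%N) :
    (0 < j)%N -> qrep_arrow X (Pi j uv ju : @arrow Q u v) \oc i (X, u) = 0.
  by move=> j0; apply: (proj1 (iK (X, u))); exact: Positive_face.
have dex (X : SimpObj n A) (u v : 'I_n) (a : chain_arrow u v) :
    exists h : lhom (K (X, u)) (K (X, v)),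
      i (X, v) \oc h = match a with D uv =>
        qrep_arrow X (Pi 0 uv (leq0n u) : @arrow Q u v) \oc i (X, u) end.
  case: a => uv.
  have [|h [hE _]] := proj2 (iK (X, v)) _
    (qrep_arrow X (Pi 0 uv (leq0n u) : @arrow Q u v) \oc i (X, u)); last by exists h.
  move=> Y f [w j vw jv j0]; have ju : (j.+1 <= u)%N by rewrite (eqP uv).
  (* For j > 0, d_j d_0 = d_0 d_(j+1), and d_(j+1) vanishes on the joint kernel. *)
  rewrite lcompA -[j in Pi j]/(j.+1.-1).
  rewrite -(@simp_face_face X u v w j.+1 0 uv vw ju (leq0n v)) //.
  by rewrite -lcompA i0 // lcomp0r.
pose dN X u v a := sval (cid (dex X u v a)).
have dNE X (u v : 'I_n) (uv : u == v.+1 :> nat) : i (X, v) \oc dN X u v (D uv) =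
    qrep_arrow X (Pi 0 uv (leq0n u) : @arrow Q u v) \oc i (X, u).
  by rewrite /dN; case: cid.
have dN_rel X u v (r : lincomb k (Q := chain_quiver n) u v) : chain_rel r ->
    \sum_(t <- r) t.1 *: @Defs.path_map k (chain_quiver n) A (fun u => K (X, u)) (dN X) _ _ t.2 = 0.
  move=> Rr; case: u v r / Rr => u v w b a; rewrite big_seq1 /= lcomp1 scale1r.
  case: a b => uv [vw]; apply: i_inj; rewrite lcompA dNE -lcompA dNE lcomp0r lcompA.
  (* The square is zero because d_0 d_0 = d_0 d_1 and d_1 is a positive face. *)
  have u1 : (1 <= u)%N by rewrite (eqP uv).
  by rewrite -(simp_face_face X uv vw u1 (leq0n v)) // -lcompA i0 // lcomp0r.
have fex (X Y : SimpObj n A) (f : morph X Y) u : exists h : lhom (K (X, u)) (K (Y, u)),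
    i (Y, u) \oc h = sval f u \oc i (X, u).
  have [|h [hE _]] := proj2 (iK (Y, u)) _ (sval f u \oc i (X, u)); last by exists h.
  move=> Z g [v j uv ju j0].
  by rewrite lcompA -(svalP f) -lcompA i0 // lcomp0r.
pose fN X Y f u := sval (cid (fex X Y f u)).
have fNE X Y f u : i (Y, u) \oc fN X Y f u = sval f u \oc i (X, u).
  by rewrite /fN; case: cid.
have fN_comm X Y f u v a : fN X Y f v \oc dN X u v a = dN Y u v a \oc fN X Y f u.
  case: a => uv; apply: i_inj; rewrite lcompA fNE -lcompA dNE !lcompA dNE.
  by rewrite (svalP f) -!lcompA fNE.
pose Nob (X : SimpObj n A) : Chain n A := MkQrep (dN_rel X).
pose Nmap (X Y : SimpObj n A) (f : morph X Y) : morph (Nob X) (Nob Y) :=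
  exist _ (fN X Y f) (fN_comm X Y f).
have N1 X : Nmap X X (idc X) = idc (Nob X).
  apply: sig_eq; apply: functional_extensionality_dep => u; apply: i_inj.
  by rewrite fNE /= l1comp lcomp1.
have NM (X Y Z : SimpObj n A) (g : morph Y Z) (f : morph X Y) :
    Nmap _ _ (compc g f) = compc (Nmap _ _ g) (Nmap _ _ f).
  apply: sig_eq; apply: functional_extensionality_dep => u; apply: i_inj.
  by rewrite fNE /= lcompA fNE -!lcompA fNE.
exists (Functor N1 NM), (fun X u => i (X, u)); split.
- by move=> X u; exact: (iK (X, u)).
- by move=> X u v uv; exact: dNE.
- by move=> X Y f u; exact: fNE.
Qed.

(* Joint kernels are unique up to isomorphism, so any functorial choice of joint
   kernels with compatible differentials is isomorphic to N.                   *)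
Lemma normalization_unique (C : category) (G : functor C (SimpObj n A))
    (W : functor C (Chain n A)) (N : functor (SimpObj n A) (Chain n A))
    (j : forall (c : C) (u : 'I_n), lhom (W c u) (G c u)) :
  is_normalization N ->
  (forall c u, is_joint_kernel (@positive_face k n A (G c) u) (j c u)) ->
  (forall c (u v : 'I_n) (uv : u == v.+1 :> nat),
     j c v \oc qrep_arrow (W c) (D uv : @arrow (chain_quiver n) u v) =
     qrep_arrow (G c) (Pi 0 uv (leq0n u) : @arrow Q u v) \oc j c u) ->
  (forall (c c' : C) (f : morph c c') u,
     j c' u \oc sval (fmap W f) u = sval (fmap G f) u \oc j c u) ->
  nat_iso (functor_comp N G) W.
Proof.
move=> [i [iK iD i_nat]] jK jD j_nat.
have /dep_choice[t tE] (cu : C * 'I_n) :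
    exists t : lhom (N (G cu.1) cu.2) (W cu.1 cu.2), j cu.1 cu.2 \oc t = i (G cu.1) cu.2.
  have [|t [tE _]] := proj2 (jK cu.1 cu.2) _ (i (G cu.1) cu.2); last by exists t.
  exact: (proj1 (iK _ _)).
have /dep_choice[s sE] (cu : C * 'I_n) :
    exists s : lhom (W cu.1 cu.2) (N (G cu.1) cu.2), i (G cu.1) cu.2 \oc s = j cu.1 cu.2.
  have [|s [sE _]] := proj2 (iK (G cu.1) cu.2) _ (j cu.1 cu.2); last by exists s.
  exact: (proj1 (jK _ _)).
have j_inj c u (T : A) (f g : lhom T (W c u)) : j c u \oc f = j c u \oc g -> f = g.
  exact: joint_kernel_unique (jK c u).
have i_inj c u (T : A) (f g : lhom T (N (G c) u)) :
    i (G c) u \oc f = i (G c) u \oc g -> f = g.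
  exact: joint_kernel_unique (iK (G c) u).
have tD c u v (a : @arrow (chain_quiver n) u v) :
    t (c, v) \oc qrep_arrow (N (G c)) a = qrep_arrow (W c) a \oc t (c, u).
  case: a => uv; apply: (j_inj c v).
  rewrite !lcompA (tE (c, v)) iD (jD c u v) -lcompA.
  by rewrite (tE (c, u)).
exists (fun c => exist _ (fun u => t (c, u)) (tD c) : qrep_hom (N (G c)) (W c)); split.
  move=> c; apply: (@qrep_hom_iso k (chain_quiver n) (@chain_rel k n) A
    (N (G c)) (W c) _ (fun u => s (c, u))) => u /=.
    by apply: (i_inj c u); rewrite lcompA (sE (c, u)) (tE (c, u)) lcomp1.
  by apply: (j_inj c u); rewrite lcompA (tE (c, u)) (sE (c, u)) lcomp1.
move=> c c' f; apply: sig_eq; apply: functional_extensionality_dep => u /=.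
apply: (j_inj c' u); rewrite lcompA (tE (c', u)) i_nat lcompA j_nat -lcompA.
by rewrite (tE (c, u)).
Qed.
End Normalization.

(** * The normalized complex of the induced simplicial object *)

Section Comparison.
Context (k : idomainType) (n : nat) (A : lincat k).
Local Notation SA := (simp_alg k n).
Local Notation B := (chain_alg k n).
Local Notation Q := (simp_quiver n).
Local Notation R := (@simp_rel k n).
Local Notation P := (DK_module k n).
Local Notation idx := {j : 'I_n & summands j}.
Local Notation idB := (idem (@chain_rel k n)).
Local Notation e := (@summand_idem k n).

Context (phi : alghom SA (end_op P)).
Hypothesis phi_idem : forall v, phi (idem R v) = vertex_proj k v.
Hypothesis phi_arrow : forall u v (a : @arrow Q u v),
  phi (arrow_class R a) = arrow_map k a.

Context (F : functor (Rep B A) (Rep SA A)).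
Context (q : forall (M : Rep B A) (s : idx), lhom (rep_ob (F M)) (rep_ob M)).
Context (p : forall (M : Rep B A) (s : idx), lhom (rep_ob M) (rep_ob (F M))).
Hypothesis qp : forall M, is_splitting (fun s => rep_act_hom M (e s)) (q M) (p M).
Hypothesis q_act : forall (M : Rep B A) a s,
  q M s \oc rep_act_hom (F M) a = \sum_t rep_act_hom M (mat (e := e) phi a s t) \oc q M t.
Hypothesis q_map : forall (M N : Rep B A) (f : morph M N) s,
  q N s \oc sval (fmap F f) = sval f \oc q M s.

Context (Vs : functor (Rep SA A) (SimpObj n A)) (Vc : functor (Rep B A) (Chain n A)).
Context (qs : forall (M : Rep SA A) (v : 'I_n), lhom (Vs M v) (rep_ob M)).
Context (ps : forall (M : Rep SA A) (v : 'I_n), lhom (rep_ob M) (Vs M v)).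
Hypothesis pqs : forall M v, ps M v \oc qs M v = lid (Vs M v).
Hypothesis qps : forall M (v : 'I_n), qs M v \oc ps M v = rep_act_hom M (idem R v).
Hypothesis Vs_arrow : forall (M : Rep SA A) (u v : Q) (a : arrow u v),
  qrep_arrow (Vs M) a = ps M v \oc rep_act_hom M (arrow_class R a) \oc qs M u.
Hypothesis Vs_map : forall (M N : Rep SA A) (f : morph M N) (v : 'I_n),
  sval (fmap Vs f) v = ps N v \oc sval f \oc qs M v.
Context (qc : forall (M : Rep B A) (v : 'I_n), lhom (Vc M v) (rep_ob M)).
Context (pc : forall (M : Rep B A) (v : 'I_n), lhom (rep_ob M) (Vc M v)).
Hypothesis pqc : forall M v, pc M v \oc qc M v = lid (Vc M v).
Hypothesis qpc : forall M (v : 'I_n), qc M v \oc pc M v = rep_act_hom M (idB v).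
Hypothesis Vc_arrow : forall (M : Rep B A) (u v : chain_quiver n) (a : arrow u v),
  qrep_arrow (Vc M) a = pc M v \oc rep_act_hom M (arrow_class (@chain_rel k n) a) \oc qc M u.
Hypothesis Vc_map : forall (M N : Rep B A) (f : morph M N) (v : 'I_n),
  sval (fmap Vc f) v = pc N v \oc sval f \oc qc M v.

Lemma q_vertex M s v : q M s \oc rep_act_hom (F M) (idem R v) = if tag s == v then q M s else 0.
Proof.
rewrite q_act; case: eqP => [sv|sv].
  rewrite (bigD1 s) //= big1 => [|t ts].
    rewrite /mat phi_idem -/(dk_gen k s) -bit_genK vertex_proj_gen size_bits sv eqxx.
    by rewrite bit_genK coord_gen eqxx addr0 (splitting_eq (qp M)).
  rewrite /mat phi_idem -/(dk_gen k s) -bit_genK vertex_proj_gen size_bits sv eqxx.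
  by rewrite bit_genK coord_gen (negPf ts) rep_act0 lcomp0l.
rewrite big1 // => t _.
rewrite /mat phi_idem -/(dk_gen k s) -bit_genK vertex_proj_gen size_bits.
have -> : (tag s == v :> nat) = false by apply/eqP => /val_inj.
by rewrite coord0 rep_act0 lcomp0l.
Qed.

Lemma idem_qs M v : rep_act_hom M (idem R v) \oc qs M v = qs M v.
Proof. by rewrite -qps -lcompA pqs lcomp1. Qed.

Lemma q_qs M s v : tag s != v -> q M s \oc qs (F M) v = 0.
Proof. by move=> sv; rewrite -idem_qs lcompA q_vertex (negPf sv) lcomp0l. Qed.

Local Notation g := (@bit_gen k n).

(* Identifies a morphism z into Vs (F M) u with a family of morphisms into M
   indexed by the bit sequences of length u.                                  *)
Definition components (M : Rep B A) (u : 'I_n) (Y : A) (z : lhom Y (Vs (F M) u)) :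
    hom_mod phi (hom_rep Y M) :=
  induced_map phi q (qs (F M) u \oc z : hom_rep Y (F M)).

Lemma components_gen M u Y (z : lhom Y (Vs (F M) u)) s :
  components z (dk_gen k s) = q M s \oc qs (F M) u \oc z.
Proof. by rewrite -lcompA; exact: (induced_map_gen phi qp). Qed.

Lemma components_inj M u Y (z z' : lhom Y (Vs (F M) u)) :
  (forall x, size x = u -> components z (g x) = components z' (g x)) -> z = z'.
Proof.
move=> zz; rewrite -[z]l1comp -[z']l1comp -pqs -!lcompA; congr (_ \oc _).
apply: (splitting_inj (qp M)) => s; rewrite !lcompA -!components_gen.
have [su|su] := eqVneq (tag s) u; first by rewrite -bit_genK zz // size_bits su.
by rewrite !components_gen q_qs // !lcomp0l.
Qed.

(** This transfers computations in [Vs (F M)] to the operators on cochains with values in the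
    B-module Hom(Y, M). *)
Lemma components_arrow M u v Y (a : @arrow Q u v) (z : lhom Y (Vs (F M) u)) x :
  size x = v ->
  components (qrep_arrow (Vs (F M)) a \oc z) (g x) =
    arrow_op a (fun y => components z (g y)) x.
Proof.
move=> xv; have xn : (size x < n)%N by rewrite xv.
have := arrow_map_gen (components z : lin P (hom_rep Y M)) a xn.
rewrite xv eqxx -phi_arrow => <-.
rewrite -[RHS]/((arrow_class R a *: components z) (g x)).
rewrite /components -(induced_map_act (@summand_idemM k n) qp q_act).
congr (induced_map phi q _ _).
by rewrite Vs_arrow !lcompA qps -rep_actM idem_path.
Qed.

Lemma components_map M N (f : morph M N) u Y (z : lhom Y (Vs (F M) u)) x : size x = u ->
  components (sval (fmap Vs (fmap F f)) u \oc z) (g x) = sval f \oc components z (g x).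
Proof.
move=> xu; have xn : (size x < n)%N by rewrite xu.
have [s _ <-] := idx_ofP xn; rewrite bit_genK !components_gen Vs_map.
rewrite !lcompA; congr (_ \oc _).
rewrite -(lcompA (q N s)) qps -(lcompA (q N s)) -(svalP (fmap F f)) lcompA q_map.
by rewrite -!lcompA idem_qs.
Qed.

Lemma components_graded M u Y (z : lhom Y (Vs (F M) u)) (v : 'I_n) :
  rep_act_hom M (idB v) \oc components z (g (nseq v true)) = components z (g (nseq v true)).
Proof.
have := bit_gen_graded k n (nseq v true).
rewrite /graded count_nseq_true degree_idemE => {2}<-.
by rewrite [in RHS]linearZZ.
Qed.

Lemma top_exists (v : 'I_n) : exists s : idx, bits s = nseq v true.
Proof. by apply: bits_surj; rewrite size_nseq. Qed.

Definition top_index (v : 'I_n) : idx := sval (cid (top_exists v)).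

Lemma bits_top v : bits (top_index v) = nseq v true.
Proof. by rewrite /top_index; case: cid. Qed.

Lemma tag_top v : tag (top_index v) = v.
Proof. by apply: ord_inj; rewrite -size_bits bits_top size_nseq. Qed.

Lemma idem_top v : e (top_index v) = idB v.
Proof.
by rewrite /summand_idem -degree_idemE -count_bits bits_top count_nseq_true degree_idemE.
Qed.

(* The inclusion of C_u as the summand of the nondegenerate top simplex. *)
Definition kappa (M : Rep B A) (u : 'I_n) : lhom (Vc M u) (Vs (F M) u) :=
  ps (F M) u \oc p M (top_index u) \oc qc M u.

Lemma idem_qc M v : rep_act_hom M (idB v) \oc qc M v = qc M v.
Proof. by rewrite -qpc -lcompA pqc lcomp1. Qed.

Lemma components_kappa M u Y (z : lhom Y (Vc M u)) x : size x = u ->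
  components (kappa M u \oc z) (g x) = if false \in x then 0 else qc M u \oc z.
Proof.
move=> xu; have xn : (size x < n)%N by rewrite xu.
have [s _ sx] := idx_ofP xn; rewrite -{1}sx bit_genK components_gen /kappa !lcompA.
have su : tag s = u by apply: ord_inj; rewrite -size_bits sx.
rewrite -(lcompA (q M s)) qps q_vertex su eqxx (proj1 (qp M)).
case: eqP => [st|st].
  rewrite -sx st bits_top mem_nseq andbF idem_top idem_qc //.
case: ifP => [_|xf]; first by rewrite !lcomp0l.
by case: st; apply: bits_inj; rewrite bits_top sx -xu; apply: nseq_true; rewrite xf.
Qed.

Lemma components0 M u Y x : components (0 : lhom Y (Vs (F M) u)) (g x) = 0.
Proof.
rewrite /components lcomp0r /= /extend_fun big1 // => s _.
by rewrite lcomp0r scaler0.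
Qed.

(** A positive face d_i reads off the components at the subsets missing i. Together these are all
    the proper subsets, and the full one is left over. *)
Lemma kappa_joint_kernel M u :
  is_joint_kernel (@positive_face k n A (Vs (F M)) u) (kappa M u).
Proof.
split=> [Y f [v i uv iu i0]|T h h0].
  case: i iu i0 => // i iu _; apply: components_inj => x xv.
  rewrite -[kappa M u]lcomp1 components_arrow // components0 /=.
  by rewrite components_kappa ?skip_bit_false // size_skip_bit xv (eqP uv).
have h_off x : size x = u -> false \in x -> components h (g x) = 0.
  move=> xu /false_skip_bit[i [x' [ix' xx' ->]]].
  (* The list x has an entry, so u is positive and [u.-1] is the degree in which the face lands. *)
  have un : (u.-1 < n)%N := leq_ltn_trans (leq_pred u) (ltn_ord u).
  pose v : 'I_n := Ordinal un.
  have uv : u == v.+1 :> nat by rewrite /= -xu xx'.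
  have x'v : size x' = v by rewrite /= -xu xx'.
  have iu : (i.+1 <= u)%N by rewrite -xu xx'.
  have := components_arrow (Pi i.+1 uv iu : @arrow Q u v) h x'v.
  by rewrite (h0 _ _ (Positive_face (Vs (F M)) uv iu (ltn0Sn i))) components0.
(* The top component is the only possible factorization; it lies in the image of [qc] because it is
   homogeneous of degree u. *)
exists (pc M u \oc (components h (g (nseq u true)) : lhom T (rep_ob M))); split.
  apply: components_inj => x xu; rewrite components_kappa //.
  case: ifPn => [xf|xf]; first by rewrite h_off.
  rewrite (nseq_true xf) xu lcompA qpc; exact: components_graded.
move=> h' h'E; rewrite -h'E components_kappa ?size_nseq // mem_nseq andbF.
by rewrite lcompA pqc l1comp.
Qed.

Lemma kappa_differential M (u v : 'I_n) (uv : u == v.+1 :> nat) :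
  kappa M v \oc qrep_arrow (Vc M) (D uv : @arrow (chain_quiver n) u v) =
  qrep_arrow (Vs (F M)) (Pi 0 uv (leq0n u) : @arrow Q u v) \oc kappa M u.
Proof.
have qcD : qc M v \oc qrep_arrow (Vc M) (D uv : @arrow (chain_quiver n) u v) =
    rep_act_hom M (differential k n) \oc qc M u.
  rewrite Vc_arrow !lcompA qpc -rep_actM -(dBE k uv) idB_dB eqxx.
  rewrite -[in RHS]idem_qc lcompA -rep_actM differential_idem (bigD1 v) //=.
  rewrite big1 ?addr0 // => v' nv; apply: dB0.
  by rewrite (eqP uv) eqSS eq_sym.
apply: components_inj => x xv; rewrite components_kappa // qcD.
rewrite components_arrow //=.
pose c' (y : seq bool) : hom_rep (Vc M u) M := if false \in y then 0 else qc M u.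
rewrite -[nochain _ _ _]/(face (@del k n (hom_rep (Vc M u) M)) 0 _ x).
rewrite (@eq_face _ _ 0 _ c') => [|y yx]; last first.
  by rewrite -[kappa M u]lcomp1 components_kappa ?lcomp1 // yx xv (eqP uv).
rewrite face0_top => [|y fy]; last by rewrite /c' fy.
by rewrite /c' inE /=; case: ifP => _; rewrite /del ?scaler0.
Qed.

Lemma kappa_natural M N (f : morph M N) u :
  kappa N u \oc sval (fmap Vc f) u = sval (fmap Vs (fmap F f)) u \oc kappa M u.
Proof.
apply: components_inj => x xu; rewrite components_kappa // components_map //.
rewrite -[kappa M u]lcomp1 components_kappa // lcomp1.
case: ifP => _; first by rewrite lcomp0r.
by rewrite Vc_map !lcompA qpc -(svalP f) -lcompA idem_qc.
Qed.

(** The idempotent of j cuts out of F M the summands s whose first index is j, and each of them is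
    the image of [e s], that is, a component of the complex. *)
Lemma vertex_summands M (j : 'I_n) :
  is_biproduct (fun s : summands j => Vc M (tag s)) (Vs (F M) j).
Proof.
pose tg (s : summands j) : idx := Tagged (fun j => summands j) s.
exists (fun s => ps (F M) j \oc p M (tg s) \oc qc M (tag s)).
exists (fun s => pc M (tag s) \oc q M (tg s) \oc qs (F M) j); split.
- move=> s; rewrite !lcompA -(lcompA _ (qs _ _)) qps -(lcompA _ (q M _)) q_vertex eqxx.
  rewrite -(lcompA _ (q M _)) (splitting_qp (qp M)) -lcompA.
  by rewrite -[rep_act_hom _ _]/(rep_act_hom M (idB (tag s))) idem_qc pqc.
- move=> s t st; rewrite !lcompA -(lcompA _ (qs _ _)) qps -(lcompA _ (q M _)) q_vertex eqxx.
  rewrite -(lcompA _ (q M _)) (proj1 (qp M)); case: eqP => [tt|_]; last by rewrite lcomp0r lcomp0l.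
  by case/eqP: st; move/eqP: tt; rewrite eq_Tagged => /eqP.
- have sum_tag (G : idx -> lhom (Vs (F M) j) (Vs (F M) j)) :
      \sum_s G s = \sum_i \sum_(t : summands i) G (Tagged (fun i => summands i) t).
    by rewrite sig_big_dep /=; apply: eq_bigr => -[].
  rewrite -[RHS](pqs (F M) j) -[qs (F M) j in RHS]l1comp -(proj2 (qp M)).
  rewrite lcomp_suml lcomp_sumr sum_tag (bigD1 j) //= [X in _ = _ + X]big1 => [|i ij].
    rewrite addr0; apply: eq_bigr => s _.
    rewrite !lcompA -(lcompA _ (qc _ _)) qpc; do 2!congr (_ \oc _).
    by rewrite -lcompA; congr (_ \oc _); exact: (splitting_pe (qp M) (tg s)).
  by rewrite big1 // => t _; rewrite -lcompA q_qs // !lcomp0r.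
Qed.

Lemma comparison (N : functor (SimpObj n A) (Chain n A)) :
  is_normalization N -> nat_iso (functor_comp N (functor_comp Vs F)) Vc.
Proof.
move=> N_norm; apply: (@normalization_unique k n A _ (functor_comp Vs F) Vc N kappa) N_norm _ _ _.
- exact: kappa_joint_kernel.
- exact: kappa_differential.
- exact: kappa_natural.
Qed.
End Comparison.

(** The index set J for Morita theory: at each vertex v it selects the single copy of P_v on the
    diagonal of T. *)
Definition top_set (k : idomainType) (n : nat) : {set {j : 'I_n & summands j}} :=
  [set top_index v | v : 'I_n].

Lemma top_set_sum (k : idomainType) (n : nat) :
  \sum_(s in top_set k n) summand_idem k s = 1.
Proof.
rewrite big_imset /= => [|u v _ _ uv]; last by rewrite -(tag_top u) uv tag_top.
by rewrite -sum_idem; apply: eq_big => // v _; rewrite idem_top.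
Qed.

Theorem proposition2p7 (k : idomainType) (k_PID : is_PID k) (n : nat) :
  exists phi : alghom (simp_alg k n) (end_op (DK_module k n)),
  [/\ bijective phi,
      forall (j : 'I_n) (p : DK_module k n),
        phi (idem (@simp_rel k n) j) p = fun s => if tag s == j then p s else 0,
      exists fg : forall M : fgmod (chain_alg k n), fin_gen (hom_mod phi M),
        is_equivalence (hom_functor fg)
    & forall A : lincat k, is_abelian A ->
      exists (F : functor (Rep (chain_alg k n) A) (Rep (simp_alg k n) A))
             (Vs : functor (Rep (simp_alg k n) A) (SimpObj n A))
             (Vc : functor (Rep (chain_alg k n) A) (Chain n A))
             (N : functor (SimpObj n A) (Chain n A)),
      [/\ is_induced phi F,
          is_vertex_functor Vs /\ is_vertex_functor Vc,
          is_normalization N,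
          [/\ is_equivalence F, is_equivalence Vs, is_equivalence Vc
            & is_equivalence N]
        & nat_iso (functor_comp N (functor_comp Vs F)) Vc /\
          forall (C : Rep (chain_alg k n) A) (j : 'I_n),
            is_biproduct (fun s : summands j => Vc C (tag s)) (Vs (F C) j)]].
Proof.
have [phi [phi_idem phi_arrow]] := dk_action_exists k n.
have phi_bij := dk_action_bijective phi_idem phi_arrow.
have ee := @summand_idemM k n.
exists phi; split.
- exact: phi_bij.
- by move=> j p; rewrite phi_idem; exact: vertex_projE.
- exact: (hom_functor_equivalence ee (top_set_sum k n) phi_bij).
move=> A A_abelian.
have [F [q [p [qp q_act q_map]]]] := sum_functor_exists ee phi A_abelian.
have [Vs Vs_vertex] := vertex_functor_exists (@simp_rel k n) A_abelian.
have [Vc Vc_vertex] := vertex_functor_exists (@chain_rel k n) A_abelian.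
have [N N_norm] := normalization_exists n A_abelian.
have F_eq := sum_functor_equivalence ee qp q_act q_map phi_bij (top_set_sum k n) A_abelian.
have Vs_eq := vertex_equivalence A_abelian Vs_vertex.
have Vc_eq := vertex_equivalence A_abelian Vc_vertex.
have [qs [ps [pqs qps Vs_arrow Vs_map]]] := Vs_vertex.
have [qc [pc [pqc qpc Vc_arrow Vc_map]]] := Vc_vertex.
have NVsF := comparison phi_idem phi_arrow qp q_act q_map pqs qps Vs_arrow Vs_map
  pqc qpc Vc_arrow Vc_map N_norm.
exists F, Vs, Vc, N; split=> //.
- exact: (sum_functor_induced ee qp q_act q_map).
(* Normalization composed with an equivalence is isomorphic to the equivalence [Vc], so it is an
   equivalence itself. *)
- by split=> //; exact: (is_equivalence_cancel NVsF (is_equivalence_comp Vs_eq F_eq) Vc_eq).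
- split=> // C j; exact: (vertex_summands phi_idem qp q_act pqs qps pqc qpc).
Qed.
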